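(* Assume that $|b_k(\phi)|=O(k^{-(1+\delta)})$ as $k\to\infty$ for some $\delta>0$. Under $\mathcal{H}_0:\mathrm{P}_1=\cdots=\mathrm{P}_c$ and as $N\to\infty$, $$T_{N,c}^{\phi}\ \rightsquigarrow\ T_{\infty,c}^{\phi}:=\sum_{k=1}^\infty2^{-1}b_k(\phi)Y_k,$$ where $\{Y_k\sim\chi^2_{2(c-1)}:k\ge1\}$ is a collection of mutually independent chi-squared distributed random variables.
   Context: Setting. Fix $c\ge2$. For $\ell=1,\ldots,c$, the $\ell$th sample consists of angles $\Theta_1^{(\ell)},\ldots,\Theta_{n_\ell}^{(\ell)}\in[0,2\pi)$, each distributed according to an absolutely continuous distribution $\mathrm{P}_\ell$ on the circle; all observations (within and across samples) are mutually independent. $n_\ell\ge2$ for all $\ell$ and $N:=\sum_{\ell=1}^c n_\ell$. Uniform scores. $r_i^{(\ell)}\in\{1,\ldots,N\}$ is the rank of $\Theta_i^{(\ell)}$ in the pooled sample of size $N$ (ties have probability zero) and $c_i^{(\ell)}:=2\pi r_i^{(\ell)}/N$ is its uniform score. Kernel. $\phi:[-1,1]\to\mathbb{R}$ is square integrable with respect to the weight $(1-t^2)^{-1/2}$, with Chebyshev coefficients $b_k(\phi)=\frac{2}{\pi(1+\delta_{k0})}\int_{-1}^1\phi(t)\cos(k\cos^{-1}t)(1-t^2)^{-1/2}\,\mathrm{d}t$ satisfying $b_0(\phi)=0$ and $\sum_{k\ge1}|b_k(\phi)|<\infty$, and $\phi(\cos\theta)=\sum_{k\ge1}b_k(\phi)\cos(k\theta)$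 for all $\theta$ (so $\phi$ is continuous). Statistic. $T_{N,c}^{\phi}:=\sum_{\ell=1}^c\frac1{n_\ell}\sum_{i,j=1}^{n_\ell}\phi(\cos(c_i^{(\ell)}-c_j^{(\ell)}))$. Asymptotic regime. $N\to\infty$ with $c$ fixed and $\pi_{\ell,N}:=n_\ell/N\to\pi_\ell\in(0,1)$ for all $\ell=1,\ldots,c$. The symbol $\rightsquigarrow$ denotes weak convergence (convergence in distribution). *)

(* Defs.v *)
From HB Require Import structures.
From mathcomp Require Import all_boot all_order all_algebra.
From mathcomp Require Import all_classical all_reals all_analysis.
Set Implicit Arguments.
Unset Strict Implicit.
Unset Printing Implicit Defensive.
Import Order.TTheory GRing.Theory Num.Theory.
Import numFieldNormedType.Exports.
Local Open Scope classical_set_scope.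
Local Open Scope ring_scope.

(* Mutual independence: the product rule over every finite subfamily.  The
   index set may be infinite. *)
Definition mutually_independent (R : realType) (d : measure_display)
    (T : measurableType d) (P : probability T R) (I : eqType)
    (X : I -> {RV P >-> R}) : Prop :=
  forall (s : seq I) (B : I -> set R), uniq s ->
    (forall i, measurable (B i)) ->
    P [set w | forall i, i \in s -> B i (X i w)]
      = (\prod_(i <- s) P (X i @^-1` B i))%E.

(* Two measures on the line agree as measures: only Borel sets are compared. *)
Definition same_law (R : realType) (mu nu : set R -> \bar R) : Prop :=
  forall B : set R, measurable B -> mu B = nu B.

Definition euler_gamma (R : realType) (a : R) : R :=
  (\int[lebesgue_measure]_(t in `]0, +oo[) (t `^ (a - 1) * expR (- t)))%R.

(* Chi-squared distribution with [nu > 0] degrees of freedom. *)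
Definition chi2_pdf (R : realType) (nu : nat) (x : R) : R :=
  if 0 < x then
    x `^ (nu%:R / 2 - 1) * expR (- (x / 2))
      / (2 `^ (nu%:R / 2) * euler_gamma (nu%:R / 2))
  else 0.

Definition chi2_prob (R : realType) (nu : nat) : set R -> \bar R :=
  fun V => (\int[lebesgue_measure]_(x in V) (chi2_pdf nu x)%:E)%E.

(* Weak convergence, tested against bounded continuous functions.  The [X m]
   may live on different probability spaces.  [X m] and [Y] are plain
   functions, so this is meaningful when they are measurable. *)
Definition cvg_in_distribution (R : realType) (d : nat -> measure_display)
    (T : forall m, measurableType (d m)) (P : forall m, probability (T m) R)
    (X : forall m, T m -> R)
    (d' : measure_display) (T' : measurableType d') (Q : probability T' R)
    (Y : T' -> R) : Prop :=
  forall f : R -> R, continuous f -> (exists M : R, forall x, `|f x| <= M) ->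
    ('E_(P m)[f \o X m] @[m --> \oo] --> 'E_Q[f \o Y])%E.

(* Total in [t]: the weight is 0 at -1 and 1, which is a null set. *)
Definition chebyshev_weight (R : realType) (t : R) : R :=
  (Num.sqrt (1 - t ^+ 2))^-1.

Definition chebyshev_square_integrable (R : realType) (phi : R -> R) : Prop :=
  measurable_fun (`[(-1)%R, 1%R]%classic : set R) phi /\
  lebesgue_measure.-integrable (`[(-1)%R, 1%R]%classic : set R)
    (fun t : R => (phi t ^+ 2 * chebyshev_weight t)%:E).

Definition chebyshev_coef (R : realType) (phi : R -> R) (k : nat) : R :=
  2 / (pi * (1 + (k == 0%N)%:R)) *
  (\int[lebesgue_measure]_(t in `[(-1)%R, 1%R])
     (phi t * cos (k%:R * acos t) * chebyshev_weight t))%R.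

Definition pooled_size (c : nat) (n : 'I_c -> nat) : nat :=
  (\sum_(l < c) n l)%N.

(* Rank from 1 to N, counting the pooled observations that are not larger. *)
Definition pooled_rank (R : realType) (c : nat) (n : 'I_c -> nat)
    (theta : forall l : 'I_c, 'I_(n l) -> R) (l : 'I_c) (i : 'I_(n l)) : nat :=
  (\sum_(l' < c) \sum_(j < n l') (theta l' j <= theta l i)%R)%N.

Definition uniform_score (R : realType) (c : nat) (n : 'I_c -> nat)
    (theta : forall l : 'I_c, 'I_(n l) -> R) (l : 'I_c) (i : 'I_(n l)) : R :=
  2 * pi * (pooled_rank theta i)%:R / (pooled_size n)%:R.

Definition uniform_scores_stat (R : realType) (phi : R -> R) (c : nat)
    (n : 'I_c -> nat) (theta : forall l : 'I_c, 'I_(n l) -> R) : R :=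
  \sum_(l < c) (n l)%:R^-1 *
    \sum_(i < n l) \sum_(j < n l)
      phi (cos (uniform_score theta i - uniform_score theta j)).

(* Main.v *)
Require Import Defs.
From HB Require Import structures.
From mathcomp Require Import all_boot all_order all_algebra all_fingroup.
From mathcomp Require Import all_classical all_reals all_analysis.
From mathcomp Require Import measurable_realfun ring lra.
Set Implicit Arguments.
Unset Strict Implicit.
Unset Printing Implicit Defensive.
Import Order.TTheory GRing.Theory Num.Theory.
Import numFieldNormedType.Exports.

(** Under the null hypothesis the pooled ranks form a uniformly distributed
    random permutation ([expectation_rank]), so the statistic is a function of
    one random permutation. Inserting the Chebyshev series of the kernel and
    expanding [cos (k (x - y))] turns it into the series [\sum_k b_k S_k], where
    [S_k >= 0] is the sum over the samples of the squared moduli of the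
    normalised Fourier sums of the uniform scores at frequency [k]
    ([freq_stat]). The limit is the same series with [Y_k / 2] in place of
    [S_k], and the two series are compared through Laplace transforms.

    Finitely many frequencies. Exchanging the values at two random places gives
    an exchangeable pair of permutations. Used in Stein's method for [S_k] and
    [f = exp (- \sum_j w_j S_j)], together with the orthogonality of the
    trigonometric functions on the roots of unity, it gives
    [(1 + w_k) E (f S_k) = (c - 1) E f + O(N ^ (- 1 / 2))]
    ([stein_quad_stat], [freq_stat_stein]). This is a linear differential
    equation in [w_k]; integrating it one frequency at a time shows that [E f]
    tends to [\prod_k (1 + w_k) ^ (- (c - 1))] ([laplace_freq_stat]), the
    Laplace transform of independent halves of chi-squared variables with
    [2 (c - 1)] degrees of freedom ([chi2_laplace]).

    Infinitely many frequencies. Separating the positive and the negative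
    coefficients writes the series as [A - B] with [A] and [B] nonnegative.
    Truncating it at frequency [K] changes the joint Laplace transform of
    [(A, B)] by at most a multiple of the mean of the tail
    [\sum_(k > K) `|b_k| S_k]. The means of the [S_k] are uniformly bounded, except
    when [N] divides [k], where only [S_k <= 2 N] is available; the decay of the
    coefficients makes [N \sum_j `|b_(j N)|] vanish in the limit
    ([mean_tail_le]). Hence the joint Laplace transforms converge to that of the
    limit ([cvg_rank_laplace], [gamma_series_limit]).

    Weak convergence. The coefficients have no fixed sign, so [A - B] itself need
    not have a Laplace transform. Instead, [f (A - B)] with [f] bounded and
    continuous is, by Bernstein's form of the Weierstrass theorem in the
    variables [exp (- A)] and [exp (- B)], a linear combination of the functions
    [exp (- (i A + j B))] up to a small constant and a small multiple of [A + B]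
    ([exp_sum_approx]). Since the means of [A + B] stay bounded, this gives the
    convergence of [E f (A - B)] ([cvg_of_laplace]). *)

Local Open Scope ring_scope.

(** * The uniform permutation and its exchangeable pair *)

Section PermMean.
Context {R : realType} {I : finType}.
Implicit Types F G : {perm I} -> R.

Definition perm_mean F : R := (#|{perm I}|%:R)^-1 * \sum_s F s.

Let card_perm_gt0 : 0 < #|{perm I}|%:R :> R.
Proof. by rewrite ltr0n; apply/card_gt0P; exists 1%g. Qed.

Lemma perm_mean_cst k : perm_mean (fun=> k) = k.
Proof.
rewrite /perm_mean sumr_const -[k *+ _]mulr_natl mulrA mulVf ?mul1r//.
by rewrite gt_eqF.
Qed.

Lemma perm_meanD F G : perm_mean (fun s => F s + G s) = perm_mean F + perm_mean G.
Proof. by rewrite /perm_mean big_split mulrDr. Qed.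

Lemma perm_meanZ k F : perm_mean (fun s => k * F s) = k * perm_mean F.
Proof. by rewrite /perm_mean -mulr_sumr mulrCA. Qed.

Lemma perm_meanN F : perm_mean (fun s => - F s) = - perm_mean F.
Proof. by rewrite /perm_mean sumrN mulrN. Qed.

Lemma perm_meanB F G : perm_mean (fun s => F s - G s) = perm_mean F - perm_mean G.
Proof. by rewrite perm_meanD perm_meanN. Qed.

Lemma perm_mean_sum (J : Type) (r : seq J) (P : pred J) (F : J -> {perm I} -> R) :
  perm_mean (fun s => \sum_(j <- r | P j) F j s)
  = \sum_(j <- r | P j) perm_mean (F j).
Proof. by rewrite /perm_mean exchange_big mulr_sumr. Qed.

Lemma eq_perm_mean F G : F =1 G -> perm_mean F = perm_mean G.
Proof. by move=> FG; rewrite /perm_mean (eq_bigr _ (fun s _ => FG s)). Qed.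

Lemma le_perm_mean F G : (forall s, F s <= G s) -> perm_mean F <= perm_mean G.
Proof.
by move=> FG; rewrite /perm_mean ler_pM2l ?invr_gt0//; apply: ler_sum => s _.
Qed.

Lemma ler_norm_perm_mean F : `|perm_mean F| <= perm_mean (fun s => `|F s|).
Proof.
rewrite /perm_mean normrM gtr0_norm ?invr_gt0// ler_pM2l ?invr_gt0//.
exact: ler_norm_sum.
Qed.

(** Composing with a transposition permutes the permutations, so a uniform
    permutation and its image under a transposition have the same law. *)
Lemma perm_mean_swap (i j : I) F :
  perm_mean (fun s => F (tperm i j * s)%g) = perm_mean F.
Proof.
rewrite /perm_mean; congr (_ * _).
rewrite [RHS](reindex_inj (h := fun s => tperm i j * s)%g)//.
exact: mulgI.
Qed.

(** Since [s] and [tperm i j * s] are exchangeable, the antisymmetric expression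
    [(G s' - G s) * (H s' + H s)] has mean zero; expanding
    [H s' + H s = 2 H s + (H s' - H s)] gives the identity. Stein's method uses
    it to trade the drift of [G] for a covariance of increments. *)
Lemma exchangeable_pair (G H : {perm I} -> R) :
  2 * perm_mean (fun s => H s * \sum_i \sum_j (G (tperm i j * s)%g - G s)) =
  - perm_mean (fun s => \sum_i \sum_j
      (G (tperm i j * s)%g - G s) * (H (tperm i j * s)%g - H s)).
Proof.
have sw i j : perm_mean (fun s => (G (tperm i j * s)%g - G s) * H (tperm i j * s)%g)
   = - perm_mean (fun s => (G (tperm i j * s)%g - G s) * H s).
  rewrite -perm_meanN -(perm_mean_swap i j); apply: eq_perm_mean => s.
  by rewrite mulgA tperm2 mul1g -mulNr opprB.
have -> : perm_mean (fun s => H s * \sum_i \sum_j (G (tperm i j * s)%g - G s)) =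
   \sum_i \sum_j perm_mean (fun s => (G (tperm i j * s)%g - G s) * H s).
  under [RHS]eq_bigr do rewrite -perm_mean_sum.
  rewrite -perm_mean_sum; apply: eq_perm_mean => s.
  rewrite mulr_sumr; apply: eq_bigr => i _; rewrite mulr_sumr.
  by apply: eq_bigr => j _; rewrite mulrC.
rewrite perm_mean_sum.
under [in RHS]eq_bigr do rewrite perm_mean_sum.
rewrite -sumrN mulr_sumr; apply: eq_bigr => i _.
rewrite -sumrN mulr_sumr; apply: eq_bigr => j _.
under [in RHS]eq_perm_mean do rewrite mulrBr.
rewrite perm_meanB sw; ring.
Qed.

End PermMean.

Section LabelSum.
Context {R : realType} {I : finType} {c : nat} (lab : I -> 'I_c).
Implicit Types (z y : I -> R) (s : {perm I}) (l : 'I_c).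

Definition labeled l (i : I) : R := (lab i == l)%:R.

Definition label_sum l z s : R := \sum_i labeled l i * z (s i).

Definition label_step l z s (i j : I) : R :=
  (labeled l i - labeled l j) * (z (s j) - z (s i)).

Lemma label_sum_swap l z s i j :
  label_sum l z (tperm i j * s)%g = label_sum l z s + label_step l z s i j.
Proof.
rewrite /label_step; have [->|ij] := eqVneq i j.
  by rewrite tperm1 mul1g !subrr mul0r addr0.
rewrite /label_sum (reindex_inj (@perm_inj _ (tperm i j)))/=.
rewrite (bigD1 i)//= (bigD1 j)/=; last by rewrite eq_sym.
rewrite [in RHS](bigD1 i)//= [in RHS](bigD1 j)/=; last by rewrite eq_sym.
rewrite !permM tpermL tpermR tpermL.
rewrite (eq_bigr (fun u => labeled l u * z (s u))).
  by ring.
by move=> u /andP[ui uj]; rewrite permM !tpermD// eq_sym.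
Qed.

Lemma sum_perm z s : \sum_i z (s i) = \sum_i z i.
Proof. by rewrite [RHS](reindex_inj (@perm_inj _ s)). Qed.

Lemma sum_label l : \sum_i labeled l i = #|[pred i | lab i == l]|%:R.
Proof.
rewrite /labeled -natr_sum -sum1_card [in RHS]big_mkcond/=.
by congr (_%:R); apply: eq_bigr => i _; rewrite inE; case: eqP.
Qed.

Lemma sum_sum_mul (f g : I -> R) :
  \sum_i \sum_j f i * g j = (\sum_i f i) * (\sum_i g i).
Proof. by rewrite big_distrlr. Qed.

(** The drift is proportional to the statistic itself. This linear regression
    property is what makes random transpositions useful here. *)
Lemma sum_label_step l z s : \sum_i z i = 0 ->
  \sum_i \sum_j label_step l z s i j = - (2 * #|I|%:R) * label_sum l z s.
Proof.
move=> z0; pose e := labeled l; pose y u := z (s u).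
have y0 : \sum_i y i = 0 by rewrite /y sum_perm.
pose f i j := e i * y j - (e i * y i) * 1.
have -> : \sum_i \sum_j label_step l z s i j = \sum_i \sum_j (f i j + f j i).
  by apply: eq_bigr => i _; apply: eq_bigr => j _; rewrite /label_step /f /y /e; ring.
have -> : \sum_i \sum_j (f i j + f j i) = 2 * \sum_i \sum_j f i j.
  under eq_bigr do rewrite big_split.
  by rewrite big_split/= [X in _ + X]exchange_big/=; ring.
rewrite /f; under eq_bigr do rewrite big_split/= sumrN.
rewrite big_split/= sumrN !sum_sum_mul y0 mulr0 sumr_const.
by rewrite /label_sum -/e -/y; ring.
Qed.

(** The product of two increments is the symmetrisation of a sum [f i j] of
    products of a function of [i] and a function of [j], so that the double
    sum factors; most terms vanish because the scores are centred. *)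
Lemma sum_label_step2 l m z z' s : \sum_i z i = 0 -> \sum_i z' i = 0 ->
  \sum_i \sum_j label_step l z s i j * label_step m z' s i j =
  2 * ((l == m)%:R * (#|[pred i | lab i == l]|%:R * (\sum_i z i * z' i)
                      + #|I|%:R * label_sum l (fun u => z u * z' u) s)
       - #|[pred i | lab i == l]|%:R * label_sum m (fun u => z u * z' u) s
       - #|[pred i | lab i == m]|%:R * label_sum l (fun u => z u * z' u) s
       + label_sum l z s * label_sum m z' s
       + label_sum l z' s * label_sum m z s).
Proof.
move=> z0 z'0; pose e := labeled l; pose d := labeled m.
pose y u := z (s u); pose x u := z' (s u).
have y0 : \sum_i y i = 0 by rewrite /y sum_perm.
have x0 : \sum_i x i = 0 by rewrite /x sum_perm.
pose f i j := (e i * d i) * (y j * x j) + (e i * d i * (y i * x i)) * 1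
   - (e i * d i * x i) * y j - (e i * d i * y i) * x j
   - e i * (d j * (y j * x j)) - (e i * (y i * x i)) * d j
   + (e i * x i) * (d j * y j) + (e i * y i) * (d j * x j).
have -> : \sum_i \sum_j label_step l z s i j * label_step m z' s i j
    = \sum_i \sum_j (f i j + f j i).
  apply: eq_bigr => i _; apply: eq_bigr => j _.
  by rewrite /label_step -/e -/d -!/(y _) -!/(x _) /f; ring.
have -> : \sum_i \sum_j (f i j + f j i) = 2 * \sum_i \sum_j f i j.
  under eq_bigr do rewrite big_split.
  by rewrite big_split/= [X in _ + X]exchange_big/=; ring.
rewrite /f; under eq_bigr do rewrite !big_split/= !sumrN.
rewrite !big_split/= !sumrN !sum_sum_mul y0 x0 !mulr0 sumr_const.
have ed i : e i * d i = (l == m)%:R * e i.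
  rewrite /e /d /labeled; case: (eqVneq l m) => [->|lm].
    by case: eqP; rewrite ?mulr1 ?mulr0.
  by case: eqP => [->|]; rewrite ?(negbTE lm) ?mulr0 ?mul0r.
have -> : \sum_i e i * d i * (y i * x i) =
    (l == m)%:R * \sum_i e i * (y i * x i).
  by rewrite mulr_sumr; apply: eq_bigr => i _; rewrite ed -mulrA.
have -> : \sum_i e i * d i = (l == m)%:R * \sum_i e i.
  by rewrite mulr_sumr; apply: eq_bigr => i _; rewrite ed.
rewrite -!sum_label /label_sum -/e -/d -!/(y _) -!/(x _).
rewrite -(sum_perm (fun u => z u * z' u) s) -/y -/x.
ring.
Qed.

Lemma label_step_le l z s i j k : (forall u, `|z u| <= k) ->
  `|label_step l z s i j| <= 2 * k.
Proof.
move=> zk; rewrite /label_step normrM -[leRHS]mul1r; apply: ler_pM => //.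
  rewrite /labeled; case: eqP => _; case: eqP => _; rewrite ?subrr ?normr0//.
    by rewrite subr0 normr1.
  by rewrite sub0r normrN normr1.
by apply: (le_trans (ler_normB _ _)); have := zk (s i); have := zk (s j); lra.
Qed.

Let N : R := #|I|%:R.

Lemma sum_sum_cst (k : R) : \sum_(i : I) \sum_(j : I) k = k * N ^+ 2.
Proof. by rewrite !sumr_const -[LHS]mulr_natr -[k *+ _]mulr_natr -mulrA. Qed.

(** Balancing the drift [- 2 N Y] of [Y] against its squared increments, which
    are at most 4 for each of the [N ^+ 2] transpositions, gives
    [4 N E Y ^+ 2 <= 4 N ^+ 2]. *)
Lemma label_sum_sq_le l z : (0 < #|I|)%N -> (forall u, `|z u| <= 1) ->
  \sum_i z i = 0 -> perm_mean (fun s => label_sum l z s ^+ 2) <= N.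
Proof.
move=> I0 z1 z0; have N0 : 0 < N by rewrite ltr0n.
have := exchangeable_pair (label_sum l z) (label_sum l z).
have -> : perm_mean (fun s => label_sum l z s *
    (\sum_i \sum_j (label_sum l z (tperm i j * s)%g - label_sum l z s))) =
    - (2 * N) * perm_mean (fun s => label_sum l z s ^+ 2).
  rewrite -perm_meanZ; apply: eq_perm_mean => s.
  under eq_bigr do under eq_bigr do rewrite label_sum_swap (addrC _ (label_step _ _ _ _ _)) addrK.
  by rewrite sum_label_step// -/N; ring.
set X := perm_mean _; set Z := perm_mean _.
have : Z <= 4 * N ^+ 2.
  rewrite -(@perm_mean_cst R I (4 * N ^+ 2)); apply: le_perm_mean => s.
  apply: (@le_trans _ _ (\sum_(i : I) \sum_(j : I) 4)).
    apply: ler_sum => i _; apply: ler_sum => j _.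
    rewrite label_sum_swap (addrC _ (label_step _ _ _ _ _)) addrK.
    have := label_step_le l s i j z1; set w := label_step _ _ _ _ _.
    rewrite ler_norml => /andP[? ?]; nra.
  by rewrite sum_sum_cst; lra.
move=> ZN H; nra.
Qed.

(** The same balance for [Y] and [Y ^+ 3]: the increments of [Y ^+ 3] are
    quadratic in [Y], whose second moment is known. *)
Lemma label_sum_pow4_le l z : (0 < #|I|)%N -> (forall u, `|z u| <= 1) ->
  \sum_i z i = 0 -> perm_mean (fun s => label_sum l z s ^+ 4) <= 13 * N ^+ 2.
Proof.
move=> I0 z1 z0; have N1 : 1 <= N by rewrite ler1n.
have H2 := label_sum_sq_le l I0 z1 z0.
have := exchangeable_pair (label_sum l z) (fun s => label_sum l z s ^+ 3).
have -> : perm_mean (fun s => label_sum l z s ^+ 3 *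
    (\sum_i \sum_j (label_sum l z (tperm i j * s)%g - label_sum l z s))) =
    - (2 * N) * perm_mean (fun s => label_sum l z s ^+ 4).
  rewrite -perm_meanZ; apply: eq_perm_mean => s.
  under eq_bigr do under eq_bigr do rewrite label_sum_swap (addrC _ (label_step _ _ _ _ _)) addrK.
  by rewrite sum_label_step// -/N; ring.
set X := perm_mean _; set Z := perm_mean (fun s => \sum_i _).
have : Z <= perm_mean (fun s => (24 * label_sum l z s ^+ 2 + 28) * N ^+ 2).
  apply: le_perm_mean => s; set y := label_sum l z s.
  apply: (@le_trans _ _ (\sum_(i : I) \sum_(j : I) (24 * y ^+ 2 + 28))).
    apply: ler_sum => i _; apply: ler_sum => j _.
    rewrite label_sum_swap -/y (addrC _ (label_step _ _ _ _ _)) addrK.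
    have := label_step_le l s i j z1; set w := label_step _ _ _ _ _.
    rewrite mulr1 => w2.
    have {}w2 : w ^+ 2 <= 4.
      by move: w2; rewrite ler_norml => /andP[? ?]; nra.
    have -> : w * ((w + y) ^+ 3 - y ^+ 3) = w ^+ 2 * (w ^+ 2 + 3 * w * y + 3 * y ^+ 2) by ring.
    have w0 : 0 <= w ^+ 2 by exact: sqr_ge0.
    have y0 : 0 <= y ^+ 2 by exact: sqr_ge0.
    have h : w ^+ 2 + 3 * w * y + 3 * y ^+ 2 <= 7 + 6 * y ^+ 2.
      have : 0 <= (w - 2 * y) ^+ 2 by exact: sqr_ge0.
      have -> : (w - 2 * y) ^+ 2 = w ^+ 2 - 4 * w * y + 4 * y ^+ 2 by ring.
      by lra.
    have h0 : 0 <= 7 + 6 * y ^+ 2 by lra.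
    apply: (@le_trans _ _ (w ^+ 2 * (7 + 6 * y ^+ 2))).
      exact: ler_wpM2l.
    have := ler_wpM2r h0 w2; lra.
  by rewrite sum_sum_cst.
under eq_perm_mean do rewrite mulrC.
rewrite perm_meanZ perm_meanD perm_meanZ perm_mean_cst.
set V := perm_mean _ in H2 *.
move=> ZN H.
have : 4 * N * X = Z by lra.
have N2 : 0 < N ^+ 2 by rewrite exprn_gt0//; lra.
have : N ^+ 2 * (24 * V + 28) <= N ^+ 2 * (24 * N + 28) by rewrite ler_pM2l//; lra.
move=> h1 h2.
have h3 : N * (4 * X) <= N * (N * (24 * N + 28)) by lra.
have : 4 * X <= N * (24 * N + 28) by rewrite -(ler_pM2l (x := N))//; lra.
nra.
Qed.

End LabelSum.

(** * Stein's identity for quadratic statistics *)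

(** The remainder is bounded by the full square, with no exponential factor,
    because both arguments of the exponential are nonpositive. *)
Lemma expRN_taylor (R : realType) (u v : R) : 0 <= u -> 0 <= v ->
  `|expR (- v) - expR (- u) + expR (- u) * (v - u)| <= (v - u) ^+ 2.
Proof.
move=> u0 v0.
have eu : expR (- u) <= 1 by rewrite -expR0 ler_expR oppr_le0.
have ev : expR (- v) <= 1 by rewrite -expR0 ler_expR oppr_le0.
pose h := v - u.
have eE : expR (- v) = expR (- u) * expR (- h).
  by rewrite -expRD /h; congr expR; ring.
have lo : 0 <= expR (- h) - 1 + h by have := expR_ge1Dx (- h); lra.
have e0 : 0 < expR (- u) by exact: expR_gt0.
have -> : expR (- v) - expR (- u) + expR (- u) * (v - u)
  = expR (- u) * (expR (- h) - 1 + h) by rewrite eE -/h; ring.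
rewrite -/h ger0_norm; last by rewrite mulr_ge0// ltW.
have hh := expRxMexpNx_1 h; have eh0 := expR_gt0 h; have eNh0 := expR_gt0 (- h).
have [h0|h0] := leP 0 h.
  have : expR (- h) - 1 + h <= h ^+ 2 by have := expR_ge1Dx h; nra.
  by move=> ?; nra.
have E : expR (- u) * (expR (- h) - 1 + h) = expR (- v) * (1 - (1 - h) * expR h).
  rewrite eE -[RHS]mulrA; congr (_ * _).
  by rewrite mulrBr mulr1 mulrCA [expR (- h) * _]mulrC hh; ring.
have ge1 := expR_ge1Dx h.
have : 1 - (1 - h) * expR h <= h ^+ 2 by nra.
rewrite E; have := expR_gt0 (- v); have := sqr_ge0 h; nra.
Qed.

Section QuadStat.
Context {R : realType} {I : finType} {c : nat} (lab : I -> 'I_c).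

Definition label_card l : R := #|[pred i | lab i == l]|%:R.

(** For a trigonometric score this is the contribution of the cosine or of the
    sine to the squared moduli of the Fourier sums of the samples. *)
Definition quad_stat (z : I -> R) (s : {perm I}) : R :=
  \sum_l (label_card l)^-1 * label_sum lab l z s ^+ 2.

Lemma quad_stat_ge0 z s : 0 <= quad_stat z s.
Proof.
by apply: sumr_ge0 => l _; rewrite mulr_ge0 ?sqr_ge0// invr_ge0.
Qed.

Lemma sum_label_card : \sum_l label_card l = #|I|%:R :> R.
Proof.
rewrite /label_card; under eq_bigr do rewrite -(@sum_label R) /labeled.
rewrite exchange_big/=; under eq_bigr => i _.
  rewrite (bigD1 (lab i))//= eqxx big1 ?addr0; last first.
    by move=> l; rewrite eq_sym => /negbTE ->.
  over.
by rewrite sumr_const.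
Qed.

Lemma sum_label_sum (z : I -> R) s : \sum_l label_sum lab l z s = \sum_i z i.
Proof.
rewrite exchange_big/= -(sum_perm z s); apply: eq_bigr => i _.
rewrite (bigD1 (lab i))//= big1 ?addr0; first by rewrite /labeled eqxx mul1r.
by move=> l; rewrite /labeled eq_sym => /negbTE ->; rewrite mul0r.
Qed.

Lemma label_card_le l : label_card l <= #|I|%:R :> R.
Proof. by rewrite ler_nat max_card. Qed.

Lemma label_sumB_cst l (z : I -> R) k s :
  label_sum lab l (fun u => z u - k) s = label_sum lab l z s - label_card l * k.
Proof.
rewrite /label_card -(@sum_label R) mulr_suml -sumrB.
by apply: eq_bigr => i _; rewrite mulrBr.
Qed.

End QuadStat.

Section Stein.
Context {R : realType} {I : finType} {c : nat} (lab : I -> 'I_c).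
Context {A : finType} (x : A -> I -> R) (w : A -> R) (kappa W : R).
Let N : R := #|I|%:R.
Let nu : R := Num.sqrt N.
Let n l : R := label_card lab l.
Let q l : R := (n l)^-1.
Let Y l a s : R := label_sum lab l (x a) s.
Let S a s : R := quad_stat lab (x a) s.
Let D l a s i j : R := label_step lab l (x a) s i j.

Hypothesis I_gt0 : (0 < #|I|)%N.
Hypothesis card_gt0 : forall l, 0 < n l.
Hypothesis kappa_ge1 : 1 <= kappa.
Hypothesis card_inv_le : forall l, q l <= kappa / N.
Hypothesis x_le1 : forall a i, `|x a i| <= 1.
Hypothesis x_sum0 : forall a, \sum_i x a i = 0.
Hypothesis x_orth : forall a b, \sum_i x a i * x b i = (a == b)%:R * (N / 2).
Hypothesis w_ge0 : forall a, 0 <= w a.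
Hypothesis w_le : forall a, w a <= W.

Let N_ge1 : 1 <= N. Proof. by rewrite ler1n. Qed.
Let N_gt0 : 0 < N. Proof. by have := N_ge1; lra. Qed.
Let nuE : nu ^+ 2 = N. Proof. by rewrite sqr_sqrtr// ltW. Qed.
Let nu_ge1 : 1 <= nu.
Proof. by rewrite -[leLHS](sqrtr1 R) ler_wsqrtr. Qed.
Let nu_gt0 : 0 < nu. Proof. by have := nu_ge1; lra. Qed.
Let q_gt0 l : 0 < q l. Proof. by rewrite invr_gt0. Qed.
Let qn l : q l * n l = 1. Proof. by rewrite mulVf// gt_eqF. Qed.
Let qN l : q l * N <= kappa.
Proof. by rewrite -ler_pdivlMr. Qed.
Let n_leN l : n l <= N. Proof. exact: label_card_le. Qed.
Let W_ge0 : A -> 0 <= W. Proof. by move=> a; apply: le_trans (w_le a). Qed.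

(** Fluctuation of the within-sample empirical covariance around its mean. *)
Let p l a b s : R :=
  label_sum lab l (fun u => x a u * x b u - (a == b)%:R / 2) s.

Let pE l a b s : label_sum lab l (fun u => x a u * x b u) s
  = p l a b s + n l * ((a == b)%:R / 2).
Proof. by rewrite /p label_sumB_cst -/(n l); ring. Qed.

Let M s : R := \sum_a S a s.

(** The common envelope of the error terms: each of them is at most a constant
    times [nu * T], and [T] has a bounded mean. *)
Let T s : R :=
  1 + M s ^+ 2 + \sum_l \sum_a \sum_b p l a b s ^+ 2 / N.
Let t s : R := Num.sqrt (M s).

Let S_ge0 a s : 0 <= S a s. Proof. exact: quad_stat_ge0. Qed.
Let M_ge0 s : 0 <= M s. Proof. exact: sumr_ge0. Qed.
Let t_ge0 s : 0 <= t s. Proof. exact: sqrtr_ge0. Qed.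
Let tE s : t s ^+ 2 = M s. Proof. by rewrite sqr_sqrtr. Qed.

Let p2_ge0 l a b s : 0 <= p l a b s ^+ 2 / N.
Proof. by rewrite divr_ge0 ?sqr_ge0// ltW. Qed.

Let psum_ge0 s : 0 <= \sum_l \sum_a \sum_b p l a b s ^+ 2 / N.
Proof. by do 3 apply: sumr_ge0 => ? _. Qed.

Let p2_le l a b s : p l a b s ^+ 2 / N
  <= \sum_l \sum_a \sum_b p l a b s ^+ 2 / N.
Proof.
rewrite (bigD1 l)//= (bigD1 a)//= (bigD1 b)//= -!addrA lerDl.
by rewrite !addr_ge0//; repeat (apply: sumr_ge0 => ? _); exact: p2_ge0.
Qed.

Let T_ge1 s : 1 <= T s.
Proof. rewrite /T; have := psum_ge0 s; have := sqr_ge0 (M s); lra. Qed.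

Let t_le s : t s <= T s.
Proof.
rewrite /T; have := psum_ge0 s.
by rewrite -tE; move: (t s) (\sum_l _) => a b ?; have := sqr_ge0 (a ^+ 2 - 1); have := sqr_ge0 (a - 1); nra.
Qed.

Let M_le s : M s <= T s.
Proof.
rewrite /T; have := psum_ge0 s.
by move: (M s) (\sum_l _) => a b ?; have := sqr_ge0 (a - 1); nra.
Qed.

Let M2_le s : M s ^+ 2 <= T s.
Proof. rewrite /T; have := psum_ge0 s; lra. Qed.

Let pq_le l a b s : (p l a b s / nu) ^+ 2 <= T s - 1 - M s ^+ 2.
Proof. by rewrite expr_div_n nuE (le_trans (p2_le l a b s))// /T; lra. Qed.

Let p_le l a b s : `|p l a b s| <= nu * T s.
Proof.
rewrite -ler_pdivrMl// mulrC -[_^-1]gtr0_norm ?invr_gt0// -normrM.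
have := pq_le l a b s; rewrite -real_normK ?num_real//; have := sqr_ge0 (M s).
by move: (`| _ |) (M s ^+ 2) => u v *; nra.
Qed.

Let Mp_le l a b s : M s * `|p l a b s| <= nu * T s.
Proof.
rewrite -ler_pdivrMl// mulrCA mulrC -[_^-1 in leLHS]gtr0_norm ?invr_gt0//.
rewrite [`|nu^-1| * _]mulrC -normrM mulrC.
have := pq_le l a b s; rewrite -real_normK ?num_real//.
by have := M_ge0 s; move: (`| _ |) (M s) => u v *; have := sqr_ge0 (u - v); nra.
Qed.

Let Y_le l a s : `|Y l a s| <= nu * t s.
Proof.
have YM : Y l a s ^+ 2 <= N * M s.
  have : q l * Y l a s ^+ 2 <= M s.
    apply: (@le_trans _ _ (S a s)).
      rewrite /S /quad_stat (bigD1 l)//= lerDl sumr_ge0// => m _.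
      by rewrite mulr_ge0 ?sqr_ge0// invr_ge0.
    by rewrite /M (bigD1 a)//= lerDl sumr_ge0.
  rewrite mulrC ler_pdivrMr// => /le_trans; apply.
  by rewrite mulrC ler_wpM2r.
by rewrite -sqrtr_sqr /nu /t -sqrtrM ?ler_wsqrtr// ltW.
Qed.

Let YY_le l m a b s : `|Y l a s| * `|Y m b s| <= N * M s.
Proof.
rewrite -nuE -tE -exprMn expr2; apply: ler_pM => //; exact: Y_le.
Qed.

Let D_le l a s i j : `|D l a s i j| <= 2.
Proof. by rewrite -[leRHS]mulr1; apply: label_step_le. Qed.

Let dS a s i j : R := S a (tperm i j * s)%g - S a s.

Let dSE a s i j :
  dS a s i j = \sum_l q l * (2 * Y l a s * D l a s i j + D l a s i j ^+ 2).
Proof.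
rewrite /dS /S /quad_stat -sumrB; apply: eq_bigr => l _.
by rewrite label_sum_swap -/(n l) -/(q l) -/(Y l a s) -/(D l a s i j); ring.
Qed.

Let sum_ord_le (F : 'I_c -> R) k : (forall l, F l <= k) -> \sum_l F l <= c%:R * k.
Proof.
move=> Fk; apply: (@le_trans _ _ (\sum_(l < c) k)); first exact: ler_sum.
by rewrite sumr_const card_ord -[k *+ c]mulr_natl.
Qed.

Let dS_le a s i j : `|dS a s i j| <= c%:R * kappa * 4 * (1 + t s) / nu.
Proof.
rewrite dSE (le_trans (ler_norm_sum _ _ _))//.
rewrite -!mulrA; apply: sum_ord_le => l.
rewrite normrM gtr0_norm//.
have h : `|2 * Y l a s * D l a s i j + D l a s i j ^+ 2| <= 4 * ((1 + t s) * nu).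
  apply: (le_trans (ler_normD _ _)).
  rewrite normrX (normrM (2 * _)) (normrM 2) (@gtr0_norm _ 2)//.
  have := D_le l a s i j; have := Y_le l a s; have := t_ge0 s.
  move: (`|Y _ _ _|) (`|D _ _ _ _ _|) (t s) (normr_ge0 (Y l a s)) (normr_ge0 (D l a s i j)).
  move=> y d r y0 d0 r0 yr d2.
  have : y * d <= (nu * r) * 2 by apply: ler_pM.
  have : d ^+ 2 <= 4 by nra.
  by have := nu_ge1; lra.
apply: (@le_trans _ _ (kappa / N * (4 * ((1 + t s) * nu)))).
  by apply: ler_pM => //; exact: ltW.
rewrite le_eqVlt; apply/orP; left; apply/eqP; rewrite -nuE; field.
by rewrite gt_eqF.
Qed.

(** Error in the drift of [S a]: its leading part is
    [- 4 N S a + 2 N (c - 1)]. *)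
Let e1 a s : R :=
  \sum_i \sum_j dS a s i j + 4 * N * S a s - 2 * N * (c%:R - 1).

Let e1_le a s : `|e1 a s| <= 10 * c%:R * kappa * (nu * T s).
Proof.
have -> : e1 a s = \sum_l q l * (2 * N * p l a a s - 4 * n l * p l a a s + 4 * Y l a s ^+ 2).
  have E l : \sum_i \sum_j q l * (2 * Y l a s * D l a s i j + D l a s i j ^+ 2) =
     q l * (2 * Y l a s * (- (2 * N) * Y l a s) + 2 * (n l * (N / 2) + N * (p l a a s + n l / 2) - 2 * n l * (p l a a s + n l / 2) + 2 * Y l a s ^+ 2)).
    under eq_bigr do rewrite -mulr_sumr.
    rewrite -mulr_sumr; congr (_ * _).
    under eq_bigr do rewrite big_split/= -mulr_sumr.
    rewrite big_split/= -mulr_sumr sum_label_step//; congr (_ + _).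
    under eq_bigr do under eq_bigr do rewrite expr2.
    rewrite sum_label_step2// x_orth pE !eqxx -/(n l) -/(Y l a s) -/N /=; ring.
  rewrite /e1; under eq_bigr do under eq_bigr do rewrite dSE.
  under eq_bigr do rewrite exchange_big/=.
  rewrite exchange_big/= (eq_bigr _ (fun l _ => E l)).
  have -> : 4 * N * S a s = \sum_l q l * (4 * N * Y l a s ^+ 2).
    by rewrite /S /quad_stat mulr_sumr; apply: eq_bigr => l _; rewrite mulrCA.
  have -> : 2 * N * (c%:R - 1) = \sum_l (2 * N - 2 * n l).
    by rewrite sumrB -!mulr_sumr (sum_label_card lab) sumr_const card_ord -/N; ring.
  rewrite -big_split -sumrB/=; apply: eq_bigr => l _.
  have -> : 2 * N - 2 * n l = q l * n l * (2 * N - 2 * n l) by rewrite qn mul1r.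
  by field.
rewrite (le_trans (ler_norm_sum _ _ _))//.
rewrite (_ : 10 * _ * _ * _ = c%:R * (10 * kappa * (nu * T s))); last by ring.
apply: sum_ord_le => l.
rewrite normrM gtr0_norm//.
apply: (@le_trans _ _ (q l * N * (10 * (nu * T s)))); last first.
  have : 0 <= nu * T s by rewrite mulr_ge0 ?(ltW nu_gt0)//; have := T_ge1 s; lra.
  by have := qN l; nra.
rewrite -[leRHS]mulrA ler_pM2l//.
apply: (le_trans (ler_normD _ _)); apply: (@le_trans _ _ (2 * N * (nu * T s) + 4 * N * (nu * T s) + 4 * N * (nu * T s))); last by lra.
have pT := p_le l a a s; have n0 := ltW (card_gt0 l); have := N_gt0 => N0.
have nT : 0 <= nu * T s := le_trans (normr_ge0 _) pT.
apply: lerD.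
  apply: (le_trans (ler_normB _ _)); apply: lerD; rewrite !normrM ?(@ger0_norm _ 2) ?(@ger0_norm _ 4)//.
    rewrite (ger0_norm (ltW N_gt0)); apply: ler_pM => //; lra.
  rewrite (ger0_norm n0) -!mulrA ler_pM2l//; exact: ler_pM.
rewrite normrM normrX (@ger0_norm _ 4)// -mulrA ler_pM2l// expr2.
apply: (le_trans (YY_le _ _ _ _ _)); rewrite ler_pM2l//.
have := M_le s; have := T_ge1 s; have := nu_ge1; nra.
Qed.

(** Error in the covariance of the increments of [S a] and [S b]: its leading
    part is [8 N S a] on the diagonal and 0 off it, by orthogonality. *)
Let e2 a b s : R :=
  \sum_i \sum_j dS a s i j * dS b s i j - 8 * N * (a == b)%:R * S a s.

(** The part of the product of two increments that is of degree at least 3 in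
    the label steps. *)
Let rho l m a b s i j : R :=
  2 * Y l a s * D l a s i j * D m b s i j ^+ 2
  + 2 * Y m b s * D l a s i j ^+ 2 * D m b s i j
  + D l a s i j ^+ 2 * D m b s i j ^+ 2.

Let rho_le l m a b s i j : `|rho l m a b s i j| <= 48 * (nu * T s).
Proof.
apply: (@le_trans _ _ (2 * (nu * T s) * 2 * 4 + 2 * (nu * T s) * 4 * 2 + 4 * 4)); last first.
  by have := T_ge1 s; have := nu_ge1; nra.
have Y' l' a' : `|Y l' a' s| <= nu * T s.
  by rewrite (le_trans (Y_le _ _ _))// ler_pM2l.
have D2 l' a' : `|D l' a' s i j| ^+ 2 <= 4.
  by have := D_le l' a' s i j; have := normr_ge0 (D l' a' s i j); nra.
rewrite /rho; apply: (le_trans (ler_normD _ _)).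
apply: lerD; first (apply: (le_trans (ler_normD _ _)); apply: lerD).
- rewrite (normrM _ (_ ^+ 2)) normrX (normrM (2 * _)) (normrM 2) (@ger0_norm _ 2)//.
  by do 3 (apply: ler_pM; rewrite ?mulr_ge0 ?exprn_ge0//).
- rewrite (normrM (2 * _ * _)) (normrM (2 * _)) normrX (normrM 2) (@ger0_norm _ 2)//.
  by do 3 (apply: ler_pM; rewrite ?mulr_ge0 ?exprn_ge0//).
- by rewrite normrM !normrX; apply: ler_pM; rewrite ?exprn_ge0.
Qed.

Let e2_le a b s : `|e2 a b s| <= 88 * c%:R ^+ 2 * kappa ^+ 2 * (nu * T s).
Proof.
pose G l m : R := (l == m)%:R * N * p l a b s - n l * p m a b s - n m * p l a b s
   + Y l a s * Y m b s + Y l b s * Y m a s.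
have -> : e2 a b s = \sum_l \sum_m q l * q m *
   (8 * (Y l a s * Y m b s) * G l m + \sum_i \sum_j rho l m a b s i j).
  have E l m : \sum_i \sum_j q l * (2 * Y l a s * D l a s i j + D l a s i j ^+ 2) *
       (q m * (2 * Y m b s * D m b s i j + D m b s i j ^+ 2)) =
     q l * q m * (8 * (Y l a s * Y m b s) * G l m + \sum_i \sum_j rho l m a b s i j)
     + 8 * (a == b)%:R * N * ((l == m)%:R * (q l * Y l a s ^+ 2))
     - 8 * (a == b)%:R * (Y l a s * Y m b s).
    have -> : \sum_i \sum_j q l * (2 * Y l a s * D l a s i j + D l a s i j ^+ 2) *
       (q m * (2 * Y m b s * D m b s i j + D m b s i j ^+ 2)) =
       q l * q m * (4 * (Y l a s * Y m b s) * (\sum_i \sum_j D l a s i j * D m b s i j) + \sum_i \sum_j rho l m a b s i j).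
      rewrite /rho; move: (Y l a s) (Y m b s) => y y'.
      rewrite !mulr_sumr -big_split/= mulr_sumr; apply: eq_bigr => i _.
      rewrite !mulr_sumr -big_split/= mulr_sumr; apply: eq_bigr => j _.
      by ring.
    rewrite sum_label_step2// x_orth !pE -/N -/(n l) -/(n m) -!/(Y _ _ _).
    have -> : 8 * (a == b)%:R * (Y l a s * Y m b s) =
      (q l * n l) * (q m * n m) * (8 * (a == b)%:R * (Y l a s * Y m b s)).
      by rewrite !qn !mul1r.
    rewrite /G; case: (eqVneq l m) => [->|lm] /=; last by field.
    case: (eqVneq a b) => [->|ab] /=; last by field.
    have -> : 8 * 1 * N * (1 * (q m * Y m b s ^+ 2)) =
      (q m * n m) * (8 * 1 * N * (1 * (q m * Y m b s ^+ 2))).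
      by rewrite !qn !mul1r.
    by field.
  rewrite /e2; under eq_bigr do under eq_bigr do rewrite !dSE big_distrlr/=.
  under eq_bigr do rewrite exchange_big/=.
  rewrite exchange_big/=.
  under eq_bigr do under eq_bigr do rewrite exchange_big/=.
  under eq_bigr do rewrite exchange_big/=.
  under eq_bigr do under eq_bigr do rewrite E.
  under eq_bigr do rewrite !big_split/= sumrN.
  rewrite !big_split/= sumrN.
  have -> : \sum_l \sum_m 8 * (a == b)%:R * (Y l a s * Y m b s) = 0.
    under eq_bigr do rewrite -mulr_sumr -mulr_sumr.
    under eq_bigr do rewrite (sum_label_sum lab (x b)) x_sum0 !mulr0.
    by rewrite big1.
  have -> : \sum_l \sum_m 8 * (a == b)%:R * N * ((l == m)%:R * (q l * Y l a s ^+ 2))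
     = 8 * N * (a == b)%:R * S a s.
    rewrite /S /quad_stat mulr_sumr; apply: eq_bigr => l _.
    rewrite (bigD1 l)//= eqxx big1 ?addr0; first by rewrite -/(n l) -/(q l) -/(Y l a s) /=; ring.
    by move=> m; rewrite eq_sym => /negbTE ->; rewrite mul0r mulr0.
  by rewrite subr0 addrK.
rewrite (le_trans (ler_norm_sum _ _ _))//.
rewrite (_ : 88 * _ * _ * _ = c%:R * (c%:R * (88 * kappa ^+ 2 * (nu * T s)))); last by ring.
apply: sum_ord_le => l.
rewrite (le_trans (ler_norm_sum _ _ _))//; apply: sum_ord_le => m.
have T1 := T_ge1 s; have nu1 := nu_ge1; have N0 := N_gt0.
have nT : 0 <= nu * T s by nra.
apply: (@le_trans _ _ ((q l * N) * (q m * N) * (88 * (nu * T s)))); last first.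
  rewrite [leRHS](_ : _ = kappa * kappa * (88 * (nu * T s))); last by ring.
  rewrite ler_wpM2r//; first by lra.
  by apply: ler_pM; rewrite ?qN// mulr_ge0 ?(ltW N_gt0)// ltW.
rewrite normrM (normrM (q l)) (gtr0_norm (q_gt0 l)) (gtr0_norm (q_gt0 m)).
rewrite [leRHS](_ : _ = q l * q m * (N ^+ 2 * (88 * (nu * T s)))); last by ring.
rewrite ler_pM2l ?mulr_gt0//.
apply: (le_trans (ler_normD _ _)).
rewrite (_ : N ^+ 2 * _ = 40 * N ^+ 2 * (nu * T s) + 48 * (nu * T s) * N ^+ 2); last by ring.
apply: lerD; last first.
  rewrite -(sum_sum_cst (48 * (nu * T s))).
  rewrite (le_trans (ler_norm_sum _ _ _))//; apply: ler_sum => i _.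
  rewrite (le_trans (ler_norm_sum _ _ _))//; apply: ler_sum => j _.
  exact: rho_le.
rewrite !normrM (@ger0_norm _ 8)//.
have M0 := M_ge0 s.
have GN : `|G l m| <= N * (`|p l a b s| + `|p m a b s| + `|p l a b s| + 2 * M s).
  have nl := n_leN l; have nm := n_leN m.
  have n0l := ltW (card_gt0 l); have n0m := ltW (card_gt0 m).
  rewrite /G; apply: (le_trans (ler_normD _ _)).
  have h1 := YY_le l m b a s.
  apply: (@le_trans _ _ (N * (`|p l a b s| + `|p m a b s| + `|p l a b s| + M s) + N * M s)); last by lra.
  apply: lerD; last by rewrite normrM.
  apply: (le_trans (ler_normD _ _)); rewrite [leRHS]mulrDr.
  apply: lerD; last by rewrite normrM YY_le.
  apply: (le_trans (ler_normB _ _)); rewrite [leRHS]mulrDr; apply: lerD; last first.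
    by rewrite normrM (ger0_norm n0m) ler_wpM2r.
  apply: (le_trans (ler_normB _ _)); rewrite [leRHS]mulrDr; apply: lerD; last first.
    by rewrite normrM (ger0_norm n0l) ler_wpM2r.
  rewrite !normrM (ger0_norm (ltW N_gt0)).
  rewrite -[leRHS]mul1r -mulrA; apply: ler_pM => //.
    by rewrite mulr_ge0// ltW.
  by case: (l == m); rewrite ?normr1 ?normr0.
have YY := YY_le l m a b s.
apply: (@le_trans _ _ (8 * (N * M s) * (N * (`|p l a b s| + `|p m a b s| + `|p l a b s| + 2 * M s)))).
  by apply: ler_pM; rewrite ?mulr_ge0 ?ler_pM2l//.
have := Mp_le l a b s; have := Mp_le m a b s; have := M2_le s.
rewrite (_ : 8 * _ * _ = N ^+ 2 * (8 * (2 * (M s * `|p l a b s|) + M s * `|p m a b s| + 2 * M s ^+ 2))); last by ring.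
move=> ? ? ?; rewrite [leRHS](_ : _ = N ^+ 2 * (40 * (nu * T s))); last by ring.
rewrite ler_pM2l ?exprn_gt0//.
by nra.
Qed.

Let Q s : R := \sum_a w a * S a s.
Let f s : R := expR (- Q s).
Let dQ s i j : R := \sum_a w a * dS a s i j.
(** Error in replacing the increment of [f = exp (- Q)] by its linear part
    [- f * dQ]. *)
Let e3 a s : R := \sum_i \sum_j dS a s i j *
  (f (tperm i j * s)%g - f s + f s * dQ s i j).

Let Q_ge0 s : 0 <= Q s.
Proof. by apply: sumr_ge0 => a _; rewrite mulr_ge0. Qed.

Let dQE s i j : dQ s i j = Q (tperm i j * s)%g - Q s.
Proof. by rewrite /dQ /Q -sumrB; apply: eq_bigr => a _; rewrite -mulrBr. Qed.

Let e3_le a s : `|e3 a s|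
  <= 512 * c%:R ^+ 3 * kappa ^+ 3 * (#|A|%:R * W) ^+ 2 * (nu * T s).
Proof.
pose u : R := c%:R * kappa * 4 * (1 + t s) / nu.
have u0 : 0 <= u.
  by rewrite /u divr_ge0 ?(ltW nu_gt0)// !mulr_ge0//; have := kappa_ge1; have := t_ge0 s; lra.
have dQ_le i j : `|dQ s i j| <= #|A|%:R * W * u.
  rewrite /dQ (le_trans (ler_norm_sum _ _ _))//.
  rewrite -mulrA mulr_natl -sumr_const; apply: ler_sum => b _.
  by rewrite normrM (ger0_norm (w_ge0 b)); apply: ler_pM; rewrite ?w_ge0 ?w_le ?dS_le.
apply: (@le_trans _ _ (\sum_(i : I) \sum_(j : I) u * (#|A|%:R * W * u) ^+ 2)).
  rewrite (le_trans (ler_norm_sum _ _ _))//; apply: ler_sum => i _.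
  rewrite (le_trans (ler_norm_sum _ _ _))//; apply: ler_sum => j _.
  rewrite normrM; apply: ler_pM => //.
  rewrite dQE /f; apply: (le_trans (expRN_taylor (Q_ge0 _) (Q_ge0 _))).
  by rewrite -dQE -real_normK ?num_real// ler_pXn2r// nnegrE (le_trans _ (dQ_le i j)).
rewrite sum_sum_cst.
have t3 : (1 + t s) ^+ 3 <= 8 * T s.
  have : 1 + M s ^+ 2 <= T s by rewrite /T; have := psum_ge0 s; lra.
  rewrite -tE; move: (t s) (T s) => a' b'.
  have := sqr_ge0 (a' - 1); have := sqr_ge0 (a' ^+ 2 - a'); have := sqr_ge0 (a' ^+ 2 - 1).
  by nra.
have E : u * (#|A|%:R * W * u) ^+ 2 * N ^+ 2 =
  64 * c%:R ^+ 3 * kappa ^+ 3 * (#|A|%:R * W) ^+ 2 * (nu * (1 + t s) ^+ 3).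
  by rewrite /u -nuE; field; rewrite gt_eqF.
rewrite E (_ : 512 = 64 * 8); last by ring.
rewrite (_ : 64 * 8 * _ * _ * _ * _ = 64 * c%:R ^+ 3 * kappa ^+ 3 * (#|A|%:R * W) ^+ 2 * (nu * (8 * T s))); last by ring.
have k0 : 0 <= kappa by have := kappa_ge1; lra.
apply: ler_wpM2l.
  by apply: mulr_ge0 (sqr_ge0 _); rewrite !mulr_ge0// exprn_ge0.
by rewrite ler_pM2l.
Qed.

Let T_mean : perm_mean T <= 1 + 13 * c%:R ^+ 2 * #|A|%:R ^+ 2 * kappa ^+ 2
  + 4 * c%:R * #|A|%:R ^+ 2.
Proof.
have k0 : 0 <= kappa by have := kappa_ge1; lra.
rewrite /T perm_meanD perm_meanD perm_mean_cst -!addrA lerD2l lerD//.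
  pose P : finType := (A * 'I_c)%type.
  have Mle s : M s ^+ 2 <= c%:R * #|A|%:R * (kappa ^+ 2 / N ^+ 2) * \sum_a \sum_l Y l a s ^+ 4.
    have ME : M s = \sum_(al : P) q al.2 * Y al.2 al.1 s ^+ 2.
      by rewrite /M /S /quad_stat pair_bigA.
    have SE : \sum_a \sum_l Y l a s ^+ 4 = \sum_(al : P) Y al.2 al.1 s ^+ 4.
      by rewrite pair_bigA.
    have MY : M s <= kappa / N * \sum_(al : P) Y al.2 al.1 s ^+ 2.
      rewrite ME mulr_sumr; apply: ler_sum => al _.
      by rewrite ler_wpM2r ?sqr_ge0.
    (* the Cauchy-Schwarz inequality against the constant function *)
    have CS (g : P -> R) : (\sum_al g al) ^+ 2 <= #|P|%:R * \sum_al g al ^+ 2.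
      have : 0 <= \sum_al \sum_bl (g al - g bl) ^+ 2.
        by apply: sumr_ge0 => ? _; apply: sumr_ge0 => ? _; exact: sqr_ge0.
      have -> : \sum_al \sum_bl (g al - g bl) ^+ 2 =
         2 * (#|P|%:R * \sum_al g al ^+ 2 - (\sum_al g al) ^+ 2).
        rewrite (eq_bigr (fun al => #|P|%:R * g al ^+ 2 - 2 * g al * (\sum_bl g bl) + \sum_bl g bl ^+ 2)).
          by rewrite !big_split/= sumrN -mulr_sumr -mulr_suml -mulr_sumr sumr_const -[_ *+ #|_|]mulr_natl; ring.
        move=> al _; rewrite [LHS](eq_bigr (fun bl => g al ^+ 2 - 2 * g al * g bl + g bl ^+ 2)); last by move=> *; ring.
        by rewrite !big_split/= sumrN sumr_const -mulr_sumr -[_ *+ #|_|]mulr_natl.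
      lra.
    pose U := \sum_(al : P) Y al.2 al.1 s ^+ 2.
    pose V := \sum_(al : P) Y al.2 al.1 s ^+ 4.
    have UV : U ^+ 2 <= #|A|%:R * c%:R * V.
      have := CS (fun al => Y al.2 al.1 s ^+ 2).
      rewrite /P card_prod card_ord natrM => /le_trans; apply.
      by rewrite /V; under [in leRHS]eq_bigr do rewrite (exprM _ 2 2).
    rewrite SE -/V; move: MY; rewrite -/U.
    move=> MU; apply: (@le_trans _ _ ((kappa / N * U) ^+ 2)).
      by rewrite ler_pXn2r// nnegrE (le_trans (M_ge0 s)).
    rewrite exprMn expr_div_n.
    rewrite [leRHS](_ : _ = kappa ^+ 2 / N ^+ 2 * (#|A|%:R * c%:R * V)); last by ring.
    apply: ler_wpM2l => //.
    by rewrite divr_ge0 ?exprn_ge0// ltW.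
  apply: (le_trans (le_perm_mean Mle)).
  rewrite perm_meanZ perm_mean_sum.
  have h : \sum_a perm_mean (fun s => \sum_l Y l a s ^+ 4) <= #|A|%:R * (c%:R * (13 * N ^+ 2)).
    rewrite [leRHS]mulr_natl -sumr_const; apply: ler_sum => a _.
    rewrite perm_mean_sum; apply: sum_ord_le => l.
    exact: label_sum_pow4_le.
  apply: (le_trans (ler_wpM2l _ h)); first by rewrite mulr_ge0// divr_ge0 ?exprn_ge0// ltW.
  rewrite le_eqVlt; apply/orP; left; apply/eqP; field; rewrite gt_eqF//.
rewrite perm_mean_sum (_ : 4 * _ * _ = c%:R * (4 * #|A|%:R ^+ 2)); last by ring.
apply: sum_ord_le => l.
rewrite perm_mean_sum (_ : 4 * _ = #|A|%:R * (#|A|%:R * 4)); last by ring.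
rewrite [leRHS]mulr_natl -sumr_const; apply: ler_sum => a _.
rewrite perm_mean_sum [leRHS]mulr_natl -sumr_const; apply: ler_sum => b _.
under eq_perm_mean do rewrite mulrC.
rewrite perm_meanZ ler_pdivrMl// mulrC.
pose z u : R := (x a u * x b u - (a == b)%:R / 2) / 2.
have pz s : p l a b s ^+ 2 = 4 * label_sum lab l z s ^+ 2.
  have -> : p l a b s = 2 * label_sum lab l z s.
    by rewrite /p /label_sum mulr_sumr; apply: eq_bigr => i _; rewrite /z; field.
  by ring.
under eq_perm_mean do rewrite pz.
rewrite perm_meanZ ler_pM2l//; apply: label_sum_sq_le => //.
- move=> u; rewrite /z normrM (@ger0_norm _ 2^-1)// ler_pdivrMr// mul1r.
  apply: (le_trans (ler_normB _ _)).
  rewrite normrM [leRHS](_ : _ = 1 * 1 + 1); last by ring.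
  apply: lerD; first by apply: ler_pM.
  by case: (a == b); rewrite /= ?mulr0n ?mulr1n ?mul0r ?normr0// ger0_norm; lra.
- rewrite /z -mulr_suml sumrB x_orth sumr_const -[_ *+ #|_|]mulr_natl -/N.
  by rewrite [N * _]mulrC; field.
Qed.

(** If the [S a] were independent gamma variables of shape [(c - 1) / 2] and
    scale 1, the left-hand side would vanish: it is the differential equation of their
    Laplace transform. The exchangeable pair for [S a] and [exp (- Q)] proves it
    up to the three errors above. All that matters about the constant is that
    it depends on [c], [#|A|], [kappa] and [W] only. *)
Lemma stein_quad_stat a :
  `|(1 + w a) * perm_mean (fun s => f s * S a s)
    - (c%:R - 1) / 2 * perm_mean f| <=
  (20 * c%:R * kappa + #|A|%:R * W * (88 * c%:R ^+ 2 * kappa ^+ 2)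
   + 512 * c%:R ^+ 3 * kappa ^+ 3 * (#|A|%:R * W) ^+ 2)
  * (1 + 13 * c%:R ^+ 2 * #|A|%:R ^+ 2 * kappa ^+ 2 + 4 * c%:R * #|A|%:R ^+ 2)
  / Num.sqrt #|I|%:R.
Proof.
have k0 : 0 <= kappa by have := kappa_ge1; lra.
set C := (20 * _ * _ + _ + _); set T0 := (1 + _ + _).
have C0 : 0 <= C.
  have AW : 0 <= #|A|%:R * W by apply: mulr_ge0 (W_ge0 a).
  have c3 : 0 <= c%:R ^+ 3 :> R by apply: exprn_ge0.
  apply: addr_ge0; first apply: addr_ge0.
  - by apply: mulr_ge0 k0; apply: mulr_ge0.
  - apply: mulr_ge0 => //; apply: mulr_ge0 (sqr_ge0 _).
    exact: mulr_ge0 _ (sqr_ge0 _).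
  - apply: mulr_ge0 (sqr_ge0 _); apply: mulr_ge0 (exprn_ge0 _ k0).
    by apply: mulr_ge0 c3; rewrite ler0n.
have key : 8 * N * ((1 + w a) * perm_mean (fun s => f s * S a s)
    - (c%:R - 1) / 2 * perm_mean f) =
  perm_mean (fun s => 2 * (f s * e1 a s) - f s * (\sum_b w b * e2 a b s) + e3 a s).
  rewrite perm_meanD perm_meanB perm_meanZ.
  have E1 : perm_mean (fun s => f s * e1 a s) =
      perm_mean (fun s => f s * \sum_i \sum_j dS a s i j)
      + 4 * N * perm_mean (fun s => f s * S a s) - 2 * N * (c%:R - 1) * perm_mean f.
    rewrite -!perm_meanZ -perm_meanD -perm_meanB; apply: eq_perm_mean => s.
    by rewrite /e1; ring.
  have E2 : perm_mean (fun s => f s * (\sum_b w b * e2 a b s)) =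
      perm_mean (fun s => \sum_i \sum_j dS a s i j * (f s * dQ s i j))
      - 8 * N * w a * perm_mean (fun s => f s * S a s).
    rewrite -!perm_meanZ -perm_meanB; apply: eq_perm_mean => s.
    have -> : \sum_b w b * e2 a b s = (\sum_i \sum_j dS a s i j * dQ s i j) - 8 * N * w a * S a s.
      rewrite /e2; under eq_bigr do rewrite mulrBr.
      rewrite sumrB; congr (_ - _).
        under eq_bigr do rewrite mulr_sumr.
        rewrite exchange_big/=; apply: eq_bigr => i _.
        under eq_bigr do rewrite mulr_sumr.
        rewrite exchange_big/=; apply: eq_bigr => j _.
        by rewrite /dQ mulr_sumr; apply: eq_bigr => b _; ring.
      rewrite (bigD1 a)//= eqxx big1 ?addr0 /=; first by ring.
      by move=> b; rewrite eq_sym => /negbTE -> /=; rewrite mulr0n; ring.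
    rewrite mulrBr; congr (_ - _); last by ring.
    rewrite mulr_sumr; apply: eq_bigr => i _; rewrite mulr_sumr.
    by apply: eq_bigr => j _; ring.
  have E3 : perm_mean (e3 a) =
      perm_mean (fun s => \sum_i \sum_j dS a s i j * (f (tperm i j * s)%g - f s))
    + perm_mean (fun s => \sum_i \sum_j dS a s i j * (f s * dQ s i j)).
    rewrite -perm_meanD; apply: eq_perm_mean => s.
    rewrite -big_split/=; apply: eq_bigr => i _.
    by rewrite -big_split/=; apply: eq_bigr => j _; rewrite -mulrDr.
  have := exchangeable_pair (S a) f; rewrite -/(dS a _ _ _).
  rewrite E1 E2 E3; move: (perm_mean _) (perm_mean _) => X1 X2.
  rewrite /dS; lra.
have N0 := N_gt0; have nu0 := nu_gt0.
have bound : `|8 * N * ((1 + w a) * perm_mean (fun s => f s * S a s)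
    - (c%:R - 1) / 2 * perm_mean f)| <= C * (nu * T0).
  rewrite key; apply: (le_trans (ler_norm_perm_mean _)).
  apply: (@le_trans _ _ (perm_mean (fun s => (C * nu) * T s))); last first.
    by rewrite perm_meanZ -mulrA ler_wpM2l// ler_pM2l// T_mean.
  apply: le_perm_mean => s.
  have f0 : 0 <= f s := ltW (expR_gt0 _).
  have f1 : f s <= 1 by rewrite /f -expR0 ler_expR oppr_le0.
  have nT : 0 <= nu * T s by have := T_ge1 s; nra.
  apply: (le_trans (ler_normD _ _)); rewrite /C -mulrA [leRHS]mulrDl.
  apply: lerD; last exact: e3_le.
  apply: (le_trans (ler_normB _ _)); rewrite [leRHS]mulrDl; apply: lerD.
    rewrite !normrM (@ger0_norm _ 2)// (ger0_norm f0).
    have := e1_le a s; have := normr_ge0 (e1 a s); nra.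
  rewrite normrM (ger0_norm f0) -[leRHS]mul1r; apply: ler_pM => //.
  rewrite (le_trans (ler_norm_sum _ _ _))// -!mulrA [leRHS]mulr_natl -sumr_const.
  apply: ler_sum => b _; rewrite normrM (ger0_norm (w_ge0 b)).
  by apply: ler_pM => //; have := e2_le a b s; rewrite -!mulrA.
rewrite ler_pdivlMr// -/nu.
move: bound; rewrite normrM gtr0_norm ?mulr_gt0// -nuE.
set Z := `| _ |; have Z0 : 0 <= Z by exact: normr_ge0.
have -> : 8 * nu ^+ 2 * Z = nu * (8 * (Z * nu)) by ring.
have -> : C * (nu * T0) = nu * (C * T0) by ring.
rewrite ler_pM2l//; have : 0 <= Z * nu by rewrite mulr_ge0// ltW.
by move=> ? ?; lra.
Qed.
End Stein.

(** * Trigonometric scores *)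

Section Trig.
Context {R : realType}.

Definition uniform_angle (N r : nat) : R := 2 * pi * r%:R / N%:R.

(** Both sums telescope after multiplication by [2 sin (pi k / N)], which
    vanishes only when [N] divides [k]. *)
Lemma sum_uniform_trig (N k : nat) : ~~ (N %| k)%N ->
  \sum_(r < N) cos (k%:R * uniform_angle N r) = 0 /\
  \sum_(r < N) sin (k%:R * uniform_angle N r) = 0.
Proof.
have [->|N0] := posnP N; first by rewrite !big_ord0.
move=> Nk.
have NR : N%:R != 0 :> R by rewrite pnatr_eq0 -lt0n.
pose h : R := pi * k%:R / N%:R.
have sinh0 : 2 * sin h != 0.
  rewrite mulf_neq0 ?pnatr_eq0//.
  have -> : h = pi * (k %% N)%:R / N%:R + pi *+ (k %/ N).
    rewrite /h {1}(divn_eq k N) natrD natrM -[pi *+ _]mulr_natr; field.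
    exact: NR.
  rewrite (alternatingn (@sinDpi R)) mulf_neq0//; first by rewrite signr_eq0.
  rewrite gt_eqF// sin_gt0_pi// divr_gt0 ?mulr_gt0 ?pi_gt0 ?ltr0n//; last first.
    by rewrite lt0n; move: Nk; rewrite /dvdn.
  rewrite ltr_pdivrMr ?ltr0n// ltr_pM2l ?pi_gt0//.
  by rewrite ltr_nat ltn_mod.
have per (x : R) : cos (x + 2 * pi * k%:R) = cos x /\ sin (x + 2 * pi * k%:R) = sin x.
  have -> : x + 2 * pi * k%:R = x + (pi *+ 2) *+ k.
    by rewrite -[in RHS]mulr_natr -[pi *+ 2]mulr_natr; ring.
  by rewrite (periodicn (@cosD2pi R)) (periodicn (@sinD2pi R)).
have angE r : k%:R * uniform_angle N r = 2 * h * r%:R.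
  by rewrite /uniform_angle /h; field.
have hN : 2 * h * N%:R = 2 * pi * k%:R by rewrite /h; field.
split; apply: (mulfI sinh0); rewrite mulr0 mulr_sumr.
- rewrite -(big_mkord xpredT (fun r => 2 * sin h * cos (k%:R * uniform_angle N r))).
  rewrite (eq_bigr (fun r : nat => sin (2 * h * r.+1%:R - h) - sin (2 * h * r%:R - h))).
    rewrite telescope_sumr// mulr0 sub0r hN (addrC (2 * pi * k%:R)).
    by rewrite (per (- h)).2 subrr.
  move=> r _; rewrite angE.
  rewrite (_ : 2 * h * r.+1%:R - h = 2 * h * r%:R + h); last by rewrite -natr1; ring.
  by rewrite sinD sinB; ring.
- rewrite -(big_mkord xpredT (fun r => 2 * sin h * sin (k%:R * uniform_angle N r))).
  rewrite (eq_bigr (fun r : nat => (- cos (2 * h * r.+1%:R - h)) - (- cos (2 * h * r%:R - h)))).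
    rewrite telescope_sumr// mulr0 sub0r hN (addrC (2 * pi * k%:R)).
    by rewrite (per (- h)).1; ring.
  move=> r _; rewrite angE.
  rewrite (_ : 2 * h * r.+1%:R - h = 2 * h * r%:R + h); last by rewrite -natr1; ring.
  by rewrite cosD cosB; ring.
Qed.

(** Frequencies are shifted by one so that the series below start at index 0
    with frequency 1; [b] selects the sine. *)
Definition trig_score (I : finType) (k : nat) (b : bool) (i : I) : R :=
  let t := k.+1%:R * uniform_angle #|I| (enum_rank i) in
  if b then sin t else cos t.

Lemma trig_score_le1 (I : finType) k b (i : I) : `|trig_score k b i| <= 1.
Proof. by rewrite /trig_score; case: b; rewrite ?sin_max ?cos_max. Qed.

Lemma sum_enum_rank (I : finType) (F : nat -> R) :
  \sum_(i : I) F (enum_rank i) = \sum_(r < #|I|) F r.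
Proof.
rewrite (reindex_inj (h := (fun r => r) : 'I_#|I| -> 'I_#|I|))//.
by rewrite [RHS](reindex_onto (@enum_rank I) enum_val)/=; [apply: eq_bigl => i; rewrite enum_rankK eqxx | move=> r _; exact: enum_valK].
Qed.

Lemma sum_trig_score (I : finType) k b : ~~ (#|I| %| k.+1)%N ->
  \sum_(i : I) trig_score k b i = 0.
Proof.
move=> /sum_uniform_trig[C S]; rewrite /trig_score.
case: b.
  by rewrite (sum_enum_rank I (fun r => sin (k.+1%:R * uniform_angle #|I| r))).
by rewrite (sum_enum_rank I (fun r => cos (k.+1%:R * uniform_angle #|I| r))).
Qed.

(** By the product formulas the sums reduce to the frequencies
    [k.+1 + q.+1] and [k.+1 - q.+1]; the bounds on [k] and [q] keep both from
    being nonzero multiples of [#|I|]. *)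
Lemma trig_score_orth (I : finType) (k q : nat) (b b' : bool) :
  (2 * k.+1 < #|I|)%N -> (2 * q.+1 < #|I|)%N ->
  \sum_(i : I) trig_score k b i * trig_score q b' i
  = ((k == q) && (b == b'))%:R * (#|I|%:R / 2).
Proof.
move=> kI qI.
wlog kq : k q b b' kI qI / (q <= k)%N.
  move=> wl; case: (leqP q k) => [|/ltnW] h; first exact: wl.
  under eq_bigr do rewrite mulrC.
  by rewrite wl// [q == k]eq_sym [b' == b]eq_sym.
pose C j := \sum_(i : I) cos (j%:R * uniform_angle #|I| (enum_rank i)).
pose S j := \sum_(i : I) sin (j%:R * uniform_angle #|I| (enum_rank i)).
have CS j : (0 < j < #|I|)%N -> C j = 0 /\ S j = 0.
  move=> /andP[j0 jI].
  have : ~~ (#|I| %| j)%N by apply/negP => /(dvdn_leq j0); rewrite leqNgt jI.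
  move=> /sum_uniform_trig[? ?]; rewrite /C /S.
  by rewrite (sum_enum_rank I (fun r => sin (j%:R * uniform_angle #|I| r)))
    (sum_enum_rank I (fun r => cos (j%:R * uniform_angle #|I| r))).
have [Cp Sp] : C (k.+1 + q.+1)%N = 0 /\ S (k.+1 + q.+1)%N = 0.
  apply: CS; rewrite addSn /=.
  by rewrite -addSn (@leq_ltn_trans (2 * k.+1)%N)// mul2n -addnn leq_add2l.
have Cm : C (k.+1 - q.+1)%N = (k == q)%:R * #|I|%:R.
  have [->|nkq] := eqVneq k q.
    rewrite /C subnn; under eq_bigr do rewrite mul0r cos0.
    by rewrite sumr_const mul1r.
  rewrite mul0r; apply: (CS _ _).1; rewrite subSS subn_gt0.
  rewrite ltn_neqAle eq_sym nkq kq /=.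
  by apply: leq_ltn_trans (leq_subr _ _) _; apply: leq_ltn_trans kI; rewrite mul2n -addnn; apply: leq_trans (leqnSn _) (leq_addr _ _).
have Sm : S (k.+1 - q.+1)%N = 0.
  have [->|nkq] := eqVneq k q.
    by rewrite /S subnn; under eq_bigr do rewrite mul0r sin0; rewrite big1.
  apply: (CS _ _).2; rewrite subSS subn_gt0.
  rewrite ltn_neqAle eq_sym nkq kq /=.
  by apply: leq_ltn_trans (leq_subr _ _) _; apply: leq_ltn_trans kI; rewrite mul2n -addnn; apply: leq_trans (leqnSn _) (leq_addr _ _).
pose u i := k.+1%:R * uniform_angle #|I| (@enum_rank I i).
pose v i := q.+1%:R * uniform_angle #|I| (@enum_rank I i).
have E1 : C (k.+1 + q.+1)%N = \sum_i cos (u i + v i).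
  by apply: eq_bigr => i _; rewrite /u /v -mulrDl -natrD.
have E2 : S (k.+1 + q.+1)%N = \sum_i sin (u i + v i).
  by apply: eq_bigr => i _; rewrite /u /v -mulrDl -natrD.
have E3 : C (k.+1 - q.+1)%N = \sum_i cos (u i - v i).
  by apply: eq_bigr => i _; rewrite /u /v -mulrBl natrB.
have E4 : S (k.+1 - q.+1)%N = \sum_i sin (u i - v i).
  by apply: eq_bigr => i _; rewrite /u /v -mulrBl natrB.
rewrite /trig_score -!/(u _) -!/(v _).
case: b; case: b'; rewrite ?andbT ?andbF /=.
- rewrite (eq_bigr (fun i => 2^-1 * (cos (u i - v i) - cos (u i + v i)))).
    by rewrite -mulr_sumr sumrB -E1 -E3 Cp Cm; field.
  by move=> i _; rewrite cosB cosD; field.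
- rewrite (eq_bigr (fun i => 2^-1 * (sin (u i + v i) + sin (u i - v i)))).
    by rewrite -mulr_sumr big_split/= -E2 -E4 Sp Sm; field.
  by move=> i _; rewrite sinB sinD; field.
- rewrite (eq_bigr (fun i => 2^-1 * (sin (u i + v i) - sin (u i - v i)))).
    by rewrite -mulr_sumr sumrB -E2 -E4 Sp Sm; field.
  by move=> i _; rewrite sinB sinD; field.
- rewrite (eq_bigr (fun i => 2^-1 * (cos (u i - v i) + cos (u i + v i)))).
    by rewrite -mulr_sumr big_split/= -E1 -E3 Cp Cm; field.
  by move=> i _; rewrite cosB cosD; field.
Qed.

End Trig.

(** * The Laplace transform at finitely many frequencies *)

Lemma is_derive_perm_mean (R : realType) (I : finType)
    (F : {perm I} -> R -> R) (dF : {perm I} -> R) (t : R) :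
  (forall s, is_derive t 1 (F s) (dF s)) ->
  is_derive t 1 (fun u => perm_mean (F ^~ u)) (perm_mean dF).
Proof.
move=> FdF; rewrite /perm_mean; apply: is_deriveZ.
elim: (index_enum _) => [|s r IH].
  rewrite big_nil (_ : (fun u => _) = cst 0); first exact: is_derive_cst.
  by apply/funext => u; rewrite big_nil.
rewrite big_cons (_ : (fun u => _) = F s + (fun u => \sum_(j <- r) F j u)).
  exact: is_deriveD.
by apply/funext => u; rewrite big_cons.
Qed.

Section Laplace.
Context {R : realType}.

(** Squared modulus of the normalised Fourier sums at frequency [k.+1], added
    over the samples. *)
Definition freq_stat {I : finType} {c : nat} (lab : I -> 'I_c) (k : nat)
    (s : {perm I}) : R :=
  \sum_(b : bool) quad_stat lab (trig_score k b) s.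

Lemma freq_stat_ge0 (I : finType) c (lab : I -> 'I_c) k s :
  0 <= freq_stat lab k s.
Proof. by apply: sumr_ge0 => b _; exact: quad_stat_ge0. Qed.

(** Second moments suffice here. At the excluded frequencies the cosine score is
    the constant 1, so that it is not centred and the bound fails. *)
Lemma mean_freq_stat_le (I : finType) c (lab : I -> 'I_c) (kappa : R) k :
  (0 < #|I|)%N ->
  (forall l, (label_card lab l)^-1 <= kappa / #|I|%:R) ->
  ~~ (#|I| %| k.+1)%N -> perm_mean (freq_stat lab k) <= 2 * c%:R * kappa.
Proof.
move=> I0 qk Ik; rewrite perm_mean_sum.
rewrite [leRHS](_ : _ = \sum_(b : bool) c%:R * kappa); last first.
  by rewrite big_bool/=; ring.
apply: ler_sum => b _; rewrite perm_mean_sum.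
rewrite [leRHS](_ : _ = \sum_(l < c) kappa); last first.
  by rewrite sumr_const card_ord mulr_natl.
apply: ler_sum => l _; rewrite perm_meanZ.
have := label_sum_sq_le lab l I0 (@trig_score_le1 R I k b) (sum_trig_score b Ik).
have := qk l; have : 0 < #|I|%:R :> R by rewrite ltr0n.
have : 0 <= (label_card lab l)^-1 :> R by rewrite invr_ge0.
set n := _^-1; set N : R := _%:R; set V := perm_mean _ => n0 N0 nk VN.
apply: (@le_trans _ _ (n * N)); first by rewrite ler_wpM2l.
by rewrite -ler_pdivlMr.
Qed.

(** Adding the identities for the sine and for the cosine doubles the shape
    [(c - 1) / 2] to [c - 1]. *)
Lemma freq_stat_stein (c : nat) (K : nat) (kappa W : R) : 1 <= kappa ->
  exists C : R, 0 <= C /\ forall (I : finType) (lab : I -> 'I_c) (w : 'I_K -> R),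
  (2 * K < #|I|)%N -> (forall l, 0 < label_card lab l :> R) ->
  (forall l, (label_card lab l)^-1 <= kappa / #|I|%:R) ->
  (forall k, 0 <= w k) -> (forall k, w k <= W) ->
  forall k : 'I_K,
  let f s := expR (- \sum_(j < K) w j * freq_stat lab j s) in
  `|(1 + w k) * perm_mean (fun s => f s * freq_stat lab k s)
    - (c%:R - 1) * perm_mean f| <= C / Num.sqrt #|I|%:R.
Proof.
move=> k1.
have [C HC] : exists C : R, forall (I : finType) (lab : I -> 'I_c) (w : 'I_K -> R),
  (2 * K < #|I|)%N -> (forall l, 0 < label_card lab l :> R) ->
  (forall l, (label_card lab l)^-1 <= kappa / #|I|%:R) ->
  (forall k, 0 <= w k) -> (forall k, w k <= W) ->
  forall (k : 'I_K) (b : bool),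
  let f s := expR (- \sum_(a : 'I_K * bool) w a.1 * quad_stat lab (trig_score a.1 a.2) s) in
  `|(1 + w k) * perm_mean (fun s => f s * quad_stat lab (trig_score k b) s)
    - (c%:R - 1) / 2 * perm_mean f| <= C / Num.sqrt #|I|%:R.
  eexists => I lab w KI n0 nk w0 wW k b /=.
  have I0 : (0 < #|I|)%N by exact: leq_ltn_trans KI.
  have KI' (j : 'I_K) : (2 * j.+1 < #|I|)%N.
    by apply: leq_ltn_trans KI; rewrite leq_mul2l/= ltn_ord.
  apply: (stein_quad_stat (A := ('I_K * bool)%type)
    (x := fun a : 'I_K * bool => @trig_score R I a.1 a.2)
    (w := fun a => w a.1) (W := W) I0 n0 k1 nk _ _ _ _ _ (k, b)) => //.
  - by move=> a i; exact: trig_score_le1.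
  - move=> a; apply: sum_trig_score; rewrite gtnNdvd//.
    by apply: leq_ltn_trans (KI' a.1); rewrite mul2n -addnn leq_addr.
  - by move=> [j b1] [q b2]; rewrite trig_score_orth.
exists (2 * `|C|); split; first by rewrite mulr_ge0.
move=> I lab w KI n0 nk w0 wW k /=.
have E s : \sum_(j < K) w j * freq_stat lab j s =
  \sum_(a : 'I_K * bool) w a.1 * quad_stat lab (trig_score a.1 a.2) s.
  under eq_bigr do rewrite mulr_sumr.
  by rewrite pair_bigA.
pose f s := expR (- \sum_(a : 'I_K * bool) w a.1 * quad_stat lab (trig_score a.1 a.2) s).
have gf s : expR (- \sum_(j < K) w j * freq_stat lab j s) = f s by rewrite E.
rewrite (eq_perm_mean gf) (@eq_perm_mean _ _ _ (fun s => f s * quad_stat lab (trig_score k true) s + f s * quad_stat lab (trig_score k false) s)); last first.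
  by move=> s; rewrite gf /freq_stat big_bool/= mulrDr.
rewrite perm_meanD.
pose X b := perm_mean (fun s => f s * quad_stat lab (trig_score k b) s).
have h b : `|(1 + w k) * X b - (c%:R - 1) / 2 * perm_mean f| <= C / Num.sqrt #|I|%:R.
  exact: (HC I lab w KI n0 nk w0 wW k b).
move: (h true) (h false); rewrite -!/(X _).
move: (X true) (X false) (perm_mean f) => X2 X1 F h2 h1.
have -> : (1 + w k) * (X2 + X1) - (c%:R - 1) * F =
  ((1 + w k) * X2 - (c%:R - 1) / 2 * F) + ((1 + w k) * X1 - (c%:R - 1) / 2 * F).
  by field.
apply: (le_trans (ler_normD _ _)).
rewrite -[leRHS]mulrA.
have : C / Num.sqrt #|I|%:R <= `|C| / Num.sqrt #|I|%:R.
  by apply: ler_wpM2r; rewrite ?invr_ge0 ?sqrtr_ge0 ?ler_norm.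
by move: h1 h2; lra.
Qed.

(** In the last Laplace variable the approximate identity is a linear
    differential equation with integrating factor [(1 + t) ^+ c.+1]; the mean
    value theorem integrates it from 0 to [w K]. *)
Lemma laplace_step (c : nat) (K : nat) (kappa : R) (w : nat -> R) :
  1 <= kappa -> (forall k, 0 <= w k) ->
  exists C : R, 0 <= C /\ forall (I : finType) (lab : I -> 'I_c.+2),
  (2 * K.+1 < #|I|)%N -> (forall l, 0 < label_card lab l :> R) ->
  (forall l, (label_card lab l)^-1 <= kappa / #|I|%:R) ->
  `|(1 + w K) ^+ c.+1 *
      perm_mean (fun s => expR (- \sum_(j < K.+1) w j * freq_stat lab j s))
    - perm_mean (fun s => expR (- \sum_(j < K) w j * freq_stat lab j s))|
  <= C / Num.sqrt #|I|%:R.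
Proof.
move=> k1 w0.
have [C [C0 HC]] := freq_stat_stein c.+2 K.+1 (\sum_(j < K.+1) w j) k1.
exists (w K * ((1 + w K) ^+ c * C)); split.
  by rewrite !mulr_ge0// exprn_ge0// addr_ge0.
move=> I lab KI n0 nk.
pose f t s := expR (- (\sum_(j < K) w j * freq_stat lab j s + t * freq_stat lab K s)).
pose G t := (1 + t) ^+ c.+1 * perm_mean (f t).
pose dG t := (1 + t) ^+ c * ((c.+1)%:R * perm_mean (f t)
   - (1 + t) * perm_mean (fun s => f t s * freq_stat lab K s)).
have GdG (t : R) : is_derive t (1 : R) G (dG t).
  have df : is_derive t 1 (fun t => perm_mean (f t))
     (perm_mean (fun s => - (f t s * freq_stat lab K s))).
    apply: is_derive_perm_mean => s; rewrite /f.
    set q := \sum_(j < K) _; set r := freq_stat lab K s.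
    have d1 : is_derive t 1 (fun u : R => - (q + u * r)) (- r).
      have -> : (fun u : R => - (q + u * r)) = (fun u => (- q) + (- r) * u).
        by apply/funext => u; ring.
      rewrite -[- r in X in is_derive _ _ _ X]add0r -[X in 0 + X]mulr1.
      by apply: is_deriveD; apply: is_deriveZ.
    rewrite -mulrN; apply: (@is_derive1_comp _ expR (fun u : R => - (q + u * r))).
  have dp : is_derive t 1 (fun t : R => (1 + t) ^+ c.+1) ((c.+1)%:R * (1 + t) ^+ c).
    have d1 : is_derive t 1 (fun u : R => 1 + u) 1.
      by rewrite -[X in is_derive _ _ _ X]add0r; apply: is_deriveD.
    have := @is_deriveX _ _ _ c.+1 t 1 _ d1; rewrite /GRing.scale/= mulr1 => dX.
    apply: (eq_ind _ (fun g => is_derive t (1 : R) g _) dX).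
    by apply/funext => u; rewrite exprfctE.
  have dM := is_deriveM dp df.
  have {}dM := eq_ind _ (fun g => is_derive t (1 : R) g _) dM G (erefl _).
  apply: (is_derive_eq dM).
  by rewrite /dG perm_meanN /GRing.scale/= exprS; ring.
have [t] : exists2 t, t \in `[0, w K]%R & G (w K) - G 0 = dG t * (w K - 0).
  apply: MVT_segment => //; apply: continuous_subspaceT => u.
  by apply: differentiable_continuous; apply/derivable1_diffP; case: (GdG u).
rewrite in_itv/= => /andP[t0 tw]; rewrite subr0 => GE.
have -> : (1 + w K) ^+ c.+1 *
      perm_mean (fun s => expR (- \sum_(j < K.+1) w j * freq_stat lab j s))
    - perm_mean (fun s => expR (- \sum_(j < K) w j * freq_stat lab j s))
  = G (w K) - G 0.
  rewrite /G addr0 expr1n mul1r; congr (_ * _ - _); apply: eq_perm_mean => s.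
    by rewrite /f big_ord_recr.
  by rewrite /f mul0r addr0.
rewrite GE normrM (ger0_norm (w0 K)) mulrC -[leRHS]mulrA ler_wpM2l//.
rewrite /dG normrM ger0_norm ?exprn_ge0 ?addr_ge0// -[leRHS]mulrA.
apply: ler_pM => //; first by rewrite exprn_ge0 ?addr_ge0.
  by rewrite lerXn2r ?nnegrE ?addr_ge0// lerD2l.
pose w' (j : 'I_K.+1) := if (j < K)%N then w j else t.
have wS j : (j <= K)%N -> w j <= \sum_(j < K.+1) w j.
  move=> jK; rewrite (bigD1 (Ordinal (jK : (j < K.+1)%N)))//= lerDl.
  exact: sumr_ge0.
have w'K : w' ord_max = t by rewrite /w' ltnn.
have w'j (j : 'I_K) : w' (widen_ord (leqnSn K) j) = w j by rewrite /w' /= ltn_ord.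
have fE s : expR (- \sum_(j < K.+1) w' j * freq_stat lab j s) = f t s.
  rewrite /f big_ord_recr w'K; under eq_bigr do rewrite w'j.
  by [].
have fKE s : expR (- \sum_(j < K.+1) w' j * freq_stat lab j s) * freq_stat lab K s
  = f t s * freq_stat lab K s by rewrite fE.
have := HC I lab w' KI n0 nk _ _ ord_max => /=.
rewrite w'K (eq_perm_mean fE) (eq_perm_mean fKE) distrC -natr1 addrK.
apply.
- by move=> k; rewrite /w'; case: ifP.
- move=> k; rewrite /w'; case: ifP => kK; first by apply: wS; exact: ltnW.
  by apply: le_trans tw _; exact: wS.
Qed.

(** One factor is removed at a time, from the highest frequency downwards. The
    limit is the Laplace transform of independent gamma variables of shape
    [c.+1], one less than the number of samples. *)
Lemma laplace_freq_stat (c : nat) (K : nat) (kappa : R) (w : nat -> R) :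
  1 <= kappa -> (forall k, 0 <= w k) ->
  exists C : R, 0 <= C /\ forall (I : finType) (lab : I -> 'I_c.+2),
  (2 * K < #|I|)%N -> (forall l, 0 < label_card lab l :> R) ->
  (forall l, (label_card lab l)^-1 <= kappa / #|I|%:R) ->
  `|(\prod_(j < K) (1 + w j) ^+ c.+1) *
      perm_mean (fun s => expR (- \sum_(j < K) w j * freq_stat lab j s)) - 1|
  <= C / Num.sqrt #|I|%:R.
Proof.
move=> k1 w0; elim: K => [|K [C [C0 IH]]].
  exists 0; split => // I lab _ _ _.
  rewrite big_ord0 mul1r (eq_perm_mean (G := fun=> 1)).
    by rewrite perm_mean_cst subrr normr0 mul0r.
  by move=> s; rewrite big_ord0 oppr0 expR0.
have [D [D0 HD]] := laplace_step c K k1 w0.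
set P := \prod_(j < K) (1 + w j) ^+ c.+1 in IH *.
have P0 : 0 <= P by apply: prodr_ge0 => j _; rewrite exprn_ge0// addr_ge0.
exists (C + P * D); split; first by rewrite addr_ge0// mulr_ge0.
move=> I lab KI n0 nk.
have KI' : (2 * K < #|I|)%N by apply: leq_ltn_trans KI; rewrite leq_mul2l/=.
have := IH I lab KI' n0 nk; have := HD I lab KI n0 nk.
rewrite big_ord_recr/= -/P.
set X := perm_mean _; set Z := perm_mean _; set u := (1 + _) ^+ _.
set r := Num.sqrt _ => h1 h2.
have -> : P * u * X - 1 = P * (u * X - Z) + (P * Z - 1) by ring.
apply: (le_trans (ler_normD _ _)); rewrite normrM (ger0_norm P0).
by rewrite mulrDl addrC lerD// -mulrA ler_wpM2l.
Qed.

End Laplace.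

Local Open Scope classical_set_scope.
Local Open Scope ring_scope.

(** * Ranks of independent observations with a common atomless law *)

Section Rectangles.
Context {R : realType} {n : nat}.
Notation tupleR := (n.-tuple (measurableTypeR R)).

Definition rectangle (B : 'I_n -> set R) : set tupleR :=
  [set t | forall k, B k (tnth t k)].

Lemma measurable_rectangle B : (forall k, measurable (B k)) ->
  measurable (rectangle B).
Proof.
move=> mB; have -> : rectangle B = \big[setI/setT]_(k < n) ((@tnth n R)^~ k @^-1` B k).
  rewrite -bigcap_seq; apply/seteqP; split => t /= tB.
    by move=> k _; exact: tB.
  by move=> k; apply: tB; rewrite /= mem_index_enum.
apply: bigsetI_measurable => k _.
rewrite -[X in measurable X]setTI.
have := @measurable_tnth _ (measurableTypeR R) n k.
move=> /(_ measurableT (B k) (mB k)); exact.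
Qed.

(** Rectangles form a pi-system that generates the product sigma-algebra. *)
Lemma rectangle_unique (m1 m2 : {measure set tupleR -> \bar R}) :
  (m1 setT < +oo)%E ->
  (forall B, (forall k, measurable (B k)) -> m1 (rectangle B) = m2 (rectangle B)) ->
  forall A, measurable A -> m1 A = m2 A.
Proof.
move=> m1oo m12 A mA.
pose G : set (set tupleR) :=
  [set C | exists2 B, (forall k, measurable (B k)) & C = rectangle B].
apply: (measure_unique G (fun=> setT)) => //.
- rewrite eqEsubset; split.
    apply: smallest_sub; first exact: smallest_sigma_algebra.
    rewrite -bigcup_seq => C [k _ [B mB <-]].
    apply: sub_sigma_algebra; exists (fun j => if j == k then B else setT).
      by move=> j; case: ifP.
    rewrite setTI; apply/seteqP; split => t /=; first by move=> Bt j; case: eqP => [->|].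
    by move=> /(_ k); rewrite eqxx.
  apply: smallest_sub; first exact: sigma_algebra_measurable.
  by move=> _ [B mB ->]; exact: measurable_rectangle.
- move=> _ _ [B mB ->] [B' mB' ->]; exists (fun k => B k `&` B' k).
    by move=> k; exact: measurableI.
  apply/seteqP; split => t /=; first by move=> [Bt B't] k; split.
  by move=> BB; split => k; have [] := BB k.
- move=> _; exists (fun=> setT) => //.
  by apply/seteqP; split.
- by rewrite bigcup_const.
- by move=> _ [B mB ->]; exact: m12.
Qed.

End Rectangles.

Definition rank_of {R : realType} {I : finType} (x : I -> R) (i : I) : nat :=
  \sum_j (x j <= x i)%R.

Lemma rank_of_perm (R : realType) (I : finType) (x : I -> R) (s : {perm I}) i :
  rank_of (fun j => x (s j)) i = rank_of x (s i).
Proof. by rewrite /rank_of [RHS](reindex_inj (@perm_inj _ s)). Qed.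

Lemma rank_of_le (R : realType) (I : finType) (x : I -> R) i :
  (rank_of x i <= #|I|)%N.
Proof.
rewrite /rank_of -sum1_card; apply: leq_sum => j _; exact: leq_b1.
Qed.

(** Without ties the ranks are distinct, hence enumerate 1 to [#|I|]. *)
Lemma rank_of_inj (R : realType) (I : finType) (x : I -> R) :
  injective x -> exists s : {perm I}, forall i, rank_of x i = (enum_rank (s i)).+1.
Proof.
move=> xinj.
have lt_rank i j : x i < x j -> (rank_of x i < rank_of x j)%N.
  move=> xij; rewrite /rank_of (bigD1 j)//= [leqRHS](bigD1 j)//= lexx.
  rewrite leNgt xij /= add0n add1n ltnS; apply: leq_sum => k _.
  case: (leP (x k) (x i)) => // ki; by rewrite (le_trans ki (ltW xij)).
have rinj : injective (rank_of x).
  move=> i j rij; apply: xinj; apply/eqP; case: ltgtP => // /lt_rank;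
  by rewrite rij ltnn.
have r_gt0 i : (0 < rank_of x i)%N.
  by rewrite /rank_of (bigD1 i)//= lexx.
have rlt i : ((rank_of x i).-1 < #|I|)%N by rewrite prednK// rank_of_le.
pose f i := enum_val (Ordinal (rlt i)).
have finj : injective f.
  move=> i j /enum_val_inj[] ij; apply: rinj.
  by rewrite -(prednK (r_gt0 i)) ij prednK.
exists (perm finj) => i; rewrite permE /f enum_valK /= prednK//.
Qed.

Section RankUniform.
Context {d : measure_display} {Omega : measurableType d} {R : realType}.
Context {P : probability Omega R} {I : finType}.
Variables (X : I -> {RV P >-> R}) (mu : probability (measurableTypeR R) R).
Hypothesis X_indep : mutually_independent X.
Hypothesis X_law : forall i, same_law (distribution P (X i)) mu.
Hypothesis mu_atom : forall x, mu [set x] = 0%E.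

Let obs w (i : I) : R := X i w.

Let sample (s : {perm I}) w : #|I|.-tuple (measurableTypeR R) :=
  [tuple X (s (enum_val k)) w | k < #|I|].

Let measurable_sample s : measurable_fun setT (sample s).
Proof.
apply/measurable_fun_tnthP => k.
apply: (eq_measurable_fun (X (s (enum_val k)))); last exact: measurable_funPT.
by move=> w _ /=; rewrite tnth_mktuple.
Qed.

(** Relabelling the observations does not change the joint law; on rectangles
    this is independence together with equality of the marginals. *)
Let P_rectangle s B : (forall k, measurable (B k)) ->
  P (sample s @^-1` rectangle B) = (\prod_(i <- enum I) mu (B (enum_rank i)))%E.
Proof.
move=> mB.
have -> : sample s @^-1` rectangle B
    = [set w | forall i, i \in enum I -> B (enum_rank ((s^-1)%g i)) (X i w)].
  apply/seteqP; split => w /= wB.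
    move=> i _; have := wB (enum_rank ((s^-1)%g i)).
    by rewrite tnth_mktuple enum_rankK permKV.
  move=> k; rewrite tnth_mktuple; have := wB (s (enum_val k)).
  by rewrite permK enum_valK mem_enum; exact.
rewrite (X_indep (s := enum I) (B := fun i => B (enum_rank ((s^-1)%g i)))) ?enum_uniq//.
rewrite !big_enum/= [RHS](reindex_inj (@perm_inj _ (s^-1)%g))/=.
by apply: eq_bigr => i _; rewrite -(X_law i).
Qed.

Let exchangeable s A : measurable A -> P (sample s @^-1` A) = P (sample 1 @^-1` A).
Proof.
move=> mA.
pose S1 : {mfun Omega >-> #|I|.-tuple (measurableTypeR R)} :=
  HB.pack (sample 1%g) (isMeasurableFun.Build _ _ _ _ _ (measurable_sample 1%g)).
pose Ss : {mfun Omega >-> #|I|.-tuple (measurableTypeR R)} :=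
  HB.pack (sample s) (isMeasurableFun.Build _ _ _ _ _ (measurable_sample s)).
apply: (@rectangle_unique R _ (distribution P Ss) (distribution P S1)) => //.
  exact: le_lt_trans (probability_le1 (distribution P Ss) measurableT) (ltry 1).
by move=> B mB; have := P_rectangle s mB; rewrite -(P_rectangle 1%g mB).
Qed.

Let rank_event (r : I -> nat) : set Omega :=
  [set w | forall i, rank_of (obs w) i = r i].

Let rank_set (r : I -> nat) : set (#|I|.-tuple (measurableTypeR R)) :=
  [set t | forall i, rank_of (fun j => tnth t (enum_rank j)) i = r i].

Let measurable_rank_set r : measurable (rank_set r).
Proof.
pose f i (t : #|I|.-tuple (measurableTypeR R)) : R :=
  \sum_j (\1_[set u : #|I|.-tuple (measurableTypeR R)
     | tnth u (enum_rank j) <= tnth u (enum_rank i)] t).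
have -> : rank_set r = \big[setI/setT]_(i : I) (f i @^-1` [set (r i)%:R]).
  rewrite -bigcap_seq.
  have fE i t : f i t = (rank_of (fun j => tnth t (enum_rank j)) i)%:R.
    rewrite /f /rank_of natr_sum; apply: eq_bigr => j _.
    by rewrite indicE mem_setE.
  apply/seteqP; split => t tr i.
    by move=> _; change (f i t = (r i)%:R); rewrite fE tr.
  have : f i t = (r i)%:R := tr i (mem_index_enum i).
  by rewrite fE => /eqP; rewrite eqr_nat => /eqP.
apply: bigsetI_measurable => i _.
have mf : measurable_fun setT (f i).
  apply: measurable_sum => j; apply: measurable_indic.
  rewrite -[X in measurable X]setTI.
  have := @measurable_fun_ler _ _ R setT
    (fun u : #|I|.-tuple (measurableTypeR R) => tnth u (enum_rank j))
    (fun u => tnth u (enum_rank i)).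
  move=> /(_ (@measurable_tnth _ (measurableTypeR R) _ _)).
  move=> /(_ (@measurable_tnth _ (measurableTypeR R) _ _)).
  by move=> /(_ measurableT [set true] _); apply.
by rewrite -[X in measurable X]setTI; exact: mf.
Qed.

Let sample_rank_set (s : {perm I}) r :
  sample s @^-1` rank_set r = rank_event (fun i => r ((s^-1)%g i)).
Proof.
have E w i : rank_of (fun j => tnth (sample s w) (enum_rank j)) i = rank_of (obs w) (s i).
  rewrite -rank_of_perm; congr rank_of; apply/funext => j.
  by rewrite tnth_mktuple enum_rankK.
apply/seteqP; split => w /= wr i.
  by rewrite -[in LHS](permKV s i) -E wr.
by rewrite E wr permK.
Qed.

Let measurable_rank_event r : measurable (rank_event r).
Proof.
have -> : rank_event r = sample 1%g @^-1` rank_set r.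
  by rewrite sample_rank_set; congr rank_event; apply/funext => i; rewrite invg1 perm1.
by rewrite -[X in measurable X]setTI; exact: measurable_sample.
Qed.

Let perm_rank (s : {perm I}) (i : I) : nat := (enum_rank (s i)).+1.

Let P_perm_rank s : P (rank_event (perm_rank s)) = P (rank_event (perm_rank 1%g)).
Proof.
have := exchangeable (s^-1)%g (measurable_rank_set (perm_rank 1%g)).
rewrite !sample_rank_set invgK invg1 => h.
transitivity (P (rank_event (fun i => perm_rank 1%g (s i)))).
  by congr (P (rank_event _)); apply/funext => i; rewrite /perm_rank perm1.
by rewrite h; congr (P (rank_event _)); apply/funext => i; rewrite perm1.
Qed.

(** The joint law of two observations is the product of two atomless laws,
    which gives mass zero to the diagonal by Fubini's theorem. *)
Let P_tie i j : i != j -> P [set w | X i w = X j w] = 0%E.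
Proof.
move=> ij.
pose f w : measurableTypeR R * measurableTypeR R := (X i w, X j w).
have mX k : measurable_fun setT (X k : Omega -> measurableTypeR R).
  exact: (measurable_funPT (X k)).
have mf : measurable_fun setT f := measurable_fun_pair (mX i) (mX j).
pose F : {mfun Omega >-> (measurableTypeR R * measurableTypeR R)%type} :=
  HB.pack f (isMeasurableFun.Build _ _ _ _ _ mf).
pose diag : set (measurableTypeR R * measurableTypeR R) := [set p | p.1 = p.2].
have mdiag : measurable diag.
  have -> : diag = (fun p : measurableTypeR R * measurableTypeR R => p.1 == p.2 :> R) @^-1` [set true].
    by apply/seteqP; split => p /= /eqP.
  rewrite -[X in measurable X]setTI.
  have := @measurable_fun_eqr _ _ R setT (fun p : measurableTypeR R * measurableTypeR R => p.1) snd.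
  by move=> /(_ measurable_fst measurable_snd measurableT [set true]); apply.
have -> : P [set w | X i w = X j w] = distribution P F diag by [].
rewrite -(@product_measure_unique _ _ _ _ R mu mu (distribution P F))//.
  rewrite /product_measure1/=.
  apply: integral0_eq => x _ /=.
  have -> : xsection diag x = [set x].
    apply/seteqP; split => y /=; rewrite /xsection/= inE /diag/=; first by move=> ->.
    by move=> ->.
  exact: mu_atom.
move=> A B mA mB.
have := X_indep (s := [:: i; j]) (B := fun k => if k == i then A else B).
rewrite /= !inE ij => /(_ isT) => h.
rewrite /distribution /pushforward.
transitivity (P [set w | forall k, k \in [:: i; j] -> (if k == i then A else B) (X k w)]).
  congr (P _); apply/seteqP; split => w /=.
    move=> [wA wB] k; rewrite !inE => /orP[]/eqP ->; first by rewrite eqxx.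
    by rewrite eq_sym (negbTE ij).
  move=> wk; split; first by have := wk i; rewrite !inE eqxx => /(_ isT).
  by have := wk j; rewrite !inE eqxx orbT eq_sym (negbTE ij) => /(_ isT).
rewrite h; last by move=> k; case: ifP.
rewrite !big_cons big_nil mule1 eqxx eq_sym (negbTE ij).
by rewrite -(X_law i)// -(X_law j).
Qed.

Let P_no_perm r : ~ (exists s, r =1 perm_rank s) -> P (rank_event r) = 0%E.
Proof.
move=> nr.
have : P.-negligible (\big[setU/set0]_(p : I * I | p.1 != p.2) [set w | X p.1 w = X p.2 w]).
  elim/big_ind : _ => [||p pne].
  - exact: negligible_set0.
  - by move=> ? ? ? ?; exact: negligibleU.
  - apply/negligibleP; last exact: P_tie.
    rewrite -[X in measurable X]setTI.
    have -> : [set w | X p.1 w = X p.2 w] = (fun w => X p.1 w == X p.2 w) @^-1` [set true].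
      by apply/seteqP; split => w /= /eqP.
    by have := @measurable_fun_eqr _ _ R setT (X p.1) (X p.2) (measurable_funPT _) (measurable_funPT _) measurableT [set true]; apply.
move=> N; apply: measure_negligible => //.
apply: negligibleS N => w /= wr; apply: contrapT => notie; apply: nr.
have [|s rs] := @rank_of_inj R I (obs w).
  move=> i j ij; apply: contrapT => /eqP inj; apply: notie.
  by rewrite -bigcup_seq_cond; exists (i, j) => //=; rewrite mem_index_enum.
by exists s => i; rewrite -wr rs.
Qed.

(** Exchangeability makes all permutations equally likely as rank vectors, and
    ties, hence all other rank vectors, have probability zero. The successor
    appears because [enum_rank] counts from 0. *)
Lemma expectation_rank (F : (I -> nat) -> R) :
  'E_P[fun w => F (rank_of (fun i => X i w))]%E =
  (perm_mean (fun s => F (fun i => (enum_rank (s i)).+1)))%:E.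
Proof.
pose T := {ffun I -> 'I_#|I|.+1}.
pose p (r : T) : R := fine (P (rank_event (fun i => r i))).
(* the rank vector has finitely many values, so its expectations are finite sums *)
have EF (G : (I -> nat) -> R) :
    'E_P[fun w => G (rank_of (obs w))]%E = (\sum_(r : T) G (fun i => r i) * p r)%:E.
  rewrite unlock.
  have -> : (fun w => (G (rank_of (obs w)))%:E) =
    (fun w => \sum_(r : T) (G (fun i => r i))%:E * (\1_(rank_event (fun i => r i)) w)%:E)%E.
    apply/funext => w.
    pose r0 : T := [ffun i => inord (rank_of (obs w) i)].
    have r0E i : r0 i = rank_of (obs w) i :> nat.
      by rewrite ffunE inordK// ltnS rank_of_le.
    rewrite (bigD1 r0)//= big1 ?adde0.
      rewrite indicE mem_set ?mule1; last by move=> i; rewrite r0E.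
      by congr (G _)%:E; apply/funext => i; rewrite r0E.
    move=> r rr0; rewrite indicE memNset ?mule0// => wr.
    move/eqP: rr0; apply; apply/ffunP => i; apply/val_inj => /=.
    by rewrite r0E wr.
  rewrite integral_sum//; last first.
    by move=> r; apply: integrableZl => //; apply: integrable_indic => //; rewrite -ge0_fin_numE ?fin_num_measure.
  rewrite -sumEFin; apply: eq_bigr => r _.
  rewrite integralZl//; last by apply: integrable_indic => //; rewrite -ge0_fin_numE ?fin_num_measure.
  by rewrite integral_indic// setIT EFinM /p fineK// fin_num_measure.
pose rs (s : {perm I}) : T := [ffun i => inord (perm_rank s i)].
have rsE s i : rs s i = perm_rank s i :> nat.
  by rewrite ffunE inordK// ltnS ltn_ord.
have rs_inj : injective rs.
  move=> s s' ss; apply/permP => i; apply: enum_rank_inj; apply/val_inj.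
  have : (rs s i : nat) = rs s' i by rewrite ss.
  by rewrite !rsE => -[].
pose p1 := fine (P (rank_event (perm_rank 1%g))).
have sumE (G : (I -> nat) -> R) : \sum_(r : T) G (fun i => r i) * p r
   = (\sum_(s : {perm I}) G (perm_rank s)) * p1.
  rewrite (bigID (fun r => r \in [set rs s | s : {perm I}]%SET))/= [X in _ + X]big1 ?addr0; last first.
    move=> r; apply: contraNeq; rewrite mulf_eq0 negb_or => /andP[_ pr].
    apply: contrapT => nr; move/eqP: pr; apply.
    rewrite /p P_no_perm// => -[s sr]; apply: nr; apply/imsetP; exists s => //.
    by apply/ffunP => i; apply/val_inj; rewrite /= sr rsE.
  rewrite (big_imset _ (in2W rs_inj))/= mulr_suml.
  apply: eq_big => [s|s _]; first by rewrite inE.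
  have -> : (fun i => rs s i : nat) = perm_rank s by apply/funext => i; rewrite rsE.
  rewrite /p.
  have -> : (fun i => rs s i : nat) = perm_rank s by apply/funext => i; rewrite rsE.
  by rewrite P_perm_rank.
have p1E : p1 = (#|{perm I}|%:R)^-1.
  have := EF (fun=> 1); rewrite expectation_cst (sumE (fun=> 1)) sumr_const => -[] h.
  have c0 : #|{perm I}|%:R != 0 :> R.
    by apply/eqP => c0; move: h; rewrite c0 mul0r => /eqP; rewrite oner_eq0.
  by apply: (mulfI c0); rewrite -h mulfV.
by rewrite EF sumE p1E mulrC.
Qed.

End RankUniform.

(** * The Laplace transform of a chi-squared variable *)

(** The law is dominated by Lebesgue measure, and its Radon-Nikodym derivative
    is the density. *)
Lemma integral_density (R : realType) d (T : measurableType d)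
    (Q : probability T R) (Y : {RV Q >-> R}) (p h : R -> R) :
  measurable_fun setT p -> (forall x, 0 <= p x) ->
  (forall B : set R, measurable B ->
     distribution Q Y B = \int[lebesgue_measure]_(x in B) (p x)%:E)%E ->
  measurable_fun setT h -> (exists M, forall x, `|h x| <= M) ->
  (\int[Q]_w (h (Y w))%:E = \int[lebesgue_measure]_x (h x * p x)%:E)%E.
Proof.
move=> mp p0 pE mh [M hM].
have mY : measurable_fun setT (Y : T -> measurableTypeR R).
  exact: (measurable_funPT Y).
pose Z : {mfun T >-> measurableTypeR R} :=
  HB.pack (Y : T -> measurableTypeR R) (isMeasurableFun.Build _ _ _ _ _ mY).
pose nu : probability (measurableTypeR R) R := distribution Q Z.
pose mu := @lebesgue_measure R.
have nu_mu : nu `<< mu.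
  apply/null_content_dominatesP => A mA muA0.
  have -> : nu A = (\int[mu]_(x in A) (p x)%:E)%E by exact: pE.
  apply: null_set_integral => //.
  by apply/measurable_EFinP; exact: measurable_funTS.
have inth : nu.-integrable setT (EFin \o h).
  apply: measurable_bounded_integrable => //.
    by rewrite -ge0_fin_numE// fin_num_measure.
  by exists M; split; [exact: num_real|move=> x Mx y _; exact: le_trans (hM y) (ltW Mx)].
transitivity (\int[nu]_x (h x)%:E)%E.
  rewrite (@integral_distribution _ _ _ _ _ Q Z (EFin \o h))//.
    exact/measurable_EFinP.
  apply: measurable_bounded_integrable => //.
  - by rewrite -ge0_fin_numE// fin_num_measure.
  - exact: (measurableT_comp mh mY).
  - by exists M; split; [exact: num_real|move=> x Mx y _; exact: le_trans (hM _) (ltW Mx)].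
rewrite -(Radon_Nikodym_change_of_variables nu_mu)//.
apply: ae_eq_integral => //.
- apply: emeasurable_funM; first exact/measurable_EFinP.
  by apply: (measurable_int mu); exact: Radon_Nikodym_integrable.
- by apply/measurable_EFinP; exact: measurable_funM.
under [X in ae_eq _ _ _ X]eq_fun do rewrite EFinM.
apply: ae_eqe_mul2l.
apply: integral_ae_eq => //.
- exact: Radon_Nikodym_integrable.
- exact/measurable_EFinP.
- by move=> E _ mE; rewrite -Radon_Nikodym_integral// -pE.
Qed.

Section Chi2.
Context {R : realType} (m : nat).
Notation nu := (2 * m.+1)%N.
Notation mu := (@lebesgue_measure R).

Let Z : R := 2 `^ (nu%:R / 2) * euler_gamma (nu%:R / 2).
Let G (x : R) : R := x ^+ m * expR (- (x / 2)).
Let J (t : R) : \bar R :=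
  (\int[mu]_(x in `]0%R, +oo[) (x ^+ m * expR (- (t * (x / 2))))%:E)%E.

Let Z_ge0 : 0 <= Z.
Proof.
rewrite mulr_ge0 ?powR_ge0//; apply: Rintegral_ge0 => x _.
by rewrite mulr_ge0 ?powR_ge0 ?expR_ge0.
Qed.

Let chi2_pdfE (x : R) :
  chi2_pdf nu x = Z^-1 * (G x * \1_(`]0%R, +oo[%classic : set R) x).
Proof.
rewrite /chi2_pdf; case: ifPn => x0; last first.
  rewrite indicE (_ : (x \in _) = false) ?mulr0n ?mulr0//.
  by apply/memNset; rewrite /= in_itv/= andbT; exact/negP.
rewrite indicE mem_set/= ?in_itv/= ?andbT// mulr1n mulr1 [RHS]mulrC; congr (_ * _ / _).
rewrite natrM mulrAC divff ?mul1r ?pnatr_eq0//.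
by rewrite -natr1 addrK powR_mulrn// ltW.
Qed.

Let continuous_G (t : R) : continuous (fun x : R => x ^+ m * expR (- (t * (x / 2)))).
Proof.
move=> x; apply: cvgM; first exact: exprn_continuous.
apply: (@continuous_comp _ _ _ (fun x : R => - (t * (x / 2))) expR); last exact: continuous_expR.
by apply: cvgN; apply: cvgMr; apply: cvgMl; exact: cvg_id.
Qed.

Let measurable_G (t : R) : measurable_fun setT (fun x : R => x ^+ m * expR (- (t * (x / 2)))).
Proof. apply: continuous_measurable_fun; exact: continuous_G. Qed.

Let GE : G = fun x => x ^+ m * expR (- (1 * (x / 2))).
Proof. by apply/funext => x; rewrite mul1r. Qed.

Lemma measurable_chi2_pdf : measurable_fun setT (@chi2_pdf R nu).
Proof.
rewrite (_ : chi2_pdf nu = fun x => Z^-1 * (G x * \1_(`]0%R, +oo[%classic : set R) x)).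
  apply: measurable_funM => //; apply: measurable_funM.
    by rewrite GE; exact: measurable_G.
  exact: measurable_indic.
by apply/funext => x; exact: chi2_pdfE.
Qed.

Lemma chi2_pdf_ge0 (x : R) : 0 <= chi2_pdf nu x.
Proof.
rewrite /chi2_pdf; case: ifP => // _; rewrite divr_ge0//.
by rewrite mulr_ge0 ?powR_ge0 ?expR_ge0.
Qed.

(** The substitution [x -> t * x] in the gamma integral. *)
Let J_scale (t : R) : 0 < t -> J 1 = ((t ^+ m.+1)%:E * J t)%E.
Proof.
move=> t0; rewrite /J.
rewrite !integral_itv_obnd_cbnd; try (apply: measurable_funTS; apply/measurable_EFinP; exact: measurable_G).
have dF (x : R) : is_derive x (1 : R) ( *%R t) t.
  have := is_deriveZ t (is_derive_id x (1 : R)).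
  by rewrite /GRing.scale/= mulr1.
have F1 : ( *%R t)^`()%classic = cst t.
  by apply/funext => x; rewrite derive1E derive_val.
have := @increasing_ge0_integration_by_substitutiony R ( *%R t)
  (fun x => x ^+ m * expR (- (1 * (x / 2)))) 0.
rewrite mulr0 => ->.
- rewrite F1; rewrite -ge0_integralZl//=.
  + by apply: eq_integral => x _; rewrite /= -EFinM !fctE/=; congr EFin; rewrite exprMn exprS; rewrite !mul1r !mulrA; ring.
  + by apply: measurable_funTS; apply/measurable_EFinP; exact: measurable_G.
  + by move=> x; rewrite in_itv/= andbT => x0; rewrite lee_fin mulr_ge0 ?exprn_ge0 ?expR_ge0.
  + by rewrite lee_fin exprn_ge0// ltW.
- by move=> x y _ _ xy; rewrite ltr_pM2l.
- by rewrite F1 => x _; exact: cvg_cst.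
- by rewrite F1; exact: is_cvg_cst.
- by rewrite F1; exact: is_cvg_cst.
- split; first by move=> x _; case: (dF x).
  apply: cvgMr; exact: cvg_at_right_filter.
- exact: gt0_cvgMry.
- by apply: continuous_subspaceT; exact: continuous_G.
- by move=> x; rewrite in_itv/= andbT => x0; rewrite mulr_ge0 ?exprn_ge0 ?expR_ge0// ltW.
Qed.

(** Multiplying the density by an exponential changes only the rate of the
    gamma kernel. The positive part makes the exponential bounded on the whole
    line, which changes nothing on the support of the density. *)
Let kernel_integral (t : R) : (\int[mu]_x (expR (- (t * (Num.max x 0 / 2))) * chi2_pdf nu x)%:E
  = (Z^-1)%:E * J (1 + t))%E.
Proof.
rewrite /J -ge0_integralZl//=; last 3 first.
- by apply: measurable_funTS; apply/measurable_EFinP; exact: measurable_G.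
- by move=> x; rewrite in_itv/= andbT => x0; rewrite lee_fin mulr_ge0 ?exprn_ge0 ?expR_ge0// ltW.
- by rewrite lee_fin invr_ge0.
rewrite [RHS]integral_mkcond; apply: eq_integral => x _.
rewrite chi2_pdfE /patch indicE; case: ifPn => x0; last first.
  by rewrite /= mulr0n !mulr0.
move: x0; rewrite inE/= in_itv/= andbT => x0.
rewrite mulr1n mulr1 -EFinM; congr EFin.
rewrite max_l ?ltW// /G mulrCA; congr (_ * _).
rewrite mulrCA; congr (_ * _).
by rewrite -expRD; congr expR; ring.
Qed.

Section Law.
Context {d : measure_display} {T : measurableType d} {Q : probability T R}.
Variable Y : {RV Q >-> R}.
Hypothesis Y_law : same_law (distribution Q Y) (chi2_prob nu).

(** That the total mass is 1 identifies the normalising constant, so the gamma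
    integral never has to be evaluated. *)
Let mass1 : ((Z^-1)%:E * J 1 = 1)%E.
Proof.
have h : (1 = \int[mu]_x (chi2_pdf nu x)%:E)%E.
  rewrite -[LHS](@probability_setT _ _ _ (distribution Q Y)).
  exact: (Y_law measurableT).
rewrite h -(addr0 1) -kernel_integral; apply: eq_integral => x _.
by rewrite mul0r oppr0 expR0 mul1r.
Qed.

(** Half a chi-squared variable with [2 * m.+1] degrees of freedom is a gamma
    variable of shape [m.+1]; scaling the gamma integral gives its transform. *)
Lemma chi2_laplace (t : R) : 0 <= t ->
  (\int[Q]_w (expR (- (t * (Num.max (Y w) 0 / 2))))%:E = ((1 + t) ^- m.+1)%:E)%E.
Proof.
move=> t0; have t1 : 0 < 1 + t by lra.
rewrite (@integral_density _ _ _ _ Y (chi2_pdf nu) (fun x => expR (- (t * (Num.max x 0 / 2)))));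
  [|exact: measurable_chi2_pdf|exact: chi2_pdf_ge0|exact: Y_law| |].
- rewrite kernel_integral; set X := (_ * _)%E.
  have X1 : (((1 + t) ^+ m.+1)%:E * X = 1)%E.
    by rewrite /X muleCA -J_scale.
  rewrite -[LHS]mul1e -[X in (X * _)%E](_ : ((1 + t) ^- m.+1 * (1 + t) ^+ m.+1)%:E = 1%E).
    by rewrite EFinM -muleA X1 mule1.
  by rewrite mulVf// expf_neq0// gt_eqF.
- apply: continuous_measurable_fun => x.
  apply: (@continuous_comp _ _ _ (fun x : R => - (t * (Num.max x 0 / 2))) expR); last exact: continuous_expR.
  apply: cvgN; apply: cvgMr; apply: cvgMl.
  by apply: continuous_max; [exact: cvg_id|exact: cvg_cst].
- exists 1 => x; rewrite ger0_norm ?expR_ge0// -expR0 ler_expR oppr_le0.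
  by rewrite mulr_ge0// divr_ge0// le_max lexx orbT.
Qed.

Lemma chi2_gt0 : {ae Q, forall w, 0 < Y w}.
Proof.
exists (Y @^-1` `]-oo, 0%R]); split.
- by rewrite -[X in measurable X]setTI; exact: measurable_funPT.
- have -> : Q (Y @^-1` `]-oo, 0%R]) = distribution Q Y `]-oo, 0%R] by [].
  rewrite Y_law// /chi2_prob; apply: integral0_eq => x.
  rewrite /= in_itv/= => x0; rewrite /chi2_pdf ltNge x0//.
- by move=> w /= /negP; rewrite -leNgt in_itv.
Qed.

End Law.
End Chi2.

(** * Means of real functions and independence *)

Section Mean.
Context {R : realType} {d : measure_display} {T : measurableType d}.
Variable Q : probability T R.
Implicit Types g h : T -> R.

Definition mean g : R := (\int[Q]_w g w)%R.
Definition has_mean g : Prop := Q.-integrable setT (EFin \o g).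

Lemma has_mean_bounded g k : measurable_fun setT g -> (forall w, `|g w| <= k) ->
  has_mean g.
Proof.
move=> mg gk; apply: measurable_bounded_integrable => //.
  by rewrite -ge0_fin_numE// fin_num_measure.
by exists k; split; [exact: num_real|move=> x kx y _; exact: le_trans (gk _) (ltW kx)].
Qed.

Lemma has_mean_cst k : has_mean (fun=> k).
Proof. by apply: (@has_mean_bounded _ `|k|) => //; exact: measurable_cst. Qed.

Lemma mean_cst k : mean (fun=> k) = k.
Proof.
rewrite /mean Rintegral_cst//; have := @probability_setT _ _ _ Q.
by move=> /= ->; rewrite mulr1.
Qed.

Lemma meanD g h : has_mean g -> has_mean h -> mean (fun w => g w + h w) = mean g + mean h.
Proof. by move=> ig ih; exact: RintegralD. Qed.

Lemma meanZ k g : has_mean g -> mean (fun w => k * g w) = k * mean g.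
Proof. by move=> ig; exact: RintegralZl. Qed.

Lemma meanB g h : has_mean g -> has_mean h -> mean (fun w => g w - h w) = mean g - mean h.
Proof. by move=> ig ih; exact: RintegralB. Qed.

Lemma has_meanD g h : has_mean g -> has_mean h -> has_mean (fun w => g w + h w).
Proof. by move=> ig ih; rewrite /has_mean; have := integrableD measurableT ig ih; exact. Qed.

Lemma has_meanB g h : has_mean g -> has_mean h -> has_mean (fun w => g w - h w).
Proof. by move=> ig ih; rewrite /has_mean; have := integrableB measurableT ig ih; exact. Qed.

Lemma has_meanZ k g : has_mean g -> has_mean (fun w => k * g w).
Proof. by move=> ig; rewrite /has_mean; have := integrableZl measurableT k ig; exact. Qed.

Lemma has_mean_sum (I : Type) (r : seq I) (F : I -> T -> R) :
  (forall i, has_mean (F i)) -> has_mean (fun w => \sum_(i <- r) F i w).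
Proof.
move=> iF; elim: r => [|i r IH].
  rewrite (_ : (fun w => _) = cst 0); last by apply/funext => w; rewrite big_nil.
  by apply: (@has_mean_bounded _ 0) => [|w]; [exact: measurable_cst|rewrite normr0].
rewrite (_ : (fun w => _) = fun w => F i w + \sum_(j <- r) F j w).
  exact: has_meanD.
by apply/funext => w; rewrite big_cons.
Qed.

Lemma mean_sum (I : Type) (r : seq I) (F : I -> T -> R) :
  (forall i, has_mean (F i)) ->
  mean (fun w => \sum_(i <- r) F i w) = \sum_(i <- r) mean (F i).
Proof.
move=> iF; elim: r => [|i r IH].
  rewrite big_nil -[RHS](mean_cst 0); congr mean.
  by apply/funext => w; rewrite big_nil.
rewrite big_cons -IH -meanD//; last exact: has_mean_sum.
by congr mean; apply/funext => w; rewrite big_cons.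
Qed.

Lemma le_mean g h : has_mean g -> has_mean h -> (forall w, g w <= h w) ->
  mean g <= mean h.
Proof. by move=> ig ih gh; apply: le_Rintegral. Qed.

Lemma mean_ge0 g : (forall w, 0 <= g w) -> 0 <= mean g.
Proof. by move=> g0; apply: Rintegral_ge0. Qed.

Lemma mean_le g k : has_mean g -> (forall w, g w <= k) -> mean g <= k.
Proof.
move=> ig gk; rewrite -(mean_cst k); apply: le_mean => //; exact: has_mean_cst.
Qed.

Lemma norm_le_mean g h : has_mean g -> has_mean h -> (forall w, `|g w| <= h w) ->
  `|mean g| <= mean h.
Proof.
move=> ig ih gh; rewrite ler_norml; apply/andP; split; last first.
  by apply: le_mean => // w; exact: le_trans (ler_norm _) (gh w).
rewrite -mulN1r -meanZ//; apply: le_mean => // [|w]; first exact: has_meanZ.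
by rewrite mulN1r lerNl; apply: le_trans (gh w); rewrite -normrN ler_norm.
Qed.

Lemma norm_mean_le g k : has_mean g -> (forall w, `|g w| <= k) -> `|mean g| <= k.
Proof.
move=> ig gk; rewrite -(mean_cst k).
by apply: norm_le_mean gk => //; exact: has_mean_cst.
Qed.

Lemma mean_indic (A : set T) : measurable A -> mean (\1_A) = fine (Q A).
Proof. by move=> mA; rewrite /mean /Rintegral integral_indic// setIT. Qed.

End Mean.

(** The sum counts the levels below [y], so the approximation is [y] rounded
    down to a multiple of [1 / n.+1]. *)
Lemma level_approx (R : realType) (n : nat) (y : R) : 0 <= y <= 1 ->
  `|y - (n.+1%:R)^-1 * \sum_(i < n.+1) ((i.+1%:R / n.+1%:R <= y)%R : nat)%:R|
  <= (n.+1%:R)^-1.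
Proof.
move=> /andP[y0 y1]; set N : R := n.+1%:R.
have N0 : 0 < N by rewrite ltr0n.
pose q := Num.truncn (y * N).
have yN0 : 0 <= y * N by rewrite mulr_ge0// ltW.
have /andP[qy yq] : q%:R <= y * N < q.+1%:R by exact: truncn_itv.
have qn : (q <= n.+1)%N.
  by rewrite -(ler_nat R) (le_trans qy)// ler_piMl// ltW.
have -> : \sum_(i < n.+1) ((i.+1%:R / N <= y)%R : nat)%:R = q%:R :> R.
  rewrite -natr_sum; congr (_%:R).
  rewrite (eq_bigr (fun i : 'I_n.+1 => ((i < q)%N : nat))); last first.
    move=> i _; rewrite ler_pdivrMr//; congr nat_of_bool.
    apply/idP/idP => iq; last by rewrite (le_trans _ qy)// ler_nat.
    by rewrite -ltnS -(ltr_nat R) (le_lt_trans iq).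
  have minE k : (\sum_(i < k) ((i < q)%N : nat) = minn k q)%N.
    elim: k => [|k IH]; first by rewrite big_ord0 min0n.
    rewrite big_ord_recr/= IH; case: (ltnP k q) => kq.
      by rewrite (minn_idPl kq) addn1.
    by rewrite (minn_idPr (leq_trans kq (leqnSn k))) addn0.
  by rewrite minE; apply/minn_idPr.
have -> : y - N^-1 * q%:R = N^-1 * (y * N - q%:R).
  by rewrite mulrBr mulrCA mulVf ?mulr1// gt_eqF.
rewrite normrM gtr0_norm ?invr_gt0// -[leRHS]mulr1 ler_pM2l ?invr_gt0//.
rewrite ger0_norm ?subr_ge0//; rewrite -natr1 in yq; lra.
Qed.

Section Independent.
Context {R : realType} {d : measure_display} {T : measurableType d}.
Context {Q : probability T R}.
Variable Y : nat -> {RV Q >-> R}.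
Hypothesis Y_indep : mutually_independent Y.

Let mY k : measurable_fun setT (Y k : T -> measurableTypeR R).
Proof. exact: (measurable_funPT (Y k)). Qed.

(** Independence passes from indicators to bounded functions one factor at a
    time, each being uniformly approximated by its level sets. *)
Lemma mean_indep_prod (K : nat) (h : nat -> R -> R) :
  (forall k, measurable_fun setT (h k)) -> (forall k x, 0 <= h k x <= 1) ->
  mean Q (fun w => \prod_(k < K) h k (Y k w)) =
  \prod_(k < K) mean Q (fun w => h k (Y k w)).
Proof.
(* induction on [j], the number of leading factors that are not indicators *)
suff H j (g : nat -> R -> R) : (forall k, measurable_fun setT (g k)) ->
    (forall k x, 0 <= g k x <= 1) ->
    (forall k x, (j <= k)%N -> g k x = ((g k x == 1) : nat)%:R) ->
    mean Q (fun w => \prod_(k < K) g k (Y k w)) =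
    \prod_(k < K) mean Q (fun w => g k (Y k w)).
  move=> mh h01.
  pose h' k := if (k < K)%N then h k else cst 1.
  have h'E (k : 'I_K) : h' k = h k by rewrite /h' ltn_ord.
  have := H K h'.
  rewrite (_ : (fun w => _) = fun w => \prod_(k < K) h k (Y k w)); last first.
    by apply/funext => w; apply: eq_bigr => k _; rewrite h'E.
  rewrite (eq_bigr (fun k : 'I_K => mean Q (fun w => h k (Y k w)))); last first.
    by move=> k _; rewrite h'E.
  apply; rewrite /h'.
  - by move=> k; case: ifP => // _; exact: measurable_cst.
  - by move=> k x; case: ifP => // _; rewrite /= ler01 lexx.
  - by move=> k x Kk; rewrite ltnNge Kk/= eqxx.
elim: j g => [|j IH] g mg g01 gind.
  pose B k : set R := [set x | g k x = 1].
  have mB k : measurable (B k).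
    by have := mg k measurableT [set 1] (measurable_set1 1); rewrite setTI.
  have gB k x : g k x = \1_(B k) x.
    rewrite gind// indicE; congr (nat_of_bool _)%:R.
    by apply/eqP/idP => [|]; [move=> ?; rewrite inE|rewrite inE].
  have mYB k : measurable (Y k @^-1` B k).
    by have := mY k measurableT (mB k); rewrite setTI.
  have -> : (fun w => \prod_(k < K) g k (Y k w)) =
     \1_[set w | forall k, k \in iota 0 K -> B k (Y k w)].
    apply/funext => w; rewrite indicE; case: (boolP (w \in _)) => [|].
      rewrite inE/= => wB; rewrite big1// => k _.
      by rewrite gB indicE mem_set//; apply: wB; rewrite mem_iota/= add0n.
    move=> wn; have [k kw] : exists k : 'I_K, ~ B k (Y k w).
      apply: contrapT => /forallNP nk; move/negP: wn; apply; rewrite inE => k.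
      rewrite mem_iota/= add0n => kK; have := nk (Ordinal kK).
      by move/contrapT.
    rewrite (bigD1 k)//= gB indicE memNset//= mul0r//.
  rewrite mean_indic.
    rewrite Y_indep ?iota_uniq//.
    have -> : (\prod_(k <- iota 0 K) Q (Y k @^-1` B k) =
      (\prod_(k <- iota 0 K) fine (Q (Y k @^-1` B k)))%:E)%E.
      elim: (iota 0 K) => [|k r IHr]; first by rewrite !big_nil.
      by rewrite !big_cons IHr EFinM fineK// fin_num_measure.
    rewrite /= -[X in iota 0 X]subn0 -/(index_iota 0 K) big_mkord.
    apply: eq_bigr => k _; rewrite -mean_indic//; congr mean.
    by apply/funext => w; rewrite gB.
  have -> : [set w | forall k, k \in iota 0 K -> B k (Y k w)] =
      \big[setI/setT]_(k <- iota 0 K) (Y k @^-1` B k).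
    by rewrite -bigcap_seq; apply/seteqP; split => w wB k; exact: wB.
  by apply: bigsetI_measurable => k _.
(* the factor of index [j] is replaced by the indicators of its level sets *)
pose upd f k := if k == j then f else g k.
have P (f : R -> R) : measurable_fun setT f -> (forall x, 0 <= f x <= 1) ->
    (forall x, f x = ((f x == 1) : nat)%:R) ->
    mean Q (fun w => \prod_(k < K) upd f k (Y k w)) =
    \prod_(k < K) mean Q (fun w => upd f k (Y k w)).
  move=> mf f01 find; apply: IH.
  - by move=> k; rewrite /upd; case: eqP.
  - by move=> k x; rewrite /upd; case: eqP.
  - move=> k x jk; rewrite /upd; case: eqP => [_|/eqP nkj]; first exact: find.
    by apply: gind; rewrite ltn_neqAle eq_sym nkj.
have [jK|Kj] := ltnP j K; last first.
  have /P : measurable_fun setT (cst (1 : R) : R -> R) by exact: measurable_cst.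
  move=> /(_ (fun=> _))/(_ (fun=> _)).
  have updE (k : 'I_K) : upd (cst 1) k = g k.
    by rewrite /upd; case: eqP => // kj; move: (ltn_ord k); rewrite kj ltnNge Kj.
  rewrite (_ : (fun w => _) = fun w => \prod_(k < K) g k (Y k w)); last first.
    by apply/funext => w; apply: eq_bigr => k _; rewrite updE.
  rewrite (eq_bigr (fun k : 'I_K => mean Q (fun w => g k (Y k w)))); last first.
    by move=> k _; rewrite updE.
  by apply=> *; rewrite /= ?ler01 ?lexx ?eqxx.
pose oj := Ordinal jK.
pose H w := \prod_(k < K | k != oj) g k (Y k w).
pose c := \prod_(k < K | k != oj) mean Q (fun w => g k (Y k w)).
have updj f : upd f oj = f by rewrite /upd eqxx.
have updk f (k : 'I_K) : k != oj -> upd f k = g k.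
  by move=> kj; rewrite /upd; case: eqP => // E; move/eqP: kj; case; apply/val_inj.
have {}P (f : R -> R) : measurable_fun setT f -> (forall x, 0 <= f x <= 1) ->
    (forall x, f x = ((f x == 1) : nat)%:R) ->
    mean Q (fun w => f (Y j w) * H w) = mean Q (fun w => f (Y j w)) * c.
  move=> mf f01 find; have := P f mf f01 find.
  rewrite (bigD1 oj)//= updj => E; rewrite (_ : c = \prod_(k < K | k != oj) mean Q (fun w => upd f k (Y k w))).
    rewrite -E; congr mean; apply/funext => w; rewrite (bigD1 oj)//= updj; congr (_ * _).
    by apply: eq_bigr => k kj; rewrite updk.
  by apply: eq_bigr => k kj; rewrite updk.
have -> : (fun w => \prod_(k < K) g k (Y k w)) = fun w => g j (Y j w) * H w.
  by apply/funext => w; rewrite (bigD1 oj).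
rewrite (bigD1 oj)//= -/c.
have mgY k : measurable_fun setT (fun w => g k (Y k w)).
  by apply: (measurableT_comp (mg k)); exact: mY.
have mH : measurable_fun setT H.
  rewrite /H; under eq_fun do rewrite big_mkcond.
  apply: measurable_prod => k _; case: (k != oj) => //; exact: measurable_cst.
have H01 w : 0 <= H w <= 1.
  rewrite prodr_ge0/=; last by move=> k _; case/andP: (g01 k (Y k w)).
  by apply: prodr_ile1 => k _; exact: g01.
have hY (f : R -> R) : measurable_fun setT f -> (forall x, 0 <= f x <= 1) -> has_mean Q (fun w => f (Y j w)).
  move=> mf f01; apply: (@has_mean_bounded _ _ _ _ _ 1).
    by apply: (measurableT_comp mf); exact: mY.
  by move=> w; have /andP[? ?] := f01 (Y j w); rewrite ger0_norm.
have hYH (f : R -> R) : measurable_fun setT f -> (forall x, 0 <= f x <= 1) -> has_mean Q (fun w => f (Y j w) * H w).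
  move=> mf f01; apply: (@has_mean_bounded _ _ _ _ _ 1).
    by apply: measurable_funM => //; apply: (measurableT_comp mf); exact: mY.
  move=> w; have /andP[? ?] := f01 (Y j w); have /andP[? ?] := H01 w.
  by rewrite ger0_norm ?mulr_ge0// mulr_ile1.
have c01 : 0 <= c <= 1.
  rewrite prodr_ge0/=; last by move=> k _; apply: mean_ge0 => w; case/andP: (g01 k (Y k w)).
  apply: prodr_ile1 => k _; rewrite mean_ge0 /=; last by move=> w; case/andP: (g01 k (Y k w)).
  apply: mean_le => [|w]; last by case/andP: (g01 k (Y k w)).
  apply: (@has_mean_bounded _ _ _ _ _ 1) => // w.
  by have /andP[? ?] := g01 k (Y k w); rewrite ger0_norm.
apply/eqP; rewrite -subr_eq0 -normr_eq0 eq_le normr_ge0 andbT.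
apply/ler_addgt0Pr => e e0; rewrite add0r.
pose n := Num.truncn (2 / e); pose N : R := n.+1%:R.
have N0 : 0 < N by rewrite ltr0n.
have Ne : 2 * N^-1 <= e.
  rewrite ler_pdivrMr// mulrC -ler_pdivrMr// ltW//.
  by have /andP[] := @truncn_itv _ (2 / e) (divr_ge0 (ler0n _ 2) (ltW e0)).
pose lev (i : 'I_n.+1) (x : R) : R := ((i.+1%:R / N <= g j x)%R : nat)%:R.
have mlev i : measurable_fun setT (lev i).
  rewrite (_ : lev i = \1_[set x | i.+1%:R / N <= g j x]); last first.
    by apply/funext => x; rewrite /lev indicE mem_setE.
  apply: measurable_indic; rewrite -[X in measurable X]setTI.
  have := @measurable_fun_ler _ _ R setT (cst (i.+1%:R / N)) (g j) (measurable_cst _) (mg j).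
  by move=> /(_ measurableT [set true]); apply.
have lev01 i x : 0 <= lev i x <= 1 by rewrite /lev ler0n lern1 leq_b1.
have levP i := P (lev i) (mlev i) (lev01 i).
pose gn x := N^-1 * \sum_i lev i x.
have near x : `|g j x - gn x| <= N^-1 by exact: level_approx.
have hYi i := hY (lev i) (mlev i) (lev01 i).
have hYHi i := hYH (lev i) (mlev i) (lev01 i).
have hn : has_mean Q (fun w => gn (Y j w)).
  by apply: has_meanZ; apply: has_mean_sum.
have gnH w : gn (Y j w) * H w = N^-1 * \sum_i lev i (Y j w) * H w.
  by rewrite /gn -mulrA mulr_suml.
have hnH : has_mean Q (fun w => gn (Y j w) * H w).
  rewrite (_ : (fun w => _) = fun w => N^-1 * \sum_i lev i (Y j w) * H w).
    by apply: has_meanZ; apply: has_mean_sum.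
  by apply/funext => w; exact: gnH.
have En : mean Q (fun w => gn (Y j w) * H w) = mean Q (fun w => gn (Y j w)) * c.
  rewrite (_ : (fun w => _) = fun w => N^-1 * \sum_i lev i (Y j w) * H w); last first.
    by apply/funext => w; exact: gnH.
  rewrite !meanZ ?mean_sum//; try exact: has_mean_sum.
  rewrite -mulrA mulr_suml; congr (_ * _); apply: eq_bigr => i _.
  apply: levP => x; rewrite /lev; case: (_ <= _); first by rewrite eqxx.
  by rewrite mulr0n [0 == 1]eq_sym oner_eq0.
have hg := hY (g j) (mg j) (g01 j); have hgH := hYH (g j) (mg j) (g01 j).
have d1 : `|mean Q (fun w => g j (Y j w) * H w) - mean Q (fun w => gn (Y j w) * H w)| <= N^-1.
  rewrite -meanB//; apply: norm_mean_le; first exact: has_meanB.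
  move=> w; rewrite -mulrBl normrM -[leRHS]mulr1; apply: ler_pM => //.
  by have /andP[? ?] := H01 w; rewrite ger0_norm.
have d2 : `|mean Q (fun w => g j (Y j w)) - mean Q (fun w => gn (Y j w))| <= N^-1.
  by rewrite -meanB//; apply: norm_mean_le; first exact: has_meanB.
apply: le_trans Ne.
have /andP[c0 c1] := c01.
rewrite [X in `|X|](_ : _ = (mean Q (fun w => g j (Y j w) * H w) - mean Q (fun w => gn (Y j w) * H w))
   - (mean Q (fun w => g j (Y j w)) - mean Q (fun w => gn (Y j w))) * c); last by rewrite En; ring.
apply: (le_trans (ler_normB _ _)); rewrite [leRHS](_ : _ = N^-1 + N^-1); last by ring.
rewrite lerD// normrM (ger0_norm c0) -[leRHS]mulr1; exact: ler_pM.
Qed.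
End Independent.

(** * Approximation by exponentials in two variables *)

Section Bernstein.
Context {R : realType}.

(** De Casteljau's recursion, with the samples indexed by [0, ..., n] instead of
    by the points [p / n]. It makes positivity and the moment formulas immediate
    by induction. *)
Fixpoint bernstein (n : nat) (h : nat -> R) (u : R) : R :=
  if n is n'.+1 then
    u * bernstein n' (fun p => h p.+1) u + (1 - u) * bernstein n' h u
  else h 0%N.

Lemma bernsteinD n g h u :
  bernstein n (fun p => g p + h p) u = bernstein n g u + bernstein n h u.
Proof. by elim: n g h => //= n IH g h; rewrite !IH; ring. Qed.

Lemma bernsteinZ n k h u : bernstein n (fun p => k * h p) u = k * bernstein n h u.
Proof. by elim: n h => //= n IH h; rewrite !IH; ring. Qed.

Lemma bernstein_cst n k u : bernstein n (fun=> k) u = k.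
Proof. by elim: n => //= n ->; ring. Qed.

Lemma le_bernstein n g h u : 0 <= u <= 1 -> (forall p, (p <= n)%N -> g p <= h p) ->
  bernstein n g u <= bernstein n h u.
Proof.
move=> /andP[u0 u1]; elim: n g h => [|n IH] g h gh /=; first exact: gh.
by apply: lerD; apply: ler_wpM2l; rewrite ?subr_ge0//; apply: IH => p pn; apply: gh => //; exact: leqW.
Qed.

(** The shift [k] is what allows the induction to go through. *)
Lemma bernstein_sq n u k :
  bernstein n (fun p => (p%:R + k) ^+ 2) u = n%:R * u * (1 - u) + (n%:R * u + k) ^+ 2.
Proof.
elim: n k => [|n IH] k /=; first by ring.
rewrite IH (_ : (fun p : nat => (p.+1%:R + k) ^+ 2) = fun p : nat => (p%:R + (1 + k)) ^+ 2); last first.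
  by apply/funext => p; rewrite -natr1 addrA.
by rewrite IH -natr1; ring.
Qed.

Lemma bernstein_var n u : 0 <= u <= 1 ->
  bernstein n.+1 (fun p => (p%:R / n.+1%:R - u) ^+ 2) u <= (4 * n.+1%:R)^-1.
Proof.
move=> /andP[u0 u1]; set N : R := n.+1%:R; have N0 : 0 < N by rewrite ltr0n.
rewrite (_ : (fun p => _) = fun p : nat => N ^- 2 * (p%:R + (- N * u)) ^+ 2); last first.
  by apply/funext => p; field; rewrite gt_eqF.
rewrite bernsteinZ bernstein_sq -/N.
rewrite (_ : N ^- 2 * _ = N^-1 * (u * (1 - u))); last by field; rewrite gt_eqF.
rewrite invfM mulrC ler_pM2r ?invr_gt0//.
have := sqr_ge0 (u - 2^-1); have : 2^-1 * 2 = 1 :> R by rewrite mulVf.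
have : (4:R)^-1 * 4 = 1 by rewrite mulVf.
nra.
Qed.

(** The entry [(k, (i, j))] stands for the term [k * exp (- (i a + j b))]. *)
Definition exp_sum (e : seq (R * (nat * nat))) (a b : R) : R :=
  \sum_(t <- e) t.1 * expR (- (t.2.1%:R * a + t.2.2%:R * b)).

Lemma exp_sum_bernstein_r n (h : nat -> R) :
  exists e, forall a b, exp_sum e a b = bernstein n h (expR (- b)).
Proof.
elim: n h => [|n IH] h /=.
  by exists [:: (h 0%N, (0, 0)%N)] => a b; rewrite /exp_sum big_seq1/= !mul0r addr0 oppr0 expR0 mulr1.
have [e eE] := IH (fun p => h p.+1); have [e' e'E] := IH h.
exists ([seq (t.1, (t.2.1, t.2.2.+1)) | t <- e] ++ e' ++ [seq (- t.1, (t.2.1, t.2.2.+1)) | t <- e']) => a b.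
rewrite -(eE a b) -(e'E a b) /exp_sum !big_cat/= !big_map/= mulrBl mul1r !mulr_sumr -sumrN.
congr (_ + (_ + _)); apply: eq_bigr => t _.
  by rewrite mulrCA -expRD; congr (_ * expR _); rewrite -natr1; ring.
by rewrite mulNr; congr (- _); rewrite mulrCA -expRD; congr (_ * expR _); rewrite -natr1; ring.
Qed.

Lemma exp_sum_bernstein n (Phi : nat -> R -> R -> R) :
  (forall p, exists e, forall a b, exp_sum e a b = Phi p a b) ->
  exists e, forall a b, exp_sum e a b = bernstein n (fun p => Phi p a b) (expR (- a)).
Proof.
elim: n Phi => [|n IH] Phi PhiE /=; first exact: PhiE.
have [e eE] := IH (fun p => Phi p.+1) (fun p => PhiE p.+1).
have [e' e'E] := IH Phi PhiE.
exists ([seq (t.1, (t.2.1.+1, t.2.2)) | t <- e] ++ e' ++ [seq (- t.1, (t.2.1.+1, t.2.2)) | t <- e']) => a b.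
rewrite -(eE a b) -(e'E a b) /exp_sum !big_cat/= !big_map/= mulrBl mul1r !mulr_sumr -sumrN.
congr (_ + (_ + _)); apply: eq_bigr => t _.
  by rewrite mulrCA -expRD; congr (_ * expR _); rewrite -natr1; ring.
by rewrite mulNr; congr (- _); rewrite mulrCA -expRD; congr (_ * expR _); rewrite -natr1; ring.
Qed.

(** Heine's theorem, from the Bolzano-Weierstrass theorem. *)
Lemma segment_unif_continuous (f : R -> R) (M e : R) : continuous f -> 0 < e ->
  exists2 d, 0 < d & forall x y, `|x| <= M -> `|y| <= M -> `|x - y| <= d ->
    `|f x - f y| <= e.
Proof.
move=> cf e0; apply: contrapT => nd.
have H (n : nat) : exists xy : R * R, [/\ `|xy.1| <= M, `|xy.2| <= M,
   `|xy.1 - xy.2| <= (n.+1%:R)^-1 & e < `|f xy.1 - f xy.2|].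
  apply: contrapT => nxy; apply: nd; exists (n.+1%:R)^-1; first by rewrite invr_gt0.
  move=> x y xM yM xy; rewrite leNgt; apply/negP => h.
  by apply: nxy; exists (x, y).
have [u uP] := choice H.
have bx : bounded_fun (fun n => (u n).1).
  exists M; split; [exact: num_real|move=> z Mz n _ /=].
  by have [h _ _ _] := uP n; exact: le_trans h (ltW Mz).
have [s smono cs] := bolzano_weierstrass bx.
have sn n : (n <= s n)%N.
  elim: n => // n IH; apply: leq_ltn_trans IH _.
  by have /increasing_seqP := smono; apply.
pose l := limn (fun n => (u (s n)).1).
have cx : (fun n => (u (s n)).1) @ \oo --> l by exact: cs.
have cd : (fun n => (u (s n)).1 - (u (s n)).2) @ \oo --> (0 : R).
  apply/cvgr0Pnorm_le => r r0.
  have /cvgr0Pnorm_le/(_ r r0) := @cvg_harmonic R; apply: filterS => n /=.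
  rewrite ger0_norm ?invr_ge0// => nr; have [_ _ h _] := uP (s n).
  apply: (le_trans h); apply: le_trans nr.
  by rewrite lef_pV2 ?posrE// ler_nat ltnS.
have cy : (fun n => (u (s n)).2) @ \oo --> l.
  rewrite (_ : (fun n => (u (s n)).2) = (fun n => (u (s n)).1 - ((u (s n)).1 - (u (s n)).2))).
    by rewrite -[l]subr0; exact: cvgB.
  by apply/funext => n; ring.
have cfd : (fun n => f (u (s n)).1 - f (u (s n)).2) @ \oo --> (0 : R).
  rewrite -(subrr (f l)); apply: cvgB.
    by apply: (cvg_comp _ _ cx); exact: cf.
  by apply: (cvg_comp _ _ cy); exact: cf.
have /cvgr0Pnorm_lt/(_ _ e0)[n _ /(_ n (leqnn n))/=] := cfd.
by rewrite ltNge; have [_ _ _ /ltW ->] := uP (s n).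
Qed.

(** Weierstrass approximation in the variables [exp (- a)] and [exp (- b)].
    Clamping [a] and [b] at [M] makes the target continuous on the closed unit
    square; the clamping error is what the last term accounts for. *)
Lemma exp_sum_approx (f : R -> R) (F M e : R) : continuous f ->
  (forall x, `|f x| <= F) -> 0 < M -> 0 < e ->
  exists s, forall a b, 0 <= a -> 0 <= b ->
    `|f (a - b) - exp_sum s a b| <= e + 2 * F * ((a + b) / M).
Proof.
move=> cf fF M0 e0.
have F0 : 0 <= F := le_trans (normr_ge0 (f 0)) (fF 0).
pose cl a : R := Num.min a M.
pose el u : R := - ln (Num.max u (expR (- M))).
have el_cl a : el (expR (- a)) = cl a.
  rewrite /el /cl; have [aM|/ltW Ma] := leP a M.
    by rewrite max_l ?ler_expR ?lerN2// expRK opprK.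
  by rewrite max_r ?ler_expR ?lerN2// expRK opprK.
have elM u : u <= 1 -> `|el u| <= M.
  move=> u1; rewrite /el normrN.
  have mpos : 0 < Num.max u (expR (- M)) by rewrite lt_max expR_gt0 orbT.
  rewrite ler0_norm; last by rewrite ln_le0// ge_max u1 -expR0 ler_expR oppr_le0 ltW.
  rewrite lerNl -[leLHS](expRK (- M)) ler_ln ?posrE ?expR_gt0//.
  by rewrite le_max lexx orbT.
pose m : R := expR (- M).
have m0 : 0 < m := expR_gt0 _.
have lnlip x y : m <= x -> x <= y -> ln y - ln x <= m^-1 * (y - x).
  move=> mx xy; have x0 : 0 < x := lt_le_trans m0 mx.
  rewrite -ln_div ?posrE//; last exact: lt_le_trans xy.
  have -> : y / x = 1 + (y - x) / x by field; rewrite gt_eqF.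
  have yx : 0 <= (y - x) / x by rewrite divr_ge0 ?subr_ge0// ltW.
  apply: (le_trans (le_ln1Dx _)); first by lra.
  rewrite mulrC; apply: ler_wpM2r; first by rewrite subr_ge0.
  by rewrite lef_pV2 ?posrE.
have ellip u v : `|el u - el v| <= m^-1 * `|u - v|.
  wlog uv : u v / u <= v.
    move=> wl; case/orP: (le_total u v) => [|h]; first exact: wl.
    by rewrite distrC [`|u - v|]distrC; exact: wl.
  have muv : Num.max u m <= Num.max v m by rewrite ge_max !le_max uv lexx !orbT.
  have := lnlip (Num.max u m) (Num.max v m).
  rewrite le_max lexx orbT => /(_ isT muv) h.
  have -> : el u - el v = ln (Num.max v m) - ln (Num.max u m) by rewrite /el -/m; ring.
  rewrite [`|u - v|]distrC ger0_norm; last first.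
    rewrite subr_ge0 ler_ln ?posrE//; apply: lt_le_trans m0 _; by rewrite le_max lexx orbT.
  apply: (le_trans h); rewrite ler_wpM2l ?invr_ge0 ?(ltW m0)// ger0_norm ?subr_ge0//.
  rewrite /Num.max; case: ltP => h1; case: ltP => h2; lra.
have [d d0 fd] := @segment_unif_continuous f (2 * M) (e / 2) cf (divr_gt0 e0 (ltr0n _ 2)).
pose g u v : R := f (el u - el v).
(* inside the square, the modulus of continuity and Chebyshev's inequality are
   combined into one pointwise bound *)
pose D := (d * m / 2) ^+ 2.
have D0 : 0 < D by rewrite exprn_gt0// divr_gt0// mulr_gt0.
have gg u v u' v' : u <= 1 -> v <= 1 -> u' <= 1 -> v' <= 1 ->
   `|g u' v' - g u v| <= e / 2 + 2 * F / D * ((u' - u) ^+ 2 + (v' - v) ^+ 2).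
  move=> u1 v1 u'1 v'1.
  have C0 : 0 <= 2 * F / D by rewrite divr_ge0 ?mulr_ge0// ltW.
  have [close|far] := leP ((u' - u) ^+ 2 + (v' - v) ^+ 2) D.
    apply: (@le_trans _ _ (e / 2)); last by rewrite lerDl mulr_ge0// addr_ge0 ?sqr_ge0.
    have sq x : x ^+ 2 <= D -> m^-1 * `|x| <= d / 2.
      move=> xD; rewrite ler_pdivrMl//.
      rewrite -(@ler_pXn2r _ 2) ?nnegrE ?mulr_ge0 ?divr_ge0 ?(ltW m0) ?(ltW d0)//.
      rewrite real_normK ?num_real// (le_trans xD)// /D le_eqVlt; apply/orP; left; apply/eqP.
      by congr (_ ^+ 2); ring.
    have := sqr_ge0 (u' - u); have := sqr_ge0 (v' - v) => h1 h2.
    have /sq hu : (u' - u) ^+ 2 <= D by lra.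
    have /sq hv : (v' - v) ^+ 2 <= D by lra.
    have l2 x y : x <= 1 -> y <= 1 -> `|el x - el y| <= 2 * M.
      move=> x1 y1; apply: (le_trans (ler_normB _ _)).
      by have := elM x x1; have := elM y y1; lra.
    apply: fd; rewrite ?l2//.
    have -> : el u' - el v' - (el u - el v) = (el u' - el u) - (el v' - el v) by ring.
    apply: (le_trans (ler_normB _ _)).
    by have := ellip u' u; have := ellip v' v; lra.
  apply: (@le_trans _ _ (2 * F)).
    by apply: (le_trans (ler_normB _ _)); have := fF (el u' - el v'); have := fF (el u - el v); rewrite /g; lra.
  rewrite -mulrA.
  have : 1 <= D^-1 * ((u' - u) ^+ 2 + (v' - v) ^+ 2) by rewrite ler_pdivlMl// mulr1 ltW.
  move: (D^-1 * _) => X X1; have : 2 * F * 1 <= 2 * F * X by rewrite ler_wpM2l// mulr_ge0.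
  lra.
pose C := 2 * F / D.
pose n := Num.truncn (C / e).
have nE : C / n.+1%:R <= e.
  rewrite ler_pdivrMr ?ltr0n// mulrC -ler_pdivrMr// ltW//.
  have C0 : 0 <= C / e by rewrite !divr_ge0 ?mulr_ge0// ltW.
  by have /andP[] := truncn_itv C0.
pose N : R := n.+1%:R.
have N0 : 0 < N by rewrite ltr0n.
have [s sE] : exists s, forall a b, exp_sum s a b =
    bernstein n.+1 (fun p => bernstein n.+1 (fun q => g (p%:R / N) (q%:R / N)) (expR (- b))) (expR (- a)).
  apply: (@exp_sum_bernstein n.+1 (fun p a b => bernstein n.+1 (fun q => g (p%:R / N) (q%:R / N)) (expR (- b)))).
  by move=> p; apply: exp_sum_bernstein_r.
exists s => a b a0 b0; rewrite sE.
pose u := expR (- a); pose v := expR (- b).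
have u01 : 0 <= u <= 1 by rewrite expR_ge0 -expR0 ler_expR oppr_le0.
have v01 : 0 <= v <= 1 by rewrite expR_ge0 -expR0 ler_expR oppr_le0.
have pN p : (p <= n.+1)%N -> p%:R / N <= 1 by move=> pn; rewrite ler_pdivrMr// mul1r ler_nat.
set B := bernstein _ _ _.
pose W p q : R := e / 2 + C * ((p%:R / N - u) ^+ 2 + (q%:R / N - v) ^+ 2).
have BW : bernstein n.+1 (fun p => bernstein n.+1 (W p) v) u <= e.
  rewrite /W (_ : (fun p => _) = fun p : nat => e / 2 + C * (p%:R / N - u) ^+ 2 + C * bernstein n.+1 (fun q => (q%:R / N - v) ^+ 2) v); last first.
    apply/funext => p.
    rewrite (_ : (fun q => _) = fun q : nat => (e / 2 + C * (p%:R / N - u) ^+ 2) + C * (q%:R / N - v) ^+ 2); last first.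
      by apply/funext => q; ring.
    by rewrite bernsteinD bernstein_cst bernsteinZ.
  rewrite bernsteinD bernstein_cst bernsteinD bernstein_cst bernsteinZ.
  have := bernstein_var n u01; have := bernstein_var n v01; rewrite -/N.
  rewrite invfM => hv hu.
  have C0 : 0 <= C by rewrite /C divr_ge0 ?mulr_ge0// ltW.
  have := ler_wpM2l C0 hu; have := ler_wpM2l C0 hv.
  move: nE; rewrite -/N.
  have -> : C * (4^-1 * N^-1) = (C / N) / 4 by ring.
  move: (C / N) (C * bernstein _ _ u) (C * bernstein _ _ v) => x y z; lra.
have BB : `|g u v - B| <= e.
  have lo : g u v - e <= B.
    apply: (@le_trans _ _ (bernstein n.+1 (fun p => bernstein n.+1 (fun q => g u v + (-1) * W p q) v) u)).
      rewrite (_ : (fun p => _) = fun p : nat => g u v + (-1) * bernstein n.+1 (W p) v); last first.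
        by apply/funext => p; rewrite bernsteinD bernstein_cst bernsteinZ.
      by rewrite bernsteinD bernstein_cst bernsteinZ; lra.
    apply: le_bernstein => // p pn; apply: le_bernstein => // q qn.
    have := gg u v (p%:R / N) (q%:R / N); have /andP[_ u1] := u01; have /andP[_ v1] := v01.
    move=> /(_ u1 v1 (pN p pn) (pN q qn)); rewrite ler_norml -/C -/(W p q) => /andP[]; lra.
  have hi : B <= g u v + e.
    apply: (@le_trans _ _ (bernstein n.+1 (fun p => bernstein n.+1 (fun q => g u v + W p q) v) u)).
      apply: le_bernstein => // p pn; apply: le_bernstein => // q qn.
      have := gg u v (p%:R / N) (q%:R / N); have /andP[_ u1] := u01; have /andP[_ v1] := v01.
      move=> /(_ u1 v1 (pN p pn) (pN q qn)); rewrite ler_norml -/C -/(W p q) => /andP[]; lra.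
    rewrite (_ : (fun p => _) = fun p : nat => g u v + bernstein n.+1 (W p) v); last first.
      by apply/funext => p; rewrite bernsteinD bernstein_cst.
    by rewrite bernsteinD bernstein_cst; lra.
  by rewrite ler_norml; apply/andP; split; lra.
have guv : `|f (a - b) - g u v| <= 2 * F * ((a + b) / M).
  rewrite /g /u /v !el_cl.
  have [aM|Ma] := leP a M; last first.
    apply: (@le_trans _ _ (2 * F)).
      by apply: (le_trans (ler_normB _ _)); have := fF (a - b); have := fF (cl a - cl b); lra.
    have : 1 <= (a + b) / M by rewrite ler_pdivlMr// mul1r; lra.
    by move=> h; rewrite -[leLHS]mulr1 ler_wpM2l// mulr_ge0.
  have [bM|Mb] := leP b M; last first.
    apply: (@le_trans _ _ (2 * F)).
      by apply: (le_trans (ler_normB _ _)); have := fF (a - b); have := fF (cl a - cl b); lra.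
    have : 1 <= (a + b) / M by rewrite ler_pdivlMr// mul1r; lra.
    by move=> h; rewrite -[leLHS]mulr1 ler_wpM2l// mulr_ge0.
  rewrite /cl (min_idPl aM) (min_idPl bM) subrr normr0.
  by apply: mulr_ge0; [exact: mulr_ge0|rewrite divr_ge0 ?addr_ge0// ltW].
have -> : f (a - b) - B = (g u v - B) + (f (a - b) - g u v) by ring.
by apply: (le_trans (ler_normD _ _)); exact: lerD.
Qed.
End Bernstein.

(** * Series with coefficients of both signs *)

Section SignedSeries.
Context {R : realType}.
Implicit Types b v : nat -> R.

Definition pos_part (x : R) : R := Num.max x 0.
Definition neg_part (x : R) : R := Num.max (- x) 0.

Lemma pos_part_ge0 x : 0 <= pos_part x. Proof. by rewrite le_max lexx orbT. Qed.
Lemma neg_part_ge0 x : 0 <= neg_part x. Proof. by rewrite le_max lexx orbT. Qed.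

Lemma pos_neg_partE x : x = pos_part x - neg_part x.
Proof. by rewrite /pos_part /neg_part /Num.max oppr_lt0; case: ltgtP => *; lra. Qed.

Lemma pos_part_le x : pos_part x <= `|x|.
Proof. by rewrite ge_max ler_norm normr_ge0. Qed.

Lemma neg_part_le x : neg_part x <= `|x|.
Proof. by rewrite ge_max -normrN ler_norm normr_ge0. Qed.

Definition pos_sum b v : R := limn (series (fun k => pos_part (b k) * v k)).
Definition neg_sum b v : R := limn (series (fun k => neg_part (b k) * v k)).
(** Zeroing the first terms, instead of shifting the index, keeps all series
    below aligned. *)
Definition tail_sum b v (K : nat) : R :=
  limn (series (fun k => if (k < K)%N then 0 else `|b k| * v k)).

Lemma norm_expR_lip (x y : R) : 0 <= x -> 0 <= y ->
  `|expR (- x) - expR (- y)| <= `|x - y|.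
Proof.
wlog xy : x y / x <= y.
  move=> wl x0 y0; case/orP: (le_total x y) => [|h]; first by move/wl; apply.
  by rewrite distrC [`|x - y|]distrC; exact: wl.
move=> x0 y0.
rewrite ger0_norm ?subr_ge0 ?ler_expR ?lerN2// distrC ger0_norm ?subr_ge0//.
have -> : expR (- y) = expR (- x) * expR (- (y - x)) by rewrite -expRD; congr expR; ring.
have := expR_ge1Dx (- (y - x)); have := expR_gt0 (- x).
have : expR (- x) <= 1 by rewrite -expR0 ler_expR oppr_le0.
move: (expR (- x)) (expR (- (y - x))) => p q ? ? ?.
nra.
Qed.

Section FixedSeries.
Variables b v : nat -> R.
Hypothesis v_ge0 : forall k, 0 <= v k.
Hypothesis bv_cvg : cvgn (series (fun k => `|b k| * v k)).

Let dominated (c : nat -> R) : (forall k, 0 <= c k <= `|b k|) ->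
  cvgn (series (fun k => c k * v k)).
Proof.
move=> cb; apply: series_le_cvg bv_cvg => k.
- by have /andP[? _] := cb k; rewrite mulr_ge0.
- by rewrite mulr_ge0.
- by have /andP[_ ?] := cb k; rewrite ler_wpM2r.
Qed.

Lemma cvg_pos_sum : series (fun k => pos_part (b k) * v k) @ \oo --> pos_sum b v.
Proof. by apply: dominated => k; rewrite pos_part_ge0 pos_part_le. Qed.

Lemma cvg_neg_sum : series (fun k => neg_part (b k) * v k) @ \oo --> neg_sum b v.
Proof. by apply: dominated => k; rewrite neg_part_ge0 neg_part_le. Qed.

Lemma cvg_tail_sum K :
  series (fun k => if (k < K)%N then 0 else `|b k| * v k) @ \oo --> tail_sum b v K.
Proof.
apply: (series_le_cvg _ _ _ bv_cvg) => k.
- by case: ifP => // _; rewrite mulr_ge0.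
- by rewrite mulr_ge0.
- by case: ifP => // _; rewrite mulr_ge0.
Qed.

Lemma cvg_signed_sum : series (fun k => b k * v k) @ \oo --> pos_sum b v - neg_sum b v.
Proof.
rewrite (_ : series _ = fun n => series (fun k => pos_part (b k) * v k) n
   - series (fun k => neg_part (b k) * v k) n).
  by apply: cvgB; [exact: cvg_pos_sum|exact: cvg_neg_sum].
apply/funext => n; rewrite /series/= -sumrB; apply: eq_bigr => k _.
by rewrite {1}(pos_neg_partE (b k)) mulrBl.
Qed.

Lemma pos_sum_ge0 : 0 <= pos_sum b v.
Proof.
apply: (cvgr_to_ge cvg_pos_sum).
by apply: nearW => n; apply: sumr_ge0 => k _; rewrite mulr_ge0 ?pos_part_ge0.
Qed.

Lemma neg_sum_ge0 : 0 <= neg_sum b v.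
Proof.
apply: (cvgr_to_ge cvg_neg_sum).
by apply: nearW => n; apply: sumr_ge0 => k _; rewrite mulr_ge0 ?neg_part_ge0.
Qed.

Lemma pos_neg_sumD : pos_sum b v + neg_sum b v = tail_sum b v 0.
Proof.
apply/esym; rewrite /tail_sum; apply: cvg_lim => //.
rewrite (_ : series _ = fun n => series (fun k => pos_part (b k) * v k) n
   + series (fun k => neg_part (b k) * v k) n).
  by apply: cvgD; [exact: cvg_pos_sum|exact: cvg_neg_sum].
apply/funext => n; rewrite /series/= -big_split/=; apply: eq_bigr => k _.
rewrite -mulrDl; congr (_ * _).
by rewrite /pos_part /neg_part /Num.max oppr_lt0; case: ltgtP => h; rewrite ?(ltr0_norm h) ?(gtr0_norm h) ?h ?normr0; lra.
Qed.

(** The exponential is 1-Lipschitz on the nonpositive half-line and the parts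
    of [b k] are at most [`|b k|]. *)
Lemma laplace_truncation (i j : R) (K : nat) : 0 <= i -> 0 <= j ->
  `|expR (- (i * pos_sum b v + j * neg_sum b v))
    - expR (- \sum_(k < K) (i * pos_part (b k) + j * neg_part (b k)) * v k)|
  <= (i + j) * tail_sum b v K.
Proof.
move=> i0 j0.
pose u k := (i * pos_part (b k) + j * neg_part (b k)) * v k.
have u0 k : 0 <= u k.
  by rewrite mulr_ge0// addr_ge0 ?mulr_ge0 ?pos_part_ge0 ?neg_part_ge0.
have ub k : u k <= (i + j) * (`|b k| * v k).
  rewrite mulrA ler_wpM2r// mulrDl lerD// ler_wpM2l ?pos_part_le ?neg_part_le//.
have cu : series u @ \oo --> i * pos_sum b v + j * neg_sum b v.
  rewrite (_ : series u = fun n => i * series (fun k => pos_part (b k) * v k) n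
   + j * series (fun k => neg_part (b k) * v k) n).
    by apply: cvgD; apply: cvgMr; [exact: cvg_pos_sum|exact: cvg_neg_sum].
  apply/funext => n; rewrite /series/= !mulr_sumr -big_split/=; apply: eq_bigr => k _.
  by rewrite /u; ring.
have AB0 : 0 <= i * pos_sum b v + j * neg_sum b v.
  by rewrite addr_ge0// mulr_ge0 ?pos_sum_ge0 ?neg_sum_ge0.
have -> : \sum_(k < K) (i * pos_part (b k) + j * neg_part (b k)) * v k = series u K.
  by rewrite /series/= big_mkord.
have uK0 : 0 <= series u K by apply: sumr_ge0.
apply: (le_trans (norm_expR_lip AB0 uK0)).
rewrite ger0_norm ?subr_ge0; last first.
  apply: (cvgr_to_ge cu); exists K => // n /= Kn.
  by rewrite -subr_ge0 sub_series_geq// sumr_ge0.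
rewrite lerBlDl.
have cr : (fun n => series u K + (i + j) * series (fun k => if (k < K)%N then 0 else `|b k| * v k) n) @ \oo
    --> series u K + (i + j) * tail_sum b v K.
  by apply: cvgD; [exact: cvg_cst|apply: cvgMr; exact: cvg_tail_sum].
apply: (ler_cvg_to cu cr); exists K => // n /= Kn.
rewrite -lerBlDl sub_series_geq// /series/= mulr_sumr [leRHS](big_cat_nat (n := K))//=.
rewrite -[leLHS]add0r; apply: lerD.
  by apply: sumr_ge0 => k _; case: ifP => _; rewrite ?mulr0// !mulr_ge0 ?addr_ge0.
rewrite big_nat [leRHS]big_nat; apply: ler_sum => k /andP[Kk _].
by rewrite ltnNge Kk.
Qed.

End FixedSeries.
End SignedSeries.

(** * The series of chi-squared variables *)

Lemma EFin_mean (R : realType) d (T : measurableType d) (Q : probability T R)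
    (g : T -> R) : has_mean Q g -> (\int[Q]_w (g w)%:E)%E = (mean Q g)%:E.
Proof.
by move=> ig; rewrite /mean /Rintegral fineK//; exact: (integrable_fin_num measurableT ig).
Qed.

Section Monotone.
Context {R : realType} {d : measure_display} {T : measurableType d}.
Variable Q : probability T R.
Variables (P : nat -> T -> R) (c : R).
Hypothesis mP : forall n, measurable_fun setT (P n).
Hypothesis P0 : forall n w, 0 <= P n w.
Hypothesis P_nd : forall w, nondecreasing_seq (P ^~ w).
Hypothesis P_int : forall n, (\int[Q]_w (P n w)%:E <= c%:E)%E.

Let lim_int : (\int[Q]_w (limn (fun n => (P n w)%:E)) <= c%:E)%E.
Proof.
have h := @cvg_monotone_convergence _ _ _ Q setT measurableT (fun n w => (P n w)%:E).
have mE n : measurable_fun setT (fun w => (P n w)%:E) by exact/measurable_EFinP.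
have {}h := h mE.
have {}h := h (fun n w _ => P0 n w).
have {}h := h (fun w _ m n mn => P_nd w mn).
rewrite -(cvg_lim _ h)//; apply: lime_le; first by apply/cvg_ex; eexists; exact: h.
by apply: nearW => n; exact: P_int.
Qed.

Lemma mean_monotone_limit (F : T -> R) :
  (forall w, P ^~ w @ \oo --> F w) -> has_mean Q F /\ mean Q F <= c.
Proof.
move=> PF.
have mF : measurable_fun setT F.
  by apply: (@measurable_fun_cvg _ _ _ _ P) => // w _; exact: PF.
have F0 w : 0 <= F w by apply: (cvgr_to_ge (PF w)); exact: nearW.
have E : (\int[Q]_w (F w)%:E <= c%:E)%E.
  apply: le_trans lim_int; rewrite le_eqVlt; apply/orP; left; apply/eqP.
  apply: eq_integral => w _; apply/esym/cvg_lim => //.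
  by apply: cvg_EFin; [exact: nearW|exact: PF].
have Foo : (\int[Q]_w (F w)%:E \is a fin_num)%E.
  rewrite ge0_fin_numE; first exact: le_lt_trans E (ltry c).
  by apply: integral_ge0 => w _; rewrite lee_fin.
split; last by rewrite -lee_fin /mean /Rintegral fineK.
apply/integrableP; split; first exact/measurable_EFinP.
under eq_integral do rewrite /= ger0_norm//.
exact: le_lt_trans E (ltry c).
Qed.

(** The extended limit has a finite mean by monotone convergence, hence is
    finite almost everywhere. *)
Lemma ae_monotone_cvg : exists G : set T,
  [/\ measurable G, Q (~` G) = 0%E & forall w, G w -> cvgn (P ^~ w)].
Proof.
pose L w : \bar R := limn (fun n => (P n w)%:E).
have mL : measurable_fun setT L.
  apply: (@emeasurable_fun_cvg _ _ _ setT (fun n w => (P n w)%:E)).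
    by move=> n; exact/measurable_EFinP.
  move=> w _; apply: ereal_nondecreasing_is_cvgn => m n mn.
  by rewrite lee_fin; exact: P_nd.
have L0 w : (0 <= L w)%E.
  apply: lime_ge; last by apply: nearW => n; rewrite lee_fin.
  by apply: ereal_nondecreasing_is_cvgn => m n mn; rewrite lee_fin; exact: P_nd.
have iL : Q.-integrable setT L.
  apply/integrableP; split => //.
  under eq_integral do rewrite gee0_abs//.
  exact: le_lt_trans lim_int (ltry c).
have [N [mN N0 LN]] := integrable_ae measurableT iL.
exists (~` N); split; first exact: measurableC.
  by rewrite setCK.
move=> w nNw; have Lfin : L w \is a fin_num.
  apply: contrapT => h; apply: nNw; apply: LN => /= /(_ I); exact: h.
apply: nondecreasing_is_cvgn; first exact: P_nd.
exists (fine (L w)) => _ [n _ <-].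
rewrite -lee_fin fineK//; apply: lime_ge.
  by apply: ereal_nondecreasing_is_cvgn => m k mk; rewrite lee_fin; exact: P_nd.
by exists n => // k /= nk; rewrite lee_fin; exact: P_nd.
Qed.

End Monotone.

Lemma mean_ae_eq (R : realType) d (T : measurableType d) (Q : probability T R)
    (f g : T -> R) (G : set T) :
  measurable_fun setT f -> measurable_fun setT g ->
  measurable G -> Q (~` G) = 0%E -> (forall w, G w -> f w = g w) ->
  (\int[Q]_w (f w)%:E = \int[Q]_w (g w)%:E)%E.
Proof.
move=> mf mg mG G0 fg; apply: ae_eq_integral => //; try exact/measurable_EFinP.
exists (~` G); split => //; first exact: measurableC.
by move=> w /= h Gw; apply: h => _; rewrite fg.
Qed.

(** Convergence is the Cauchy criterion, a countable combination of measurable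
    conditions. *)
Lemma measurable_cvg_set (R : realType) d (T : measurableType d) (h : nat -> T -> R) :
  (forall n, measurable_fun setT (h n)) -> measurable [set w | cvgn (h ^~ w)].
Proof.
move=> mh.
have -> : [set w | cvgn (h ^~ w)] =
    \bigcap_m \bigcup_N \bigcap_n [set w | `|h (N + n)%N w - h N w| <= (m.+1%:R)^-1].
  apply/seteqP; split => w /=.
    move=> cw m _.
    have e0 : 0 < (m.+1%:R)^-1 / 2 :> R by rewrite divr_gt0// invr_gt0.
    have /cvgrPdist_le/(_ _ e0)[N _ hN] := cw.
    exists N => // n _ /=; have h1 := hN N (leqnn N); have h2 := hN (N + n)%N (leq_addr n N).
    move: h1 h2 => /=; move: (limn _) => l h1 h2.
    have -> : h (N + n)%N w - h N w = (l - h N w) - (l - h (N + n)%N w) by ring.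
    by apply: (le_trans (ler_normB _ _)); rewrite [leRHS]splitr; exact: lerD.
  move=> H; apply/cauchy_cvgP/cauchy_exP => e e0.
  pose m := Num.truncn e^-1.
  have me : (m.+1%:R)^-1 < e.
    rewrite invf_plt ?posrE//.
    by have /andP[] := @truncn_itv _ e^-1 (ltW (etrans (invr_gt0 e) e0)).
  have [N _ hN] := H m I; exists (h N w); exists N => // n /= Nn.
  rewrite -ball_normE/= distrC; apply: le_lt_trans me.
  by have := hN (n - N)%N I; rewrite /= subnKC.
apply: bigcap_measurableType => m _; apply: bigcup_measurable => N _.
apply: bigcap_measurableType => n _.
rewrite -[X in measurable X]setTI.
have := @measurable_fun_ler _ _ R setT (fun w => `|h (N + n)%N w - h N w|) (cst (m.+1%:R)^-1).
have mB : measurable_fun setT (fun w => `|h (N + n)%N w - h N w|).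
  by apply: measurableT_comp => //; exact: measurable_funB.
by move=> /(_ mB (measurable_cst _) measurableT [set true]); apply.
Qed.

Section GammaSeries.
Context {R : realType} {d : measure_display} {T : measurableType d}.
Context {Q : probability T R} (m : nat) (Y : nat -> {RV Q >-> R}) (b : nat -> R).
Hypothesis Y_law : forall k, same_law (distribution Q (Y k)) (chi2_prob (2 * m.+1)).
Hypothesis Y_indep : mutually_independent Y.
Hypothesis b_cvg : cvgn (series (fun k => `|b k|)).

(** The positive part makes every partial sum of the dominating series
    nonnegative everywhere; [V k] is half of [Y k] almost surely. *)
Let V k w : R := Num.max (Y k w) 0 / 2.

Let V_ge0 k w : 0 <= V k w.
Proof. by rewrite divr_ge0// le_max lexx orbT. Qed.

Let mY k : measurable_fun setT (fun w => Y k w : R).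
Proof. exact: (measurable_funPT (Y k)). Qed.

Let mV k : measurable_fun setT (V k).
Proof.
apply: measurable_funM => //; apply: measurable_maxr => //; exact: measurable_cst.
Qed.

Let mexpV t k : measurable_fun setT (fun w => expR (- (t * V k w))).
Proof.
apply: measurableT_comp => //; apply: measurableT_comp => //.
by apply: measurable_funM => //; exact: measurable_cst.
Qed.

Let expV_mean t k : 0 <= t -> has_mean Q (fun w => expR (- (t * V k w))).
Proof.
move=> t0; apply: (@has_mean_bounded _ _ _ _ _ 1) => // w.
by rewrite ger0_norm ?expR_ge0// -expR0 ler_expR oppr_le0 mulr_ge0.
Qed.

Let V_laplace t k : 0 <= t ->
  mean Q (fun w => expR (- (t * V k w))) = (1 + t) ^- m.+1.
Proof. by move=> t0; rewrite /mean /Rintegral (chi2_laplace (Y_law k)). Qed.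

(** [V * exp (- r V)] increases to [V] as [r] decreases to 0 and is at most
    [(1 - exp (- r V)) / r], whose mean is given by the Laplace transform. *)
Let V_mean k : has_mean Q (V k) /\ mean Q (V k) <= m.+1%:R.
Proof.
pose r n : R := (n.+1%:R)^-1.
have r0 n : 0 < r n by rewrite invr_gt0.
apply: (@mean_monotone_limit _ _ _ _ (fun n w => V k w * expR (- (r n * V k w)))).
- by move=> n; apply: measurable_funM.
- by move=> n w; rewrite mulr_ge0 ?expR_ge0.
- move=> w n p np; rewrite ler_wpM2l// ler_expR lerN2 ler_wpM2r//.
  by rewrite lef_pV2 ?posrE// ler_nat.
- move=> n.
  have bound w : V k w * expR (- (r n * V k w)) <= (r n)^-1 * (1 - expR (- (r n * V k w))).
    rewrite ler_pdivlMl// mulrA.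
    have := expR_ge1Dx (r n * V k w); have := expRxMexpNx_1 (r n * V k w).
    have := expR_gt0 (- (r n * V k w)); have : 0 <= r n * V k w by rewrite mulr_ge0// ltW.
    move: (r n * V k w) => x; move: (expR x) (expR (- x)) => p q.
    nra.
  have hr := expV_mean k (ltW (r0 n)).
  have h1 : has_mean Q (fun=> 1 : R) by exact: has_mean_cst.
  have h2 : has_mean Q (fun w => (r n)^-1 * (1 - expR (- (r n * V k w)))).
    by apply: has_meanZ; exact: has_meanB.
  have h3 : has_mean Q (fun w => V k w * expR (- (r n * V k w))).
    apply: (@has_mean_bounded _ _ _ _ _ (r n)^-1); first exact: measurable_funM.
    move=> w; rewrite (ger0_norm (mulr_ge0 (V_ge0 k w) (expR_ge0 _))).
    apply: (le_trans (bound w)); rewrite -[leRHS]mulr1 ler_pM2l ?invr_gt0// gerBl expR_ge0.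
  rewrite EFin_mean// lee_fin; apply: (le_trans (le_mean h3 h2 bound)).
  rewrite meanZ ?meanB//; last exact: has_meanB.
  rewrite mean_cst V_laplace ?(ltW (r0 n))//.
  rewrite ler_pdivrMl//.
  have bern p (x : R) : 0 <= x -> 1 - p%:R * x <= (1 + x) ^- p.
    move=> x0; elim: p => [|p IH]; first by rewrite mul0r subr0 expr0 invr1.
    rewrite exprS invfM.
    have x1 : 0 < 1 + x by lra.
    rewrite ler_pdivlMl//; apply: le_trans IH; rewrite -natr1.
    have : 0 <= p%:R :> R by []. nra.
  have := bern m.+1 (r n) (ltW (r0 n)); rewrite mulrC; lra.
- move=> w; rewrite -[X in _ --> X]mulr1 -expR0 -oppr0 -(mul0r (V k w)).
  apply: cvgM; first exact: cvg_cst.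
  apply: (@cvg_comp _ _ _ (fun n => - (r n * V k w)) expR); last exact: continuous_expR.
  by apply: cvgN; apply: cvgMl; exact: cvg_harmonic.
Qed.

Let dominating_partial n w : R := series (fun k => `|b k| * V k w) n.

Let good_set : exists G : set T,
  [/\ measurable G, Q (~` G) = 0%E & forall w, G w -> cvgn (dominating_partial ^~ w)].
Proof.
have hn n : has_mean Q (dominating_partial n).
  by apply: has_mean_sum => k; apply: has_meanZ; have [] := V_mean k.
apply: (@ae_monotone_cvg _ _ _ _ _ (m.+1%:R * limn (series (fun k => `|b k|)))).
- move=> n; apply: measurable_sum => k; apply: measurable_funM => //; exact: measurable_cst.
- by move=> n w; apply: sumr_ge0 => k _; rewrite mulr_ge0.
- move=> w; apply/nondecreasing_seqP => n; rewrite /dominating_partial /series/= big_nat_recr//= lerDl.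
  by rewrite mulr_ge0.
- move=> n.
  rewrite EFin_mean// lee_fin /dominating_partial mean_sum; last by move=> k; apply: has_meanZ; have [] := V_mean k.
  apply: (@le_trans _ _ (m.+1%:R * series (fun k => `|b k|) n)).
    rewrite /series/= mulr_sumr; apply: ler_sum => k _; rewrite meanZ; last by have [] := V_mean k.
    by rewrite mulrC ler_wpM2r//; have [] := V_mean k.
  rewrite ler_wpM2l//; apply: nondecreasing_cvgn_le => //.
  by apply/nondecreasing_seqP => p; rewrite /series/= big_nat_recr//= lerDl.
Qed.

(** [A] and [B] collect the positive and the negative coefficients. They are
    defined to be 0 outside the event where the dominating series converges, so
    that the truncation bound holds everywhere. *)
Lemma gamma_series_limit : exists A B : T -> R,
  [/\ measurable_fun setT A /\ measurable_fun setT B,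
      (forall w, 0 <= A w) /\ (forall w, 0 <= B w),
      has_mean Q (fun w => A w + B w),
      forall (i j : R) (K : nat), 0 <= i -> 0 <= j ->
        `|mean Q (fun w => expR (- (i * A w + j * B w)))
          - \prod_(k < K) (1 + (i * pos_part (b k) + j * neg_part (b k))) ^- m.+1|
        <= (i + j) * (m.+1%:R * tail_sum b (fun=> 1) K) &
      exists G : set T, [/\ measurable G, Q (~` G) = 0%E &
        forall w, G w -> series (fun k => 2^-1 * b k * Y k w) @ \oo --> A w - B w]].
Proof.
have [G [mG G0 Gcvg]] := good_set.
pose V' k w : R := V k w * \1_G w.
have V'_ge0 k w : 0 <= V' k w by rewrite mulr_ge0.
have mV' k : measurable_fun setT (V' k).
  by apply: measurable_funM => //; exact: measurable_indic.
have V'G k w : G w -> V' k w = V k w by move=> Gw; rewrite /V' indicE mem_set// mulr1.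
have V'le k w : V' k w <= V k w.
  by rewrite /V' indicE -[leRHS]mulr1 ler_wpM2l// lern1 leq_b1.
have bV'_cvg w : cvgn (series (fun k => `|b k| * V' k w)).
  have [Gw|nGw] := pselect (G w).
    rewrite (_ : (fun k => _) = fun k => `|b k| * V k w); first exact: Gcvg.
    by apply/funext => k; rewrite V'G.
  rewrite (_ : series _ = cst 0); first exact: is_cvg_cst.
  apply/funext => n; rewrite /series/= big1// => k _.
  by rewrite /V' indicE memNset// mulr0n !mulr0.
have msum (c : nat -> R) n : measurable_fun setT (fun w => series (fun k => c k * V' k w) n).
  by apply: measurable_sum => k; apply: measurable_funM => //; exact: measurable_cst.
pose A w := pos_sum b (V' ^~ w); pose B w := neg_sum b (V' ^~ w).
have mA : measurable_fun setT A.
  apply: (@measurable_fun_cvg _ _ _ _ (fun n w => series (fun k => pos_part (b k) * V' k w) n)).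
    by move=> n; exact: msum.
  by move=> w _; apply: cvg_pos_sum.
have mB : measurable_fun setT B.
  apply: (@measurable_fun_cvg _ _ _ _ (fun n w => series (fun k => neg_part (b k) * V' k w) n)).
    by move=> n; exact: msum.
  by move=> w _; apply: cvg_neg_sum.
have A0 w : 0 <= A w by apply: pos_sum_ge0.
have B0 w : 0 <= B w by apply: neg_sum_ge0.
have tail K : has_mean Q (fun w => tail_sum b (V' ^~ w) K) /\
    mean Q (fun w => tail_sum b (V' ^~ w) K) <= m.+1%:R * tail_sum b (fun=> 1) K.
  pose c k : R := if (k < K)%N then 0 else `|b k|.
  have c0 k : 0 <= c k by rewrite /c; case: ifP.
  have cE (v : nat -> R) : (fun k => if (k < K)%N then 0 else `|b k| * v k) = fun k => c k * v k.
    by apply/funext => k; rewrite /c; case: ifP; rewrite ?mul0r.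
  have hV' k : has_mean Q (V' k).
    have [hV _] := V_mean k.
    apply: (@le_integrable _ _ _ Q setT measurableT _ (EFin \o V k)) => //.
      exact/measurable_EFinP.
    by move=> w _; rewrite /= lee_fin !ger0_norm.
  have V'mean k : mean Q (V' k) <= m.+1%:R.
    by have [hV] := V_mean k; apply: le_trans; apply: le_mean.
  have c_cvg : series (fun k => c k * 1) @ \oo --> tail_sum b (fun=> 1) K.
    rewrite -cE; apply: cvg_tail_sum => //.
    by rewrite (_ : (fun k => _) = fun k => `|b k|)//; apply/funext => k; rewrite mulr1.
  apply: (@mean_monotone_limit _ _ _ _ (fun n w => series (fun k => c k * V' k w) n)).
  - by move=> n; exact: msum.
  - by move=> n w; apply: sumr_ge0 => k _; rewrite mulr_ge0.
  - move=> w; apply/nondecreasing_seqP => n; rewrite /series/= big_nat_recr//= lerDl.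
    by rewrite mulr_ge0.
  - move=> n; rewrite EFin_mean; last by apply: has_mean_sum => k; exact: has_meanZ.
    rewrite lee_fin mean_sum; last by move=> k; exact: has_meanZ.
    apply: (@le_trans _ _ (m.+1%:R * series (fun k => c k * 1) n)).
      rewrite /series/= mulr_sumr; apply: ler_sum => k _; rewrite meanZ//.
      by rewrite mulr1 mulrC ler_wpM2r.
    rewrite ler_wpM2l// -(cvg_lim (@Rhausdorff R) c_cvg).
    apply: nondecreasing_cvgn_le; last by apply/cvg_ex; eexists; exact: c_cvg.
    by apply/nondecreasing_seqP => p; rewrite /series/= big_nat_recr//= lerDl mulr1.
  - by move=> w; rewrite -cE; apply: cvg_tail_sum.
exists A, B; split => //.
- have [h0 _] := tail 0.
  rewrite (_ : (fun w => _) = fun w => tail_sum b (V' ^~ w) 0)//.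
  by apply/funext => w; apply: pos_neg_sumD.
- move=> i j K i0 j0.
  pose u k := i * pos_part (b k) + j * neg_part (b k).
  have u0 k : 0 <= u k by rewrite addr_ge0// mulr_ge0 ?pos_part_ge0 ?neg_part_ge0.
  have le1 x : 0 <= x -> `|expR (- x)| <= 1.
    by move=> x0; rewrite ger0_norm ?expR_ge0// -expR0 ler_expR oppr_le0.
  have mpart (v : nat -> T -> R) : (forall k, measurable_fun setT (v k)) ->
      measurable_fun setT (fun w => expR (- \sum_(k < K) u k * v k w)).
    move=> mv; apply: measurableT_comp => //; apply: measurableT_comp => //.
    by apply: measurable_sum => k; apply: measurable_funM => //; exact: measurable_cst.
  have hpart : has_mean Q (fun w => expR (- \sum_(k < K) u k * V' k w)).
    apply: (@has_mean_bounded _ _ _ _ _ 1) => [|w]; first exact: mpart.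
    by apply: le1; apply: sumr_ge0 => k _; rewrite mulr_ge0.
  have hfull : has_mean Q (fun w => expR (- (i * A w + j * B w))).
    apply: (@has_mean_bounded _ _ _ _ _ 1) => [|w].
      apply: measurableT_comp => //; apply: measurableT_comp => //.
      by apply: measurable_funD; apply: measurable_funM => //; exact: measurable_cst.
    by apply: le1; rewrite addr_ge0// mulr_ge0.
  have -> : \prod_(k < K) (1 + u k) ^- m.+1 = mean Q (fun w => expR (- \sum_(k < K) u k * V' k w)).
    transitivity (mean Q (fun w => expR (- \sum_(k < K) u k * V k w))); last first.
      rewrite /mean /Rintegral; congr fine; apply: (mean_ae_eq (G := G)) => //.
      - exact: mpart.
      - exact: mpart.
      - by move=> w Gw; congr (expR (- _)); apply: eq_bigr => k _; rewrite V'G.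
    pose h k (x : R) := expR (- (u k * (Num.max x 0 / 2))).
    have := @mean_indep_prod _ _ _ _ Y Y_indep K h.
    have hE : (fun w => \prod_(k < K) h k (Y k w)) = fun w => expR (- \sum_(k < K) u k * V k w).
      by apply/funext => w; rewrite -sumrN expR_sum.
    rewrite hE => ->.
    + by apply: eq_bigr => k _; rewrite -(V_laplace k (u0 k)).
    + move=> k; apply: measurableT_comp => //; apply: measurableT_comp => //.
      apply: measurable_funM; first exact: measurable_cst.
      by apply: measurable_funM => //; apply: measurable_maxr => //; exact: measurable_cst.
    + move=> k x; rewrite expR_ge0/= -expR0 ler_expR oppr_le0 mulr_ge0// divr_ge0//.
      by rewrite le_max lexx orbT.
  have [htail tail_le] := tail K.
  rewrite -meanB//; apply: (@le_trans _ _ (mean Q (fun w => (i + j) * tail_sum b (V' ^~ w) K))); last first.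
    by rewrite meanZ// ler_wpM2l// addr_ge0.
  apply: norm_le_mean; [exact: has_meanB|exact: has_meanZ|].
  by move=> w; apply: laplace_truncation.
- pose Ypos := \bigcap_k (Y k @^-1` `]0%R, +oo[).
  have mYpos k : measurable (Y k @^-1` `]0%R, +oo[).
    by have := mY k measurableT (measurable_itv `]0%R, +oo[); rewrite setTI.
  have negY : Q.-negligible (~` Ypos).
    rewrite setC_bigcap; apply: negligible_bigcup => k.
    have := chi2_gt0 (Y_law k); apply: negligibleS => w /= h hw; apply: h.
    by rewrite /= in_itv/= andbT.
  exists (G `&` Ypos); split.
  + by apply: measurableI => //; exact: bigcap_measurableType.
  + apply: measure_negligible.
      by apply: measurableC; apply: measurableI => //; exact: bigcap_measurableType.
    rewrite setCI; apply: negligibleU => //; apply/negligibleP => //.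
    exact: measurableC.
  + move=> w [Gw Yw].
    rewrite (_ : (fun k => _) = fun k => b k * V' k w); first exact: cvg_signed_sum.
    apply/funext => k; rewrite V'G// /V max_l; first by ring.
    by have := Yw k I; rewrite /= in_itv/= andbT => /ltW.
Qed.

End GammaSeries.

(** * Tails of the coefficients and the continuity theorem *)

Section PowerSums.
Context {R : realType} (delta : R).
Hypothesis delta_gt0 : 0 < delta.

(** Comparison of the sum of [p ^ (- (1 + delta))] with its integral. *)
Lemma powR_telescope (p : nat) : (0 < p)%N ->
  p.+1%:R `^ (- (1 + delta)) <=
  delta^-1 * (p%:R `^ (- delta) - p.+1%:R `^ (- delta)) :> R.
Proof.
move=> p0; set x : R := p%:R; set y : R := p.+1%:R.
have x0 : 0 < x by rewrite ltr0n.
have y0 : 0 < y by rewrite ltr0n.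
have xy : x = y - 1 by rewrite /y -natr1 addrK.
clearbody x y.
set a := y `^ (- delta).
have a0 : 0 < a by exact: powR_gt0.
have -> : y `^ (- (1 + delta)) = y^-1 * a.
  rewrite opprD powRD; last by rewrite (gt_eqF y0) implybT.
  by rewrite powR_inv1// ltW.
set r := (x / y) `^ (- delta).
have -> : x `^ (- delta) = r * a.
  by rewrite /r /a -powRM ?divfK ?gt_eqF// ?divr_ge0// ltW.
have lnxy : ln (x / y) <= - y^-1.
  have -> : x / y = 1 + - y^-1 by rewrite xy mulrBl divff ?gt_eqF// mul1r.
  apply: le_ln1Dx; rewrite ltrN2 invf_lt1//; lra.
have rE : 1 + delta / y <= r.
  rewrite /r /powR mulf_eq0 invr_eq0 (gt_eqF x0) (gt_eqF y0)/=.
  apply: le_trans (expR_ge1Dx _); rewrite lerD2l.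
  have := ler_wpM2l (ltW delta_gt0) lnxy; by rewrite mulrN mulNr lerNr.
rewrite ler_pdivlMl//.
have : delta / y * a <= (r - 1) * a by rewrite ler_pM2r//; lra.
by rewrite mulrA; lra.
Qed.

Lemma sum_powR_le (q : nat) :
  \sum_(j < q) j.+1%:R `^ (- (1 + delta)) <= 1 + delta^-1 :> R.
Proof.
have d0 : 0 <= delta^-1 by rewrite invr_ge0 ltW.
case: q => [|q]; first by rewrite big_ord0 addr_ge0.
apply: (@le_trans _ _ (1 + delta^-1 * (1 - q.+1%:R `^ (- delta)))); last first.
  rewrite lerD2l -[leRHS]mulr1 ler_wpM2l// lerBlDr lerDl powR_ge0.
elim: q => [|q IH].
  by rewrite big_ord1 !powR1 subrr mulr0 addr0.
rewrite big_ord_recr/=; have := @powR_telescope q.+1 isT; lra.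
Qed.

Lemma sum_multiples (F : nat -> R) (N q : nat) : (0 < N)%N ->
  \sum_(0 <= k < q * N | (N %| k.+1)%N) F k.+1 = \sum_(j < q) F (j.+1 * N)%N.
Proof.
case: N => // N _; elim: q => [|q IH]; first by rewrite mul0n big_geq// big_ord0.
rewrite big_ord_recr/= -IH (big_cat_nat (n := (q * N.+1)%N))//=; last first.
  by rewrite leq_mul2r leqnSn orbT.
congr (_ + _); rewrite big_mkcond/=.
have -> : (q.+1 * N.+1 = (q * N.+1 + N).+1)%N by rewrite mulSn addnC addnS.
rewrite big_nat_recr ?leq_addr//= -addnS -mulSnr dvdn_mull//.
rewrite big_nat big1 ?add0r// => k /andP[qk kq].
rewrite ifF//; apply/negbTE; rewrite /dvdn.
have -> : k.+1 = (q * N.+1 + (k.+1 - q * N.+1))%N by rewrite subnKC// ltnW.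
by rewrite modnMDl modn_small ?subn_eq0 -?ltnNge// ltn_subLR ?addnS ?ltnS// ltnW.
Qed.

(** The coefficients at the multiples of [N] are [N ^ (- (1 + delta))] times a
    convergent sum. *)
Lemma sum_multiples_decay (beta : nat -> R) (C : R) (k0 N n : nat) :
  0 <= C -> (forall k, (k0 <= k)%N -> `|beta k| <= C * k%:R `^ (- (1 + delta))) ->
  (0 < N)%N -> (k0 <= N)%N ->
  \sum_(0 <= k < n | (N %| k.+1)%N) `|beta k.+1| <=
  C * (1 + delta^-1) * N%:R `^ (- (1 + delta)).
Proof.
move=> C0 bC N0 k0N.
apply: (@le_trans _ _ (\sum_(0 <= k < n * N | (N %| k.+1)%N) `|beta k.+1|)).
  rewrite [leRHS](big_cat_nat (n := n)) ?leq_pmulr//= lerDl.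
  by apply: sumr_ge0.
rewrite (sum_multiples (fun k => `|beta k|))//.
apply: (@le_trans _ _ (\sum_(j < n) C * N%:R `^ (- (1 + delta)) * j.+1%:R `^ (- (1 + delta)))).
  apply: ler_sum => j _; apply: (le_trans (bC _ _)).
    by apply: leq_trans k0N _; rewrite leq_pmull.
  by rewrite natrM powRM// -mulrA [_ * j.+1%:R `^ _]mulrC.
rewrite -mulr_sumr mulrAC ler_wpM2r ?powR_ge0// ler_wpM2l//.
exact: sum_powR_le.
Qed.

(** Here the decay is used at full strength: the factor [N] is the size of the
    statistics at frequencies divisible by [N]. *)
Lemma mul_powR_small (e : R) : 0 < e ->
  exists N0, forall N, (N0 <= N)%N -> N%:R * N%:R `^ (- (1 + delta)) <= e.
Proof.
move=> e0; pose x : R := e `^ (- delta^-1).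
exists (Num.truncn x).+1 => N xN.
have x0 : 0 < x by exact: powR_gt0.
have xN' : x <= N%:R.
  have /andP[_ /ltW h] := truncn_itv (ltW x0).
  by apply: (le_trans h); rewrite ler_nat.
have N0 : 0 < N%:R :> R by apply: lt_le_trans xN'.
have -> : N%:R * N%:R `^ (- (1 + delta)) = N%:R `^ (- delta) :> R.
  rewrite opprD powRD; last by rewrite (gt_eqF N0) implybT.
  by rewrite powR_inv1 ?ltW// mulrA divff ?mul1r// gt_eqF.
have -> : e = x `^ (- delta).
  by rewrite /x -powRrM mulrNN mulVf ?gt_eqF// powRr1// ltW.
rewrite !powRN lef_pV2 ?posrE ?powR_gt0//.
by apply: ge0_ler_powR => //; rewrite ?nnegrE; exact: ltW.
Qed.

End PowerSums.

Lemma tail_sum_small (R : realType) (b : nat -> R) (e : R) :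
  cvgn (series (fun k => `|b k|)) -> 0 < e ->
  exists K, tail_sum b (fun=> 1) K <= e.
Proof.
move=> cb e0.
have /cvgrPdist_le/(_ _ e0)[K _ hK] := cb.
exists K; have cb' : cvgn (series (fun k => `|b k| * 1)).
  by rewrite (_ : (fun k => _) = fun k => `|b k|)//; apply/funext => k; rewrite mulr1.
have ct := @cvg_tail_sum R b (fun=> 1) (fun=> ler01) cb' K.
apply: (cvgr_to_le ct).
exists K => // n /= Kn.
have -> : series (fun k => if (k < K)%N then 0 else `|b k| * 1) n =
    series (fun k => `|b k|) n - series (fun k => `|b k|) K.
  rewrite sub_series_geq// /series/= (big_cat_nat (n := K))//= big_nat big1 ?add0r; last first.
    by move=> k /andP[_ ->].
  rewrite big_nat [RHS]big_nat; apply: eq_bigr => k /andP[Kk _].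
  by rewrite ltnNge Kk/= mulr1.
have := hK K (leqnn K); apply: le_trans; apply: le_trans (ler_norm _).
rewrite lerD2r; apply: nondecreasing_cvgn_le => //.
by apply/nondecreasing_seqP => p; rewrite /series/= big_nat_recr//= lerDl.
Qed.

Lemma cvg_big_sum (R : realType) (I : Type) (r : seq I) (u : I -> nat -> R) (x : I -> R) :
  (forall i, u i @ \oo --> x i) ->
  (fun m => \sum_(i <- r) u i m) @ \oo --> \sum_(i <- r) x i.
Proof.
move=> ux; elim: r => [|i r IH].
  rewrite big_nil (_ : (fun m => _) = cst 0); first exact: cvg_cst.
  by apply/funext => m; rewrite big_nil.
rewrite big_cons (_ : (fun m => _) = fun m => u i m + \sum_(j <- r) u j m).
  by apply: cvgD.
by apply/funext => m; rewrite big_cons.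
Qed.

(** The continuity theorem for the difference of two nonnegative variables. The
    means are abstracted to numbers [E m] and [E'], so that it applies to finite
    averages on one side and to integrals on the other; [Cb] bounds the means
    of the sum of the two variables. *)
Lemma cvg_of_laplace (R : realType) (f : R -> R) (F Cb : R) (E : nat -> R) (E' : R)
    (psi : nat -> nat -> nat -> R) (psi' : nat -> nat -> R) :
  continuous f -> (forall x, `|f x| <= F) -> 0 <= Cb ->
  (forall s e M, 0 < e -> 0 < M ->
     (forall a b, 0 <= a -> 0 <= b -> `|f (a - b) - exp_sum s a b| <= e + 2 * F * ((a + b) / M)) ->
     (\forall m \near \oo, `|E m - \sum_(t <- s) t.1 * psi m t.2.1 t.2.2| <= e + 2 * F * (Cb / M)) /\
     `|E' - \sum_(t <- s) t.1 * psi' t.2.1 t.2.2| <= e + 2 * F * (Cb / M)) ->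
  (forall i j, psi ^~ i ^~ j @ \oo --> psi' i j) ->
  E @ \oo --> E'.
Proof.
move=> cf fF Cb0 approx psi_cvg; apply/cvgrPdist_le => e e0.
have F0 : 0 <= F := le_trans (normr_ge0 (f 0)) (fF 0).
pose e1 := e / 6; have e10 : 0 < e1 by rewrite divr_gt0.
pose M := (2 * F * Cb + 1) / e1.
have M0 : 0 < M by rewrite divr_gt0// ltr_wpDl// !mulr_ge0.
have Me : 2 * F * (Cb / M) <= e1.
  rewrite mulrA ler_pdivrMr// /M [leRHS]mulrC divfK ?gt_eqF//; lra.
have [s sP] := exp_sum_approx cf fF M0 e10.
have [h1 h2] := approx s e1 M e10 M0 sP.
have cs : (fun m => \sum_(t <- s) t.1 * psi m t.2.1 t.2.2) @ \oo -->
    \sum_(t <- s) t.1 * psi' t.2.1 t.2.2.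
  by apply: cvg_big_sum => t; apply: cvgMr; exact: psi_cvg.
have e20 : 0 < 2 * e1 by rewrite mulr_gt0.
have /cvgrPdist_le/(_ _ e20) h3 := cs.
near=> m.
have a1 : `|E m - \sum_(t <- s) t.1 * psi m t.2.1 t.2.2| <= e1 + 2 * F * (Cb / M) by near: m.
have a3 : `|\sum_(t <- s) t.1 * psi' t.2.1 t.2.2 - \sum_(t <- s) t.1 * psi m t.2.1 t.2.2| <= 2 * e1.
  by near: m.
move: a1 a3 h2; set X := \sum_(t <- s) _; set Z := \sum_(t <- s) _ => a1 a3 h2.
have -> : E' - E m = (E' - Z) + (Z - X) - (E m - X) by ring.
apply: (le_trans (ler_normB _ _)).
have := ler_normD (E' - Z) (Z - X).
have : e = 6 * e1 by rewrite /e1; field.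
by move: (2 * F * (Cb / M)) Me a1 a3 h2 => q; lra.
Unshelve. all: by end_near. Qed.

(** * Frequency decomposition of the rank statistic *)

Section RankStatistic.
Context {R : realType} {c : nat} (n : 'I_c -> nat).
Notation obs := {l : 'I_c & 'I_(n l)}.
Notation N := (pooled_size n).

Definition sample_of (p : obs) : 'I_c := tag p.

Definition rank_stat (phi : R -> R) (r : obs -> nat) : R :=
  \sum_(l < c) (n l)%:R^-1 * \sum_(i < n l) \sum_(j < n l)
    phi (cos (2 * pi * (r (Tagged _ i))%:R / N%:R
              - 2 * pi * (r (Tagged _ j))%:R / N%:R)).

Lemma uniform_scores_stat_rank (phi : R -> R) (theta : forall l, 'I_(n l) -> R) :
  uniform_scores_stat phi theta =
  rank_stat phi (rank_of (fun p : obs => theta (tag p) (tagged p))).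
Proof.
have rankE l (i : 'I_(n l)) : pooled_rank theta i =
    rank_of (fun p : obs => theta (tag p) (tagged p)) (Tagged _ i).
  by rewrite /pooled_rank /rank_of sig_big_dep.
rewrite /uniform_scores_stat /rank_stat; apply: eq_bigr => l _.
congr (_ * _); apply: eq_bigr => i _; apply: eq_bigr => j _.
by rewrite /uniform_score !rankE.
Qed.

Lemma card_obs : #|{: obs}| = N.
Proof.
rewrite -sum1_card /pooled_size.
have := @sig_big_dep nat 0%N addn 'I_c (fun l => 'I_(n l)) xpredT
  (fun l => xpredT) (fun l (i : 'I_(n l)) => 1%N).
rewrite /= => <-; by apply: eq_bigr => l _; rewrite sum1_card card_ord.
Qed.

Lemma sum_sample_of (G : obs -> R) l :
  \sum_p labeled sample_of l p * G p = \sum_(i < n l) G (Tagged _ i).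
Proof.
have := @sig_big_dep R 0 +%R 'I_c (fun l => 'I_(n l)) xpredT (fun=> xpredT)
  (fun l' (i : 'I_(n l')) => labeled sample_of l (Tagged _ i) * G (Tagged _ i)).
rewrite /= (eq_bigr (fun p : obs => labeled sample_of l p * G p)); last by move=> [].
move=> <-; rewrite (bigD1 l)//= [X in _ + X]big1 ?addr0.
  by apply: eq_bigr => i _; rewrite /labeled /sample_of/= eqxx mul1r.
move=> l' l'l; rewrite big1// => i _.
by rewrite /labeled /sample_of/= (negbTE l'l) mul0r.
Qed.

Lemma label_card_obs l : label_card sample_of l = (n l)%:R :> R.
Proof.
rewrite /label_card -(@sum_label R); under eq_bigr do rewrite -[labeled _ _ _]mulr1.
by rewrite (sum_sample_of (fun=> 1)) sumr_const card_ord.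
Qed.

(** The addition formula for the cosine. *)
Lemma freq_statE k (s : {perm obs}) :
  freq_stat sample_of k s = \sum_(l < c) (n l)%:R^-1 * \sum_(i < n l) \sum_(j < n l)
   cos (k.+1%:R * (2 * pi * (enum_rank (s (Tagged _ i))).+1%:R / N%:R
              - 2 * pi * (enum_rank (s (Tagged _ j))).+1%:R / N%:R)) :> R.
Proof.
rewrite /freq_stat big_bool/= /quad_stat -big_split/=; apply: eq_bigr => l _.
rewrite label_card_obs -mulrDr; congr (_ * _).
rewrite /label_sum !sum_sample_of !expr2 !big_distrlr/= -big_split/=.
apply: eq_bigr => i _; rewrite -big_split/=; apply: eq_bigr => j _.
have cN : #|{: obs}|%:R = N%:R :> R by rewrite card_obs.
rewrite /trig_score /uniform_angle addrC -cosB cN; congr cos.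
by rewrite -!natr1; ring.
Qed.

Lemma freq_stat_le k (s : {perm obs}) : (forall l, (0 < n l)%N) ->
  freq_stat sample_of k s <= 2 * N%:R :> R.
Proof.
move=> n0; rewrite /freq_stat big_bool/=.
have le_N b : quad_stat sample_of (trig_score k b) s <= N%:R :> R.
  rewrite /quad_stat /pooled_size natr_sum; apply: ler_sum => l _.
  rewrite label_card_obs ler_pdivrMl ?ltr0n//.
  have h : `|label_sum sample_of l (@trig_score R _ k b) s| <= (n l)%:R.
    rewrite /label_sum sum_sample_of (le_trans (ler_norm_sum _ _ _))//.
    rewrite -[leRHS]mulr1 -[X in X%:R]card_ord mulr_natl -sumr_const.
    by apply: ler_sum => i _; exact: trig_score_le1.
  rewrite -real_normK ?num_real// -expr2 ler_pXn2r ?nnegrE//.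
by have := le_N true; have := le_N false; lra.
Qed.

(** Only the frequencies that are multiples of the pooled size escape the
    uniform bound on the means. There the trivial bound is of order [N], and
    the decay of the coefficients compensates for it. *)
Lemma mean_tail_le (beta : nat -> R) (kappa delta C : R) (k0 K : nat) :
  (forall l, (0 < n l)%N) -> (0 < N)%N -> (k0 <= N)%N -> 0 < delta -> 0 <= C -> 0 <= kappa ->
  (forall l, (n l)%:R^-1 <= kappa / N%:R) ->
  (forall k, (k0 <= k)%N -> `|beta k| <= C * k%:R `^ (- (1 + delta))) ->
  cvgn (series (fun k => `|beta k.+1|)) ->
  (forall s : {perm obs}, cvgn (series (fun k => `|beta k.+1| * freq_stat sample_of k s))) /\
  perm_mean (fun s : {perm obs} =>
     tail_sum (fun k => beta k.+1) (fun k => freq_stat sample_of k s) K) <=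
  2 * c%:R * kappa * tail_sum (fun k => beta k.+1) (fun=> 1) K +
  2 * (C * (1 + delta^-1)) * (N%:R * N%:R `^ (- (1 + delta))).
Proof.
move=> n0 N0 k0N d0 C0 kap0 nk bC b_cvg.
have bv (s : {perm obs}) : cvgn (series (fun k => `|beta k.+1| * freq_stat sample_of k s)).
  have cN : cvgn (series (fun k => (2 * N%:R) * `|beta k.+1|)).
    rewrite (_ : series _ = fun p => 2 * N%:R * series (fun k => `|beta k.+1|) p).
      by apply: is_cvgMr.
    by apply/funext => p; rewrite /series/= mulr_sumr.
  apply: (series_le_cvg _ _ _ cN) => k; rewrite ?mulr_ge0 ?freq_stat_ge0//.
  by rewrite mulrC ler_wpM2r// freq_stat_le.
split=> //.
have cvg_mean : (fun p => perm_mean (fun s : {perm obs} =>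
     series (fun k => if (k < K)%N then 0 else `|beta k.+1| * freq_stat sample_of k s) p)) @ \oo -->
   perm_mean (fun s : {perm obs} =>
     tail_sum (fun k => beta k.+1) (fun k => freq_stat sample_of k s) K).
  rewrite /perm_mean; apply: cvgMr; apply: cvg_big_sum => s.
  by apply: cvg_tail_sum => [k|]; [exact: freq_stat_ge0|exact: bv].
have b_cvg1 : cvgn (series (fun k => `|beta k.+1| * 1)).
  by rewrite (_ : (fun k => _) = fun k => `|beta k.+1|)//; apply/funext => k; rewrite mulr1.
have ct := @cvg_tail_sum R (fun k => beta k.+1) (fun=> 1) (fun=> ler01) b_cvg1 K.
(* it suffices to bound the means of the partial sums, term by term *)
apply: (cvgr_to_le cvg_mean); apply: nearW => p /=.
rewrite /series/= perm_mean_sum.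
have I0 : (0 < #|{: obs}|)%N by rewrite card_obs.
have qk l : (label_card sample_of l)^-1 <= kappa / #|{: obs}|%:R by rewrite label_card_obs card_obs.
have k20 : 0 <= 2 * c%:R * kappa by rewrite !mulr_ge0.
have term k : perm_mean (fun s : {perm obs} => if (k < K)%N then 0 else `|beta k.+1| * freq_stat sample_of k s)
   <= 2 * c%:R * kappa * (if (k < K)%N then 0 else `|beta k.+1| * 1)
      + (if (N %| k.+1)%N then 2 * N%:R * `|beta k.+1| else 0).
  case: ifP => _; first by rewrite mulr0 add0r perm_mean_cst; case: ifP => // _; rewrite !mulr_ge0.
  rewrite perm_meanZ mulr1; case: ifPn => Nk.
    apply: (@le_trans _ _ (`|beta k.+1| * (2 * N%:R))).
      rewrite ler_wpM2l// -[leRHS](@perm_mean_cst R {: obs}); apply: le_perm_mean => s.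
      exact: freq_stat_le.
    by rewrite mulrC lerDr mulr_ge0.
  rewrite addr0 mulrC ler_wpM2r//; apply: mean_freq_stat_le => //.
  by rewrite card_obs.
apply: (@le_trans _ _ (\sum_(0 <= k < p) (2 * c%:R * kappa * (if (k < K)%N then 0 else `|beta k.+1| * 1)
      + (if (N %| k.+1)%N then 2 * N%:R * `|beta k.+1| else 0)))).
  by apply: ler_sum => k _; exact: term.
rewrite big_split/= -mulr_sumr -big_mkcond/= -mulr_sumr; apply: lerD.
  rewrite ler_wpM2l// -(cvg_lim (@Rhausdorff R) ct).
  apply: (@nondecreasing_cvgn_le _ (series (fun k => if (k < K)%N then 0 else `|beta k.+1| * 1))).
    apply/nondecreasing_seqP => q; rewrite /series/= big_nat_recr//= lerDl.
    by case: ifP => // _; rewrite mulr_ge0.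
  by apply/cvg_ex; eexists; exact: ct.
have := sum_multiples_decay d0 p C0 bC N0 k0N.
set X := \sum_(_ <= _ < _ | _) _; set Z := _ `^ _ => XZ.
rewrite [leRHS](_ : _ = 2 * N%:R * (C * (1 + delta^-1) * Z)); last by ring.
by rewrite ler_wpM2l// mulr_ge0.
Qed.

Lemma cvg_rank_stat (phi : R -> R) (b : nat -> R) (s : {perm obs}) :
  (forall x : R, series (fun k => b k * cos (k.+1%:R * x)) @ \oo --> phi (cos x)) ->
  series (fun k => b k * freq_stat sample_of k s) @ \oo -->
    rank_stat phi (fun p => (enum_rank (s p)).+1).
Proof.
move=> phiE; rewrite /rank_stat.
pose x l (i j : 'I_(n l)) : R := 2 * pi * (enum_rank (s (Tagged _ i))).+1%:R / N%:R
              - 2 * pi * (enum_rank (s (Tagged _ j))).+1%:R / N%:R.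
rewrite (_ : series _ = fun p => \sum_(l < c) (n l)%:R^-1 * \sum_(i < n l) \sum_(j < n l)
   series (fun k => b k * cos (k.+1%:R * x l i j)) p); last first.
  apply/funext => p; rewrite /series/=.
  under eq_bigr do rewrite freq_statE mulr_sumr.
  rewrite exchange_big/=; apply: eq_bigr => l _.
  under eq_bigr do rewrite mulrCA mulr_sumr.
  rewrite -mulr_sumr exchange_big/=; congr (_ * _); apply: eq_bigr => i _.
  under eq_bigr do rewrite mulr_sumr.
  by rewrite exchange_big.
apply: cvg_big_sum => l; apply: cvgMr; apply: cvg_big_sum => i; apply: cvg_big_sum => j.
exact: phiE.
Qed.

End RankStatistic.

(** * Passage to the limit *)

(** The approximation error is affine in [A + B], so that after averaging it is
    controlled by the mean of [A + B]. *)
Lemma perm_mean_exp_sum (R : realType) (I : finType) (f : R -> R) (F Cb e M : R)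
    (s : seq (R * (nat * nat))) (A B : {perm I} -> R) :
  (forall p, 0 <= A p) -> (forall p, 0 <= B p) ->
  0 <= F -> 0 < M -> perm_mean (fun p => A p + B p) <= Cb ->
  (forall a b, 0 <= a -> 0 <= b -> `|f (a - b) - exp_sum s a b| <= e + 2 * F * ((a + b) / M)) ->
  `|perm_mean (fun p => f (A p - B p))
    - \sum_(t <- s) t.1 * perm_mean (fun p => expR (- (t.2.1%:R * A p + t.2.2%:R * B p)))|
  <= e + 2 * F * (Cb / M).
Proof.
move=> A0 B0 F0 M0 ABC approx.
under eq_bigr do rewrite -perm_meanZ.
rewrite -perm_mean_sum -perm_meanB; apply: (le_trans (ler_norm_perm_mean _)).
apply: (@le_trans _ _ (perm_mean (fun p : {perm I} => e + 2 * F / M * (A p + B p)))).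
  apply: le_perm_mean => p; apply: (le_trans (approx _ _ (A0 p) (B0 p))).
  by rewrite lerD2l mulrA [leRHS]mulrAC.
rewrite perm_meanD perm_mean_cst perm_meanZ lerD2l [leRHS]mulrA [leRHS]mulrAC.
by rewrite ler_wpM2l// mulr_ge0 ?invr_ge0 ?(ltW M0)// mulr_ge0.
Qed.

Lemma mean_exp_sum (R : realType) d (T : measurableType d) (Q : probability T R)
    (f : R -> R) (F e M : R) (s : seq (R * (nat * nat))) (A B : T -> R) :
  continuous f -> (forall x, `|f x| <= F) ->
  measurable_fun setT A -> measurable_fun setT B ->
  (forall w, 0 <= A w) -> (forall w, 0 <= B w) ->
  has_mean Q (fun w => A w + B w) -> 0 < M ->
  (forall a b, 0 <= a -> 0 <= b -> `|f (a - b) - exp_sum s a b| <= e + 2 * F * ((a + b) / M)) ->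
  `|mean Q (fun w => f (A w - B w))
    - \sum_(t <- s) t.1 * mean Q (fun w => expR (- (t.2.1%:R * A w + t.2.2%:R * B w)))|
  <= e + 2 * F * (mean Q (fun w => A w + B w) / M).
Proof.
move=> cf fF mA mB A0 B0 AB M0 approx.
have F0 : 0 <= F := le_trans (normr_ge0 (f 0)) (fF 0).
have mf : measurable_fun setT (f : R -> R) by exact: continuous_measurable_fun.
have hf : has_mean Q (fun w => f (A w - B w)).
  apply: (@has_mean_bounded _ _ _ _ _ F) => [|w]; last exact: fF.
  by apply: measurableT_comp => //; exact: measurable_funB.
have he (i j : R) : 0 <= i -> 0 <= j ->
    has_mean Q (fun w => expR (- (i * A w + j * B w))).
  move=> i0 j0; apply: (@has_mean_bounded _ _ _ _ _ 1) => [|w].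
    apply: measurableT_comp => //; apply: measurableT_comp => //.
    by apply: measurable_funD; apply: measurable_funM => //; exact: measurable_cst.
  by rewrite ger0_norm ?expR_ge0// -expR0 ler_expR oppr_le0 addr_ge0// mulr_ge0.
have hs : has_mean Q (fun w => exp_sum s (A w) (B w)).
  by apply: has_mean_sum => t; apply: has_meanZ; exact: he.
rewrite (_ : \sum_(t <- s) _ = mean Q (fun w => exp_sum s (A w) (B w))); last first.
  rewrite mean_sum; last by move=> t; apply: has_meanZ; exact: he.
  by apply: eq_bigr => t _; rewrite meanZ//; exact: he.
rewrite -meanB//; apply: (@le_trans _ _
    (mean Q (fun w => e + 2 * F / M * (A w + B w)))).
  apply: norm_le_mean.
  - exact: has_meanB.
  - by apply: has_meanD; [exact: has_mean_cst|exact: has_meanZ].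
  - move=> w; apply: (le_trans (approx _ _ (A0 w) (B0 w))).
    by rewrite lerD2l mulrA [leRHS]mulrAC.
rewrite meanD; [|exact: has_mean_cst|exact: has_meanZ].
by rewrite mean_cst meanZ// lerD2l [leRHS]mulrA [leRHS]mulrAC.
Qed.

Section RankLimit.
Context {R : realType} {c : nat}.
Variables (n : nat -> 'I_c.+2 -> nat) (beta : nat -> R) (delta C kappa : R) (k0 : nat).
Hypothesis n_gt0 : forall m l, (0 < n m l)%N.
Hypothesis N_infty : pooled_size (n m) @[m --> \oo] --> \oo.
Hypothesis kappa_ge1 : 1 <= kappa.
Hypothesis balanced : \forall m \near \oo,
  forall l, (n m l)%:R^-1 <= kappa / (pooled_size (n m))%:R.
Hypothesis delta_gt0 : 0 < delta.
Hypothesis C_ge0 : 0 <= C.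
Hypothesis beta_decay : forall k, (k0 <= k)%N -> `|beta k| <= C * k%:R `^ (- (1 + delta)).
Hypothesis beta_cvg : cvgn (series (fun k => `|beta k.+1|)).

Notation obs m := {l : 'I_c.+2 & 'I_(n m l)}.
Notation b := (fun k => beta k.+1).
Notation score m s := (fun k => freq_stat (R := R) (@sample_of _ (n m)) k s).

Let large_N M : \forall m \near \oo, (M <= pooled_size (n m))%N.
Proof. exact: N_infty _ (nbhs_infty_ge M). Qed.

(** Uniformly in the sample sizes, the tails of the random series are as small
    in mean as the tails of the coefficients. *)
Let tail_bound K e : 0 < e ->
  \forall m \near \oo,
  (forall s : {perm obs m}, cvgn (series (fun k => `|b k| * score m s k))) /\
  perm_mean (fun s : {perm obs m} => tail_sum b (score m s) K) <=
  2 * c.+2%:R * kappa * tail_sum b (fun=> 1) K + e.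
Proof.
move=> e0; have C1 : 0 < 2 * (C * (1 + delta^-1)) + 1.
  by rewrite ltr_wpDl// !mulr_ge0// addr_ge0// invr_ge0 ltW.
have [N0 hN0] := mul_powR_small delta_gt0 (divr_gt0 e0 C1).
near=> m.
have h1 : (N0 <= pooled_size (n m))%N by near: m; exact: large_N.
have h2 : (k0 <= pooled_size (n m))%N by near: m; exact: large_N.
have h3 : (0 < pooled_size (n m))%N by near: m; exact: large_N.
have h4 : forall l, (n m l)%:R^-1 <= kappa / (pooled_size (n m))%:R by near: m; exact: balanced.
have [? h] := mean_tail_le K (n_gt0 m) h3 h2 delta_gt0 C_ge0
  (le_trans ler01 kappa_ge1) h4 beta_decay beta_cvg.
split=> //; apply: (le_trans h); rewrite lerD2l.
have := hN0 _ h1; rewrite ler_pdivlMr// mulrC.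
have : 0 <= (pooled_size (n m))%:R * (pooled_size (n m))%:R `^ (- (1 + delta)) :> R.
  by rewrite mulr_ge0// powR_ge0.
by move: (_ * _ `^ _) (2 * _) => X q; lra.
Unshelve. all: by end_near. Qed.

(** Truncation at [K] costs a tail of the coefficients on either side, and the
    truncated transforms have the same limit. The limit [L] is only required to
    be approximated by the finite products, which avoids infinite products. *)
Lemma cvg_rank_laplace (i j : R) (L : R) : 0 <= i -> 0 <= j ->
  (forall K, `|L - \prod_(k < K) (1 + (i * pos_part (b k) + j * neg_part (b k))) ^- c.+1|
     <= (i + j) * (c.+1%:R * tail_sum b (fun=> 1) K)) ->
  (fun m => perm_mean (fun s : {perm obs m} =>
     expR (- (i * pos_sum b (score m s) + j * neg_sum b (score m s))))) @ \oo --> L.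
Proof.
move=> i0 j0 LK; apply/cvgrPdist_le => e e0.
have ij0 : 0 <= i + j by exact: addr_ge0.
pose D := (i + j) * (c.+1%:R + 2 * c.+2%:R * kappa + 1) + 1.
have kap0 : 0 <= kappa := le_trans ler01 kappa_ge1.
have D0 : 0 < D by rewrite ltr_wpDl// mulr_ge0// !addr_ge0// !mulr_ge0.
pose eta := e / (2 * D).
have eta0 : 0 < eta by rewrite divr_gt0// mulr_gt0.
have [K tK] := tail_sum_small beta_cvg eta0.
pose w k := i * pos_part (b k) + j * neg_part (b k).
have w0 k : 0 <= w k by rewrite addr_ge0// mulr_ge0 ?pos_part_ge0 ?neg_part_ge0.
have [C' [C'0 hC']] := laplace_freq_stat c K kappa_ge1 w0.
pose P := \prod_(k < K) (1 + w k) ^+ c.+1.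
have P1 : 1 <= P.
  apply: (@le_trans _ _ (\prod_(k < K) 1)); first by rewrite big1_eq.
  by apply: ler_prod => k _; rewrite ler01 exprn_ege1// lerDl.
near=> m.
have hN : (2 * K < pooled_size (n m))%N by near: m; exact: large_N.
have hbal : forall l, (n m l)%:R^-1 <= kappa / (pooled_size (n m))%:R by near: m; exact: balanced.
have hsq : C' / Num.sqrt (pooled_size (n m))%:R <= e / 2.
  near: m.
  apply: filterS (large_N (Num.truncn ((2 * C' / e) ^+ 2)).+1) => m hm.
  have N0 : 0 < (pooled_size (n m))%:R :> R by rewrite ltr0n (leq_trans _ hm).
  rewrite ler_pdivrMr ?sqrtr_gt0//.
  have q0 : 0 <= 2 * C' / e by rewrite divr_ge0 ?mulr_ge0// ltW.
  have : 2 * C' / e <= Num.sqrt (pooled_size (n m))%:R.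
    rewrite -(ger0_norm q0) -sqrtr_sqr ler_wsqrtr//.
    apply: (le_trans (ltW (truncnS_gt _))); by rewrite ler_nat.
  rewrite ler_pdivrMr// => h; rewrite mulrAC ler_pdivlMr//; lra.
have [hcv htail] : (forall s : {perm obs m}, cvgn (series (fun k => `|b k| * score m s k))) /\
  perm_mean (fun s : {perm obs m} => tail_sum b (score m s) K) <=
  2 * c.+2%:R * kappa * tail_sum b (fun=> 1) K + eta.
  by near: m; exact: tail_bound.
pose X := perm_mean (fun s : {perm obs m} => expR (- \sum_(k < K) w k * score m s k)).
have hX : `|X - P^-1| <= e / 2.
  apply: le_trans hsq; have := hC' _ (@sample_of _ (n m)).
  rewrite card_obs => /(_ hN); rewrite -/P -/X => h.
  have {h} h := h (fun l => _) (fun l => _).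
  apply: le_trans (h _ _).
  - have P0 : 0 < P := lt_le_trans ltr01 P1.
    have -> : X - P^-1 = P^-1 * (P * X - 1) by rewrite mulrBr mulr1 mulKf// gt_eqF.
    rewrite normrM ler_piMl// gtr0_norm ?invr_gt0//.
    by rewrite invf_le1.
  - by move=> l; rewrite label_card_obs ltr0n.
  - by move=> l; rewrite label_card_obs.
set Z := perm_mean _.
have hZ : `|Z - X| <= (i + j) * (2 * c.+2%:R * kappa * eta + eta).
  rewrite /Z /X -perm_meanB; apply: (le_trans (ler_norm_perm_mean _)).
  apply: (@le_trans _ _ (perm_mean (fun s : {perm obs m} => (i + j) * tail_sum b (score m s) K))).
    apply: le_perm_mean => s; apply: laplace_truncation => // k; exact: freq_stat_ge0.
  rewrite perm_meanZ ler_wpM2l//; apply: (le_trans htail); rewrite lerD2r.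
  by rewrite ler_wpM2l// !mulr_ge0.
(* [P^-1] is within [e / 2] of [X], and the two tails cost at most [e / 2] *)
have hL : `|L - P^-1| <= (i + j) * (c.+1%:R * eta).
  apply: (le_trans _ (le_trans (LK K) _)); last by rewrite ler_wpM2l// ler_wpM2l.
  by rewrite /P -prodfV; under [in leRHS]eq_bigr do rewrite -/(w _).
have -> : L - Z = (L - P^-1) - (X - P^-1) - (Z - X) by ring.
apply: (le_trans (ler_normB _ _)).
have h12 := ler_normB (L - P^-1) (X - P^-1).
have hD : D * eta = e / 2 by rewrite /eta; field; rewrite gt_eqF.
have hD2 : (i + j) * (c.+1%:R * eta) + (i + j) * (2 * c.+2%:R * kappa * eta + eta) + eta = D * eta.
  by rewrite /D; ring.
lra.
Unshelve. all: by end_near. Qed.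

Lemma rank_mean_bound : exists Cb, \forall m \near \oo,
  (forall s : {perm obs m}, cvgn (series (fun k => `|b k| * score m s k))) /\
  perm_mean (fun s : {perm obs m} =>
    pos_sum b (score m s) + neg_sum b (score m s)) <= Cb.
Proof.
exists (2 * c.+2%:R * kappa * tail_sum b (fun=> 1) 0 + 1).
apply: filterS (tail_bound 0 ltr01) => m [hcv hm]; split=> //.
rewrite (_ : (fun s => _) = fun s : {perm obs m} => tail_sum b (score m s) 0)//.
by apply/funext => s; apply: pos_neg_sumD => // k; exact: freq_stat_ge0.
Qed.

End RankLimit.

(** The limit operator is total, with a fixed value at divergent sequences, so
    it is enough to make the sequence constant off the convergence set. *)
Lemma measurable_limn (R : realType) d (T : measurableType d) (h : nat -> T -> R) :
  (forall n, measurable_fun setT (h n)) -> measurable_fun setT (fun w => limn (h ^~ w)).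
Proof.
move=> mh; have mG := measurable_cvg_set mh.
set G := [set w | _] in mG.
pose x0 : R := point.
pose h' n w := h n w * \1_G w + x0 * \1_(~` G) w.
apply: (@measurable_fun_cvg _ _ _ _ h') => [n|w _].
  apply: measurable_funD; apply: measurable_funM; rewrite ?mh//; apply: measurable_indic => //.
  exact: measurableC.
have [Gw|nGw] := pselect (G w).
  rewrite (_ : h' ^~ w = h ^~ w)//; apply/funext => n.
  by rewrite /h' !indicE mem_set// memNset ?mulr1 ?mulr0 ?addr0// => /(_ Gw).
rewrite (_ : h' ^~ w = cst x0); first by rewrite dvgP//; exact: cvg_cst.
by apply/funext => n; rewrite /h' !indicE memNset// mem_set// mulr0 mulr1 add0r.
Qed.

(** The limiting proportions are positive, so each sample size is eventually at
    least a fixed fraction of the pooled size, and the weights [1 / n l] are of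
    the order of [1 / N]. *)
Lemma balanced_sizes (R : realType) (c : nat) (n : nat -> 'I_c -> nat) (prop : 'I_c -> R) :
  (forall m l, (0 < n m l)%N) -> (forall l, 0 < prop l) ->
  (forall l, (n m l)%:R / (pooled_size (n m))%:R @[m --> \oo] --> prop l) ->
  exists2 kappa : R, 1 <= kappa & \forall m \near \oo,
    forall l, (n m l)%:R^-1 <= kappa / (pooled_size (n m))%:R.
Proof.
move=> n0 prop0 prop_lim; pose kappa : R := 1 + \sum_(l < c) 2 / prop l.
exists kappa; first by rewrite lerDl sumr_ge0// => l _; rewrite divr_ge0// ltW.
have half l : \forall m \near \oo, prop l / 2 <= (n m l)%:R / (pooled_size (n m))%:R.
  by apply: (cvgr_ge _ (prop_lim l)); have := prop0 l; lra.
have [M _ hM] : \forall m \near \oo, forall l,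
  prop l / 2 <= (n m l)%:R / (pooled_size (n m))%:R := filter_forall _ half.
exists M => // m /hM hm l.
have N0 : 0 < (pooled_size (n m))%:R :> R.
  by rewrite ltr0n /pooled_size (bigD1 l)//= addn_gt0 n0.
have p0 := prop0 l.
have pk : 2 / prop l <= kappa.
  rewrite /kappa (bigD1 l)//= addrCA lerDl addr_ge0// sumr_ge0// => l' _.
  by rewrite divr_ge0// ltW.
rewrite ler_pdivlMr// ler_pdivrMl ?ltr0n// [leRHS]mulrC.
apply: (@le_trans _ _ (2 / prop l * (n m l)%:R)); last by rewrite ler_wpM2r.
rewrite -[leLHS](mulVKf (lt0r_neq0 (divr_gt0 (@ltr0Sn R 1) p0))).
rewrite ler_wpM2l ?divr_ge0 ?(ltW p0)//.
by rewrite invf_div -ler_pdivlMr.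
Qed.

Lemma null_expectation (R : realType) (c : nat) (n : 'I_c -> nat) (phi f : R -> R)
    d (T : measurableType d) (P : probability T R)
    (Theta : forall l : 'I_c, 'I_(n l) -> {RV P >-> R})
    (mu : probability (measurableTypeR R) R) :
  mutually_independent (fun p : {l : 'I_c & 'I_(n l)} => Theta (tag p) (tagged p)) ->
  (forall l i, same_law (distribution P (Theta l i)) mu) ->
  (forall x, mu [set x] = 0%E) ->
  'E_P[f \o (fun w => uniform_scores_stat phi (fun l i => Theta l i w))]%E =
  (perm_mean (fun s : {perm {l : 'I_c & 'I_(n l)}} =>
     f (rank_stat phi (fun p => (enum_rank (s p)).+1))))%:E.
Proof.
move=> indep law na.
rewrite -(expectation_rank indep (fun p => law (tag p) (tagged p)) na
  (fun r => f (rank_stat phi r))).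
by congr expectation; apply/funext => w /=; rewrite uniform_scores_stat_rank.
Qed.

Theorem corollary5p1 (R : realType) (c : nat) (hc : (2 <= c)%N)
    (* kernel *)
    (phi : R -> R)
    (phi_L2 : chebyshev_square_integrable phi)
    (b_0 : chebyshev_coef phi 0 = 0)
    (b_summable : cvgn (series (fun k => `|chebyshev_coef phi k.+1|)))
    (phi_series : forall x : R,
       series (fun k => chebyshev_coef phi k.+1 * cos (k.+1%:R * x)) @ \oo
         --> phi (cos x))
    (delta : R) (delta_gt0 : 0 < delta)
    (b_decay : (fun k : nat => `|chebyshev_coef phi k| : R^o) =O_\oo
       (fun k : nat => k%:R `^ (- (1 + delta)) : R^o))
    (* sample sizes, indexed by the asymptotic parameter m *)
    (n : nat -> 'I_c -> nat)
    (n_ge2 : forall m l, (2 <= n m l)%N)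
    (N_infty : pooled_size (n m) @[m --> \oo] --> \oo)
    (prop : 'I_c -> R)
    (prop_itv : forall l, 0 < prop l < 1)
    (prop_lim : forall l,
       (n m l)%:R / (pooled_size (n m))%:R @[m --> \oo] --> prop l)
    (* population distributions on the circle, identified with [0, 2 pi[ *)
    (Pop : 'I_c -> probability (measurableTypeR R) R)
    (Pop_ac : forall l, Pop l `<< @lebesgue_measure R)
    (* samples *)
    (d : nat -> measure_display) (Omega : forall m, measurableType (d m))
    (Pr : forall m, probability (Omega m) R)
    (Theta : forall (m : nat) (l : 'I_c), 'I_(n m l) -> {RV (Pr m) >-> R})
    (Theta_itv : forall m l (i : 'I_(n m l)) w, 0 <= Theta m l i w < 2 * pi)
    (Theta_law : forall m l (i : 'I_(n m l)),
       same_law (distribution (Pr m) (Theta m l i)) (Pop l))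
    (Theta_indep : forall m, mutually_independent
       (fun p : {l : 'I_c & 'I_(n m l)} => Theta m (tag p) (tagged p)))
    (* null hypothesis *)
    (H0 : forall l1 l2, same_law (Pop l1) (Pop l2))
    (* chi-squared variables of the limit *)
    (d' : measure_display) (Omega' : measurableType d')
    (Q : probability Omega' R) (Y : nat -> {RV Q >-> R})
    (Y_law : forall k,
       same_law (distribution Q (Y k)) (chi2_prob (2 * (c - 1))))
    (Y_indep : mutually_independent Y) :
  let T_partial w := series (fun k => 2^-1 * chebyshev_coef phi k.+1 * Y k w) in
  {ae Q, forall w, cvgn (T_partial w)} /\
  cvg_in_distribution Pr
    (fun m w => uniform_scores_stat phi (fun l i => Theta m l i w))
    Q (fun w => limn (T_partial w)).
Proof.
move=> T_partial; destruct c as [|[|c']] => // {hc}.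
pose beta := chebyshev_coef phi.
have lawY : forall k, same_law (distribution Q (Y k)) (chi2_prob (2 * c'.+1)) := Y_law.
have [A [B [[mA mB] [A0 B0] AB lap [G [mG G0 Gcvg]]]]] :=
  gamma_series_limit lawY Y_indep b_summable.
split.
  exists (~` G); split => //; first exact: measurableC.
  by move=> w /= ncv Gw; apply: ncv; apply: cvgP (Gcvg w Gw).
move=> f cf [F fF].
have F0 : 0 <= F := le_trans (normr_ge0 (f 0)) (fF 0).
have [C C0 [k0 _ decay]] : exists2 C : R, 0 < C &
    \forall k \near \oo, `|beta k| <= C * k%:R `^ (- (1 + delta)).
  move/eqO_exP : b_decay => [C C0 h]; exists C => //.
  apply: filterS h => k; rewrite normr_id => /le_trans; apply.
  by rewrite ler_wpM2l ?(ltW C0)// ger0_norm// powR_ge0.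
have prop0 l : 0 < prop l by have /andP[] := prop_itv l.
have n0 m l : (0 < n m l)%N := ltnW (n_ge2 m l).
have [kappa kappa1 balanced] := balanced_sizes n0 prop0 prop_lim.
have [Cb bound] := rank_mean_bound n0 N_infty kappa1 balanced delta_gt0 (ltW C0) decay b_summable.
pose score m (s : {perm {l : 'I_c'.+2 & 'I_(n m l)}}) k : R :=
  freq_stat (@sample_of _ (n m)) k s.
pose Ap m s := pos_sum (fun k => beta k.+1) (score m s).
pose Bp m s := neg_sum (fun k => beta k.+1) (score m s).
pose E m := perm_mean (fun s : {perm {l : 'I_c'.+2 & 'I_(n m l)}} =>
   f (rank_stat phi (fun p => (enum_rank (s p)).+1))).
have score0 m s k : 0 <= score m s k by exact: freq_stat_ge0.
(* the Chebyshev series of the statistic, summed separately over its two signs *)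
have EE : \forall m \near \oo, E m = perm_mean (fun s => f (Ap m s - Bp m s)).
  apply: filterS bound => m [hcv _]; apply: eq_perm_mean => s; congr f.
  have h1 := cvg_rank_stat (s := s) phi_series.
  have h2 := cvg_signed_sum (score0 m s) (hcv s).
  by rewrite -(cvg_lim (@Rhausdorff R) h1) -(cvg_lim (@Rhausdorff R) h2).
have mf : measurable_fun setT (f : R -> R) by exact: continuous_measurable_fun.
have -> : 'E_Q[f \o (fun w => limn (T_partial w))]%E = (mean Q (fun w => f (A w - B w)))%:E.
  rewrite unlock -EFin_mean; last first.
    apply: (@has_mean_bounded _ _ _ _ _ F) => [|w]; last exact: fF.
    by apply: measurableT_comp => //; exact: measurable_funB.
  apply: (mean_ae_eq (G := G)) => //.
  - apply: measurableT_comp => //; apply: measurable_limn => k.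
    by apply: measurable_sum => j; apply: measurable_funM => //; exact: measurable_cst.
  - by apply: measurableT_comp => //; exact: measurable_funB.
  - by move=> w Gw /=; congr f; apply: cvg_lim; [exact: Rhausdorff|exact: Gcvg].
have -> : (fun m => 'E_(Pr m)[f \o (fun w => uniform_scores_stat phi (fun l i => Theta m l i w))]%E)
    = EFin \o E.
  apply/funext => m; apply: (@null_expectation _ _ _ _ _ _ _ _ (Theta m) (Pop ord0)).
  - exact: Theta_indep.
  - by move=> l i V mV; rewrite (Theta_law m l i)// (H0 l ord0).
  - move=> x; apply: (null_content_dominatesP _ _).1 (Pop_ac ord0) _ _ _ => //.
    exact: lebesgue_measure_set1.
apply: cvg_EFin; first exact: nearW.
pose Cm := Num.max (Num.max Cb 0) (mean Q (fun w => A w + B w)).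
apply: (@cvg_of_laplace R f F Cm E _
  (fun m i j => perm_mean (fun s => expR (- (i%:R * Ap m s + j%:R * Bp m s))))
  (fun i j => mean Q (fun w => expR (- (i%:R * A w + j%:R * B w)))) cf fF).
- by rewrite !le_max lexx orbT.
- move=> s e M e0 M0 approx; split; last first.
    apply: le_trans (mean_exp_sum cf fF mA mB A0 B0 AB M0 approx) _.
    by rewrite lerD2l ler_wpM2l ?mulr_ge0// ler_wpM2r ?invr_ge0 ?(ltW M0)// le_max lexx orbT.
  near=> m.
  have [hcv hm] : (forall s : {perm {l : 'I_c'.+2 & 'I_(n m l)}},
      cvgn (series (fun k => `|beta k.+1| * score m s k))) /\
      perm_mean (fun s => Ap m s + Bp m s) <= Cb by near: m; exact: bound.
  have -> : E m = perm_mean (fun s => f (Ap m s - Bp m s)) by near: m; exact: EE.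
  apply: perm_mean_exp_sum => // [p|p|].
  + exact: pos_sum_ge0.
  + exact: neg_sum_ge0.
  + by apply: (le_trans hm); rewrite !le_max lexx.
- move=> i j; apply: (cvg_rank_laplace n0 N_infty kappa1 balanced delta_gt0 (ltW C0) decay b_summable) => // K.
  exact: lap.
Unshelve. all: by end_near. Qed.
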